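(* Let $(X_n)_{n\ge0}$ be a random walk with $X_0=0$ and i.i.d. steps from a symmetric and absolutely continuous distribution, and let $p_k^{(\beta)}(n)$, $L_k^{(\beta)}(n)$ ($\beta=1,2,3$, $k\ge1$, $n\ge0$) and the constants $p_k^{(1)},p_k^{(2)},C_k^{(1)},C_k^{(2)},C_k^{(3)}$ be as defined in the context. Then for every $k=1,2,\dots$ the following hold. (a) For $\beta=1,2$, $$\sum_{n\ge0}p_k^{(\beta)}(n)e^{-sn}\sim\frac{p_k^{(\beta)}}{s}\qquad\text{as } s\to0^+,$$ and $$\sum_{n\ge0}p_k^{(3)}(n)e^{-sn}\sim\frac1{\sqrt s}\ln\frac1{\sqrt s}\qquad\text{as } s\to0^+.$$ (b) As a consequence, $p_k^{(1)}(n)\to p_k^{(1)}$ as $n\to\infty$; if the sequence $p_k^{(2)}(n)$ converges as $n\to\infty$, then its limit is $p_k^{(2)}$; and if the sequence $\sqrt n\,p_k^{(3)}(n)/\ln n$ converges as $n\to\infty$, then its limit is $1/(2\sqrt\pi)$, that is, $p_k^{(3)}(n)\sim\frac{\ln n}{2\sqrt{\pi n}}$. (c) For $\beta=1,2,3$, $$\sum_{n\ge0}\mathbf E(L_k^{(\beta)}(n))e^{-sn}\sim\frac{C_k^{(\beta)}}{s^2}\qquad\text{as } s\to0^+.$$ (d) Consequently, for $\beta=1,2$, $$\frac{\mathbf E(L_k^{(\beta)}(n))}n\to C_k^{(\beta)}\qquad\text{as } n\to\infty,$$ and if the sequence $\mathbf E(L_k^{(3)}(n))/n$ converges as $n\to\infty$,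 then its limit is $C_k^{(3)}$. In the case $\beta=2$, $k=1$ one has $C_1^{(2)}=\infty$, and the assertions in (c) and (d) are understood as saying that $\mathbf E(L_1^{(2)}(n))=\infty$ for all $n$.
   Context: Setting. $\eta_1,\eta_2,\dots$ are i.i.d. real random variables with a symmetric, absolutely continuous distribution, $X_0=0$, $X_n=X_{n-1}+\eta_n$. Record times: $t_1=0$ and $t_k=t_{k-1}+\min\{\tau>0:X_{t_{k-1}+\tau}>X_{t_{k-1}}\}$ for $k\ge2$. Ages of records: $\tau_k=t_{k+1}-t_k$, $k\ge1$ (an i.i.d. sequence of a.s. finite positive integers). Number of records until time $n$: $R_n=m$ if and only if $t_m\le n<t_{m+1}$. Current age: $A_n=n-t_m$ if $R_n=m$. Given $R_n=m$, define three finite sequences (elements counted with multiplicity): $\mathcal A^{(1)}_{n,m}=(\tau_1,\dots,\tau_{m-1},A_n)$, $\mathcal A^{(2)}_{n,m}=(\tau_1,\dots,\tau_{m})$, $\mathcal A^{(3)}_{n,m}=(\tau_1,\dots,\tau_{m-1})$. For $\beta=1,2,3$, $L_k^{(\beta)}(n)$ is the $k$th largest element of $\mathcal A^{(\beta)}_{n,R_n}$ (equal to $0$ if this sequence has fewer than $k$ elements), and $p_k^{(\beta)}(n)$ is the probability that the last element of $\mathcal A^{(\beta)}_{n,R_n}$ is the $k$th longest one of the sequence, meaning that the sequence is nonempty and exactly $k-1$ of its elements are strictly larger than its last element. Constants. With $\Gamma(\nu,x)=\int_x^\infty e^{-t}t^{\nu-1}\,dt$ and $\gamma(\nu,x)=\int_0^x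 e^{-t}t^{\nu-1}\,dt$, $$p_k^{(1)}=\frac1{2^{k-1}}\int_0^\infty\frac{x^{-1/2}e^{-x}\,\Gamma(-1/2,x)^{k-1}}{(x^{-1/2}e^{-x}+\gamma(1/2,x))^k}\,dx,\qquad p_k^{(2)}=\frac1{2^k}\int_0^\infty\frac{x^{-3/2}(1-e^{-x})\,\Gamma(-1/2,x)^{k-1}}{(x^{-1/2}e^{-x}+\gamma(1/2,x))^k}\,dx,$$ $$C_k^{(1)}=p_k^{(1)},\qquad C_k^{(2)}=\frac1{2^{k-1}}\int_0^\infty\frac{x^{-1/2}\,\Gamma(-1/2,x)^{k-1}}{(x^{-1/2}e^{-x}+\gamma(1/2,x))^k}\,dx,\qquad C_k^{(3)}=\frac1{2^k}\int_0^\infty\frac{\Gamma(-1/2,x)^k}{(x^{-1/2}e^{-x}+\gamma(1/2,x))^k}\,dx.$$ The symbol $\sim$ means that the ratio of the two sides converges to $1$. *)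

(* Defs.v *)
From HB Require Import structures.
From mathcomp Require Import all_boot all_order all_algebra finmap.
From mathcomp Require Import all_classical all_reals all_analysis.

Set Implicit Arguments.
Unset Strict Implicit.
Unset Printing Implicit Defensive.

Import Order.TTheory GRing.Theory Num.Theory.
Import numFieldNormedType.Exports.

Local Open Scope classical_set_scope.
Local Open Scope ring_scope.
Local Open Scope ereal_scope.

Section Steps.
Context {d : measure_display} {T : measurableType d} {R : realType}.
Variable P : probability T R.

Definition mutually_independent (eta : nat -> {RV P >-> R}) :=
  forall (J : {fset nat}) (B : nat -> set R),
    (forall j, measurable (B j)) ->
    P (\bigcap_(j in [set` J]) (eta j @^-1` B j)) =
    \prod_(j <- J) P (eta j @^-1` B j).

Definition identically_distributed (eta : nat -> {RV P >-> R}) :=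
  forall (i j : nat) (B : set R), measurable B ->
    distribution P (eta i) B = distribution P (eta j) B.

Definition symmetric_law (Y : {RV P >-> R}) :=
  forall B : set R, measurable B ->
    distribution P Y B = distribution P Y [set y | B (- y)%R].

Definition abs_continuous_law (Y : {RV P >-> R}) :=
  distribution P Y `<< (@lebesgue_measure R).

(* The step from X_i to X_{i+1} is [eta i], so [eta] is numbered from 0. *)
Definition walk (eta : nat -> {RV P >-> R}) (w : T) (n : nat) : R :=
  (\sum_(i < n) eta i w)%R.

End Steps.

Section Records.
Context {R : realType}.
Implicit Types (x : nat -> R) (n k t : nat).

(* [None] stands for +oo: the minimum of the empty set. *)
Definition first_nat (Q : pred nat) : option nat :=
  match pselect (exists n, Q n) with
  | left exQ => Some (ex_minn exQ)
  | right _ => None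
  end.

Definition next_record x t : option nat :=
  omap (addn t) (first_nat (fun u => (0 < u)%N && (x t < x (t + u)%N)%R)).

(* [record_time x k] is t_k for k >= 1; the value t_0 = 0 is a dummy, chosen
   so that t_0 <= n < t_1 never holds. *)
Fixpoint record_time x k : option nat :=
  match k with
  | 0 => Some 0%N
  | k'.+1 => if k' is 0 then Some 0%N else obind (next_record x) (record_time x k')
  end.

Definition age x k : \bar R :=
  match record_time x k, record_time x k.+1 with
  | Some s, Some t => ((t - s)%N%:R)%:E
  | _, _ => +oo
  end.

Definition is_record_number x n : set nat :=
  [set m | (if record_time x m is Some s then s <= n else false)%N /\
           (if record_time x m.+1 is Some t then n < t else true)%N].

(* Exactly one m satisfies the predicate, so the default 0 is never used. *)
Definition record_number x n : nat := xget 0%N (is_record_number x n).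

Definition current_age x n : \bar R :=
  if record_time x (record_number x n) is Some s then ((n - s)%N%:R)%:E else 0.

Definition ages1 x n : seq (\bar R) :=
  rcons [seq age x i | i <- index_iota 1 (record_number x n)] (current_age x n).

Definition ages2 x n : seq (\bar R) :=
  [seq age x i | i <- index_iota 1 (record_number x n).+1].

Definition ages3 x n : seq (\bar R) :=
  [seq age x i | i <- index_iota 1 (record_number x n)].

Definition kth_largest k (s : seq (\bar R)) : \bar R :=
  nth 0 (sort (fun a b => b <= a) s) k.-1.

Definition last_is_kth_longest k (s : seq (\bar R)) : bool :=
  (s != [::]) && (count (fun a => last 0 s < a) s == k.-1).

End Records.

Section Averages.
Context {d : measure_display} {T : measurableType d} {R : realType}.
Variables (P : probability T R) (eta : nat -> {RV P >-> R}).
Variable ages : (nat -> R) -> nat -> seq (\bar R).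

Definition prob_last_kth (k n : nat) : R :=
  fine (P [set w | last_is_kth_longest k (ages (walk eta w) n)]).

(* The library's expectation takes real-valued functions only, whereas an age
   may be +oo (on a null set). *)
Definition mean_kth_largest (k n : nat) : \bar R :=
  \int[P]_w kth_largest k (ages (walk eta w) n).

End Averages.

Section Asymptotics.
Context {R : realType}.

Definition laplace (u : nat -> \bar R) (s : R) : \bar R :=
  \sum_(0 <= n <oo) u n * (expR (- (s * n%:R)))%:E.

(* Since 0^-1 = +oo and +oo^-1 = 0 in \bar R, if g is 0 (resp. +oo) near 0+
   then the ratio is 0 or an infinity there, and the equivalence fails. *)
Definition equiv_at0 (f g : R -> \bar R) : Prop :=
  f s / g s @[s --> (0 : R)^'+] --> (1 : \bar R).

End Asymptotics.

Section Constants.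
Context {R : realType}.
Local Notation leb := (@lebesgue_measure R).

Definition upper_gamma (nu x : R) : R :=
  (\int[leb]_(t in `]x, +oo[) (expR (- t) * t `^ (nu - 1)))%R.

Definition lower_gamma (nu x : R) : R :=
  (\int[leb]_(t in `]0%R, x[) (expR (- t) * t `^ (nu - 1)))%R.

Definition denominator (x : R) : R :=
  (x `^ (- 2^-1) * expR (- x) + lower_gamma 2^-1 x)%R.

Definition p1_const (k : nat) : \bar R :=
  ((2 ^+ k.-1)^-1)%:E * \int[leb]_(x in `]0%R, +oo[)
    (x `^ (- 2^-1) * expR (- x) * upper_gamma (- 2^-1) x ^+ k.-1
     / denominator x ^+ k)%:E.

Definition p2_const (k : nat) : \bar R :=
  ((2 ^+ k)^-1)%:E * \int[leb]_(x in `]0%R, +oo[)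
    (x `^ (- (3 / 2)) * (1 - expR (- x)) * upper_gamma (- 2^-1) x ^+ k.-1
     / denominator x ^+ k)%:E.

Definition C1_const (k : nat) : \bar R := p1_const k.

Definition C2_const (k : nat) : \bar R :=
  ((2 ^+ k.-1)^-1)%:E * \int[leb]_(x in `]0%R, +oo[)
    (x `^ (- 2^-1) * upper_gamma (- 2^-1) x ^+ k.-1 / denominator x ^+ k)%:E.

Definition C3_const (k : nat) : \bar R :=
  ((2 ^+ k)^-1)%:E * \int[leb]_(x in `]0%R, +oo[)
    (upper_gamma (- 2^-1) x ^+ k / denominator x ^+ k)%:E.

End Constants.

(* Main.v *)
(** Let q(n) be the probability that the walk has no record during its first n
    steps.  Reversing time and changing signs (ties are null events, the law of
    the steps being absolutely continuous) shows that q(n) is also the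
    probability of a record at time n; cutting the path at its last record then
    gives q * q = 1, whence q(n) = prod_(i < n) (2i + 1) / (2i + 2).  The ages of
    the records are i.i.d. of law f(l) = q(l - 1) - q(l).  Write z = e^(-s),
    Q = sum_n q(n) z^n = (1 - z)^(-1/2), G_b = sum_(l > b) f(l) z^l and
    D_b = 1 - sum_(l <= b) f(l) z^l.  The sequence of probabilities that n is a
    record time and that k of the preceding ages exceed b has generating function
    G_b^k / D_b^(k+1).  As E L_k is the sum over j of the probabilities that at
    least k ages exceed j, all six Laplace transforms become explicit series such
    as sum_a q(a) z^a G_a^(k-1) / D_a^k.

    After multiplication by s, and except for p_k^(3), these series are Riemann
    sums of mesh s; they converge by dominated convergence because
    sqrt n * q(n) has a limit, which cancels out.  For p_k^(3) the identity
    f(l) z^l = D_(l-1) - D_l makes the series telescope to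
    ln (1 / (D_b at b = oo)) + O(1).

    The limits of p_k^(1)(n) and of E L_k(n) / n for the first two sequences
    follow from Karamata's theorem (E L_k^(1) has increments p_k^(1), and
    E L_k^(2) is nondecreasing), together with the slow oscillation of p_k^(1).
    The conditional limits follow from the Abelian theorem. *)

Require Import Defs.
From HB Require Import structures.
From mathcomp Require Import all_boot all_order all_algebra finmap.
From mathcomp Require Import all_classical all_reals all_analysis.
From mathcomp Require Import measurable_realfun gauss_integral.
From mathcomp Require Import ring lra zify.

Import Order.TTheory GRing.Theory Num.Theory.
Import numFieldNormedType.Exports.

Local Open Scope classical_set_scope.
Local Open Scope ring_scope.

Set Implicit Arguments.
Unset Strict Implicit.

(** * The law of the age of a record *)

(** Analysis and probability meet in a single interface, [tail_weights]: generating functions,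
    limits and oscillation are treated for any weights obeying that recursion, and the walk enters
    only when [tails] is shown to obey it and the six sequences are expressed through it. Record
    times may be infinite, so the probabilistic side works at a fixed time n with the finite [state]
    (completed ages, current age), a function of the first n steps; independence of what precedes
    and what follows the last record becomes a statement about sets of step sequences.

    Karamata's theorem only yields limits of averages. These suffice for E L_k^(1) and E L_k^(2),
    whose increments are nonnegative, but for p_k^(1)(n) regularity has to be proved by hand. Its
    formula is a convolution in which the threshold on the ages is the summation index itself; the
    point is to control the effect of moving this threshold from a to a + h, which is at most the
    mass that f puts on that window. No such regularity is established for p_k^(2), p_k^(3) and E
    L_k^(3), hence the conditional form of their limits. *)

Section StaySequence.
Context {R : realType}.
Implicit Types (n l i : nat).

(* [qs n] is the probability q(n) of no record during [n] steps, and [fs l] the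
   probability f(l) that a record has age [l]; [fs 0 = 0]. *)
Definition qs n : R := \prod_(i < n) ((2 * i%:R + 1) / (2 * i%:R + 2)).

Definition fs l : R := if l is l'.+1 then qs l' - qs l else 0.

Lemma qs0 : qs 0 = 1. Proof. by rewrite /qs big_ord0. Qed.

Lemma qsS n : qs n.+1 = qs n * ((2 * n%:R + 1) / (2 * n%:R + 2)).
Proof. by rewrite /qs big_ord_recr. Qed.

Lemma qsSE n : (2 * n%:R + 2) * qs n.+1 = (2 * n%:R + 1) * qs n.
Proof.
rewrite qsS.
have : (2 * n%:R + 2 : R) != 0 by have := ler0n R n; lra.
by move=> ?; field.
Qed.

Lemma qs_gt0 n : 0 < qs n.
Proof.
by elim: n => [|n ih]; rewrite ?qs0// qsS mulr_gt0// divr_gt0 //; have := ler0n R n; lra.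
Qed.

Lemma qs_ge0 n : 0 <= qs n. Proof. exact/ltW/qs_gt0. Qed.
Hint Resolve qs_ge0 qs_gt0 : core.

Lemma fsS l : fs l.+1 = qs l / (2 * l%:R + 2).
Proof.
rewrite /fs qsS.
have : (2 * l%:R + 2 : R) != 0 by have := ler0n R l; lra.
by move=> ?; field.
Qed.

Lemma fs_ge0 l : 0 <= fs l.
Proof. by case: l => [//|l]; rewrite fsS divr_ge0// addr_ge0// mulr_ge0. Qed.

Lemma qs_nonincr m n : (m <= n)%N -> qs n <= qs m.
Proof.
move=> /subnK <-; elim: (n - m)%N => [//|k ih]; apply: le_trans ih.
by rewrite addSn -subr_ge0; exact: (fs_ge0 (k + m).+1).
Qed.

Lemma qs_le1 n : qs n <= 1. Proof. by rewrite -qs0 qs_nonincr. Qed.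

Lemma fs_sum m n : (m <= n)%N -> \sum_(m.+1 <= l < n.+1) fs l = qs m - qs n.
Proof.
move=> mn; rewrite big_add1 /= -opprB -telescope_sumr// -sumrN.
by apply: eq_bigr => i _; rewrite opprB.
Qed.

Lemma conv_rev (u v : nat -> R) n :
  \sum_(i < n.+1) u i * v (n - i)%N = \sum_(i < n.+1) u (n - i)%N * v i.
Proof.
rewrite (reindex_inj rev_ord_inj); apply: eq_bigr => i _ /=.
by rewrite subSS subKn// -ltnS.
Qed.

(** Here q(n) is the central binomial coefficient C(2n, n) divided by 4^n. Reflecting the index
    shows that i has mean n / 2 under the weights q(i) q(n - i) ([E]); with (i + 1) q(i + 1) = (i +
    1/2) q(i), this carries the value 1 from n to n + 1. *)
Lemma qs_conv n : \sum_(i < n.+1) qs i * qs (n - i)%N = 1.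
Proof.
elim: n => [|n ih]; first by rewrite big_ord_recr big_ord0 /= qs0 add0r mul1r.
pose c := \sum_(i < n.+2) qs i * qs (n.+1 - i)%N.
have E m : 2 * \sum_(i < m.+1) i%:R * (qs i * qs (m - i)%N)
    = m%:R * \sum_(i < m.+1) qs i * qs (m - i)%N.
  have H : \sum_(i < m.+1) i%:R * (qs i * qs (m - i)%N) =
      \sum_(i < m.+1) (m - i)%:R * (qs i * qs (m - i)%N).
    under eq_bigr do rewrite mulrA.
    rewrite (conv_rev (fun i => i%:R * qs i)); apply: eq_bigr => i _.
    by rewrite -mulrA; congr (_ * _); rewrite mulrC.
  rewrite mulr_natl mulr2n [X in _ + X]H -big_split mulr_sumr /=.
  apply: eq_bigr => i _; rewrite -mulrDl -natrD subnKC //.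
  by rewrite -ltnS.
have F : n.+1%:R * c = n.+1%:R.
  rewrite -E big_ord_recl /= mul0r add0r.
  rewrite (eq_bigr (fun i : 'I_n.+1 =>
      i%:R * (qs i * qs (n - i)%N) + 2^-1 * (qs i * qs (n - i)%N))); last first.
    move=> i _; rewrite /bump /= add1n subSS -natr1.
    transitivity (i.+1%:R * qs i.+1 * qs (n - i)%N); first by rewrite -mulrA natr1.
    transitivity ((i%:R + 2^-1) * qs i * qs (n - i)%N); last by ring.
    by congr (_ * _); have := qsSE i; rewrite -(natr1 i); lra.
  rewrite big_split /= mulrDr E -mulr_sumr ih -(natr1 n); lra.
have : n.+1%:R * (c - 1) = 0 by rewrite mulrBr F mulr1 subrr.
by move/eqP; rewrite mulf_eq0 pnatr_eq0 /= subr_eq0 => /eqP.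
Qed.

Lemma conv_ends (u v : nat -> R) n : \sum_(i < n.+2) u i * v (n.+1 - i)%N =
  u 0%N * v n.+1 + \sum_(i < n) u i.+1 * v (n - i)%N + u n.+1 * v 0%N.
Proof.
rewrite big_ord_recr big_ord_recl /= subn0 subnn; congr (_ + _ + _).
Qed.

(** The equation of index n + 1 is affine in q(n + 1), with slope 2 q(0), so the sequence is
    determined by q(0); the sign hypothesis selects the root 1 of q(0)^2 = 1. *)
Lemma conv1_unique (q : nat -> R) : 0 <= q 0%N ->
  (forall n, \sum_(i < n.+1) q i * q (n - i)%N = 1) -> q =1 qs.
Proof.
move=> q0 qq.
have q01 : q 0%N = 1.
  have := qq 0%N; rewrite big_ord_recr big_ord0 /= add0r -expr2 => /eqP.
  by rewrite sqrp_eq1// => /eqP.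
elim/ltn_ind => -[|n] ih; first by rewrite q01 qs0.
have := qs_conv n.+1; rewrite -(qq n.+1) !conv_ends q01 qs0.
rewrite [in X in _ = X](eq_bigr (fun i : 'I_n => qs i.+1 * qs (n - i)%N)); last first.
  move=> i _ /=; rewrite !ih// ltnS ?leq_subr//.
by rewrite ?mul1r ?mulr1; lra.
Qed.

Lemma qs1 : qs 1 = 2^-1.
Proof. by rewrite qsS qs0 mulr0 !add0r !mul1r. Qed.

Lemma qs_sum n : \sum_(i < n) qs i = 2 * n%:R * qs n.
Proof.
elim: n => [|n ih]; first by rewrite big_ord0 mulr0 mul0r.
rewrite big_ord_recr /= ih -(natr1 n); have := qsSE n; lra.
Qed.

(** Wallis's argument: (2n + 1) q(n)^2 decreases, while n q(n)^2 increases ([qs_sqr_mono]). The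
    first gives the upper bound on q(n), the second the lower bound and the existence of the limit
    of sqrt n * q(n). *)
Lemma qs_sqr_le n : (2 * n%:R + 1) * qs n ^+ 2 <= 1.
Proof.
elim: n => [|n ih]; first by rewrite qs0 mulr0 add0r mul1r expr1n.
suff : (2 * n.+1%:R + 1) * qs n.+1 ^+ 2 <= (2 * n%:R + 1) * qs n ^+ 2.
  by move=> /le_trans; apply.
rewrite qsS -(natr1 n).
set x : R := n%:R; have x0 : 0 <= x by rewrite ler0n.
rewrite exprMn [qs n ^+ 2 * _]mulrC [_ * (_ * qs n ^+ 2)]mulrA ler_pM2r ?exprn_gt0//.
rewrite expr_div_n mulrA ler_pdivrMr; last by rewrite exprn_gt0//; lra.
nra.
Qed.

Lemma qs_sqr_mono m n : (m <= n)%N -> m%:R * qs m ^+ 2 <= n%:R * qs n ^+ 2.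
Proof.
move=> /subnK <-; elim: (n - m)%N => [//|k]; move=> /le_trans; apply.
rewrite addSn; move: (k + m)%N => {m n}n.
suff : n%:R * qs n ^+ 2 <= n.+1%:R * qs n.+1 ^+ 2 by [].
rewrite qsS -(natr1 n).
set x : R := n%:R; have x0 : 0 <= x by rewrite ler0n.
rewrite exprMn [qs n ^+ 2 * _]mulrC [_ * (_ * qs n ^+ 2)]mulrA ler_pM2r ?exprn_gt0//.
rewrite expr_div_n mulrA ler_pdivlMr; last by rewrite exprn_gt0//; lra.
nra.
Qed.

Lemma qs_le n : qs n <= (Num.sqrt (2 * n%:R + 1))^-1.
Proof.
have x0 : 0 < 2 * n%:R + 1 :> R by have := ler0n R n; lra.
rewrite -[leLHS]ger0_norm// -sqrtr_sqr -sqrtrV ?(ltW x0)//; apply: ler_wsqrtr.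
by rewrite -[leRHS]div1r ler_pdivlMr// mulrC qs_sqr_le.
Qed.

Lemma qs_ge n : (0 < n)%N -> (2 * Num.sqrt n%:R)^-1 <= qs n.
Proof.
move=> n0; have n0' : 0 < n%:R :> R by rewrite ltr0n.
have := @qs_sqr_mono 1 n n0.
rewrite qs1 mul1r => h.
have {h} : Num.sqrt (4^-1) <= Num.sqrt (n%:R * qs n ^+ 2).
  by apply: ler_wsqrtr; lra.
rewrite sqrtrM ?ler0n// sqrtr_sqr ger0_norm//.
have -> : 4^-1 = 2^-1 ^+ 2 :> R by lra.
rewrite sqrtr_sqr ger0_norm ?invr_ge0// => h.
by rewrite invfM mulrC ler_pdivrMl ?sqrtr_gt0.
Qed.

End StaySequence.
#[global] Hint Extern 0 (is_true (0 <= qs _)) => solve [apply: qs_ge0] : core.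
#[global] Hint Extern 0 (is_true (0 < qs _)) => solve [apply: qs_gt0] : core.
#[global] Hint Extern 0 (is_true (0 <= fs _)) => solve [apply: fs_ge0] : core.

(** * Generating functions *)

Section GeneratingFunctions.
Context {R : realType}.
Implicit Types (u v : nat -> R) (z : R) (n k : nat).

Lemma nneseries_diag (w : nat -> nat -> \bar R) : (forall i j, 0 <= w i j)%E ->
  (\sum_(0 <= n <oo) \sum_(i < n.+1) w i (n - i)%N =
   \sum_(0 <= i <oo) \sum_(0 <= j <oo) w i j)%E.
Proof.
move=> w0.
transitivity (\sum_(0 <= n <oo) \sum_(0 <= i <oo)
    (if (i <= n)%N then w i (n - i)%N else 0))%E.
  apply: eq_eseriesr => n _.
  rewrite (@nneseries_split _ _ 0%N n.+1); last by move=> k _; case: ifP.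
  rewrite add0n [X in (_ + X)%E]eseries0 ?adde0; last first.
    by move=> i ni _; rewrite leqNgt ni.
  rewrite big_mkord; apply: eq_bigr => i _.
  by rewrite -ltnS ltn_ord.
rewrite nneseries_interchange; last by move=> i j; case: ifP.
apply: eq_eseriesr => i _.
rewrite (@nneseries_split _ _ 0%N i); last by move=> k _; case: ifP.
rewrite add0n big_nat_cond big1 ?add0e; last first.
  by move=> j /andP[/andP[_ ji] _]; rewrite leqNgt ji.
rewrite -nneseries_addn; last by move=> k; case: ifP.
by apply: eq_eseriesr => j _; rewrite leq_addl addnK.
Qed.

Definition gf u z : \bar R := (\sum_(0 <= n <oo) (u n * z ^+ n)%:E)%E.

Definition conv u v n : R := \sum_(i < n.+1) u i * v (n - i)%N.

Lemma laplaceE u s : laplace (fun n => (u n)%:E) s = gf u (expR (- s)).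
Proof.
by apply: eq_eseriesr => n _; rewrite -EFinM -mulNr expRM_natr.
Qed.

Section FixedPoint.
Variable z : R.
Hypotheses (z0 : 0 <= z) (z1 : z < 1).

Lemma gf_ge0 u : (forall n, 0 <= u n) -> (0 <= gf u z)%E.
Proof. by move=> u0; apply: nneseries_ge0 => n _ _; rewrite lee_fin mulr_ge0// exprn_ge0. Qed.

Lemma le_gf u v : (forall n, 0 <= u n) -> (forall n, u n <= v n) ->
  (gf u z <= gf v z)%E.
Proof.
move=> u0 uv; apply: lee_nneseries => [n _ _|n _].
  by rewrite lee_fin mulr_ge0// exprn_ge0.
by rewrite lee_fin ler_wpM2r// exprn_ge0.
Qed.

Lemma gfD u v : (forall n, 0 <= u n) -> (forall n, 0 <= v n) ->
  gf (fun n => u n + v n) z = (gf u z + gf v z)%E.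
Proof.
move=> u0 v0; rewrite /gf -nneseriesD.
- by apply: eq_eseriesr => n _; rewrite -EFinD mulrDl.
- by move=> n _ _; rewrite lee_fin mulr_ge0// exprn_ge0.
- by move=> n _ _; rewrite lee_fin mulr_ge0// exprn_ge0.
Qed.

Lemma gfZ c u : (forall n, 0 <= u n) ->
  gf (fun n => c * u n) z = (c%:E * gf u z)%E.
Proof.
move=> u0; rewrite /gf -nneseriesZl.
- by apply: eq_eseriesr => n _; rewrite -EFinM mulrA.
- by move=> n _; rewrite lee_fin mulr_ge0// exprn_ge0.
Qed.

Lemma gf1 : gf (fun=> 1) z = ((1 - z)^-1)%:E.
Proof.
rewrite /gf; apply/cvg_lim => //.
have := @cvg_geometric_series R 1 z; rewrite ger0_norm// => /(_ z1).
rewrite div1r => h.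
have {}h : (EFin \o series (geometric 1 z)) n @[n --> \oo] --> ((1 - z)^-1)%:E.
  by apply: cvg_EFin => //; exact: nearW.
rewrite (_ : (fun n => _) = EFin \o series (geometric 1 z))//.
by apply/funext => n; rewrite /= /series sumEFin.
Qed.

Lemma gf_lty u : (forall n, 0 <= u n) -> (forall n, u n <= 1) -> (gf u z < +oo)%E.
Proof.
move=> u0 u1; have := @le_gf u (fun=> 1) u0 u1; move=> /le_lt_trans; apply.
by rewrite gf1 ltry.
Qed.

Lemma gf_fin u : (forall n, 0 <= u n) -> (forall n, u n <= 1) ->
  gf u z \is a fin_num.
Proof. by move=> u0 u1; rewrite ge0_fin_numE ?gf_lty// gf_ge0. Qed.

(** The second factor may depend on the index of the first: for p_k^(1) and p_k^(3) the threshold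
    imposed on the earlier ages is the last age of the sequence, over which the sum runs. *)
Lemma gf_conv2 (w : nat -> nat -> R) (u : nat -> R) :
  (forall i, 0 <= u i) -> (forall i n, 0 <= w i n) ->
  gf (fun n => \sum_(i < n.+1) u i * w i (n - i)%N) z =
  (\sum_(0 <= i <oo) (u i * z ^+ i)%:E * gf (w i) z)%E.
Proof.
move=> u0 w0.
have uw0 i j : (0 <= (u i * z ^+ i)%:E * (w i j * z ^+ j)%:E)%E.
  by rewrite -EFinM lee_fin !mulr_ge0// exprn_ge0.
transitivity (\sum_(0 <= n <oo) \sum_(i < n.+1)
  ((u i * z ^+ i)%:E * (w i (n - i)%N * z ^+ (n - i)%N)%:E))%E.
  apply: eq_eseriesr => n _; rewrite mulr_suml -sumEFin.
  apply: eq_bigr => i _; rewrite -EFinM; congr EFin.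
  have e : (i <= n)%N by rewrite -ltnS.
  have -> : z ^+ n = z ^+ i * z ^+ (n - i)%N by rewrite -exprD subnKC.
  by ring.
rewrite (nneseries_diag (w := fun i j => (u i * z ^+ i)%:E * (w i j * z ^+ j)%:E)%E)//.
apply: eq_eseriesr => i _; rewrite -nneseriesZl// => j _.
by rewrite lee_fin mulr_ge0// exprn_ge0.
Qed.

Lemma gf_conv u v : (forall n, 0 <= u n) -> (forall n, 0 <= v n) ->
  gf v z \is a fin_num -> gf (conv u v) z = (gf u z * gf v z)%E.
Proof.
move=> u0 v0 vfin; rewrite (gf_conv2 (w := fun=> v))// -(fineK vfin).
under eq_eseriesr do rewrite muleC.
rewrite nneseriesZl 1?muleC// => n _.
by rewrite lee_fin mulr_ge0// exprn_ge0.
Qed.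

Lemma gf_recl u : (forall n, 0 <= u n) ->
  gf u z = ((u 0%N)%:E + z%:E * gf (fun n => u n.+1) z)%E.
Proof.
move=> u0; have uz0 n : (0 <= (u n * z ^+ n)%:E)%E.
  by rewrite lee_fin mulr_ge0// exprn_ge0.
rewrite /gf nneseries_recl// expr0 mulr1 -nneseriesZl; last first.
  by move=> n _; rewrite lee_fin mulr_ge0// exprn_ge0.
congr (_ + _)%E; rewrite -(nneseries_addn 1)//.
by apply: eq_eseriesr => n _; rewrite addn1 exprS -EFinM; congr EFin; ring.
Qed.

End FixedPoint.

Lemma fs_le1 l : fs l <= 1 :> R.
Proof. by case: l => [//|l] /=; rewrite lerBlDr ler_wpDr ?qs_ge0 ?qs_le1. Qed.
Hint Resolve fs_le1 : core.

(** Since f(i + 1) = q(i) - q(i + 1), the left side is a difference of two convolutions of [qs] with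
    itself; both would be 1, but the second lacks its term of index 0, which is q(n + 1). *)
Lemma renewal n : conv fs qs n.+1 = qs n.+1 :> R.
Proof.
rewrite /conv big_ord_recl mul0r add0r.
have h m := @qs_conv R m.
have h1 := h n.+1; rewrite big_ord_recl /= qs0 mul1r subn0 in h1.
rewrite (eq_bigr (fun i : 'I_n.+1 =>
  qs i * qs (n - i)%N - qs i.+1 * qs (n.+1 - i.+1)%N)); last first.
  by move=> i _; rewrite /= /bump /= add1n subSS mulrBl.
by rewrite sumrB h -[in X in X - _]h1 addrK.
Qed.

Section StayGF.
Variable z : R.
Hypotheses (z0 : 0 <= z) (z1 : z < 1).

Lemma gf_qs : gf qs z = ((Num.sqrt (1 - z))^-1)%:E.
Proof.
have qfin : gf qs z \is a fin_num by apply: gf_fin => // n; exact: qs_le1.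
have : (gf qs z * gf qs z = ((1 - z)^-1)%:E)%E.
  rewrite -gf_conv// -gf1//; apply: eq_eseriesr => n _.
  by rewrite /conv qs_conv.
rewrite -(fineK qfin) -EFinM => -[] /esym h; congr EFin.
rewrite -sqrtrV ?subr_ge0 ?(ltW z1)//.
rewrite h -expr2 sqrtr_sqr ger0_norm//.
by rewrite fine_ge0// gf_ge0.
Qed.

(* [Dinf], [Dn b] and [Gn b] are 1 / Q, D_b and G_b. *)
Definition Dinf : R := Num.sqrt (1 - z).

Lemma Dinf_gt0 : 0 < Dinf. Proof. by rewrite sqrtr_gt0 subr_gt0. Qed.

Lemma Dinf_sqr : Dinf ^+ 2 = 1 - z. Proof. by rewrite sqr_sqrtr// subr_ge0 ltW. Qed.

(** The differences defining f give the transform 1 - (1 - z) Q, and (1 - z) Q = 1 / Q. *)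
Lemma gf_fs : gf fs z = (1 - Dinf)%:E.
Proof.
have e : (z%:E * gf qs z = gf (fun n => qs n.+1) z * z%:E + gf fs z)%E.
  rewrite [gf fs _]gf_recl// add0e [X in (X + _)%E]muleC -ge0_muleDr ?gf_ge0//.
  by congr (_ * _)%E; rewrite -gfD//; apply: eq_eseriesr => n _; rewrite /= addrC subrK.
have ffin : gf fs z \is a fin_num by exact: gf_fin.
have gfin : gf (fun n => qs n.+1) z \is a fin_num.
  by apply: gf_fin => // n; exact: qs_le1.
have e2 := @gf_recl z z0 qs (fun n => qs_ge0 n).
move: e e2; rewrite gf_qs -(fineK ffin) -(fineK gfin) -!EFinM -!EFinD.
rewrite qs0 => -[e] [e2]; congr EFin.
have D0 := Dinf_gt0; have Dq := Dinf_sqr; rewrite -/Dinf in e e2.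
have : Dinf^-1 * (1 - z) = Dinf.
  by rewrite -Dq expr2 mulrA mulVf ?mul1r// gt_eqF.
lra.
Qed.

Definition Dn b : R := 1 - \sum_(l < b.+1) fs l * z ^+ l.

Definition Gn b : R := Dn b - Dinf.

Definition fs_low b l : R := if (l <= b)%N then fs l else 0.

Definition fs_high b l : R := if (l <= b)%N then 0 else fs l.

Lemma gf_low b : gf (fs_low b) z = (1 - Dn b)%:E.
Proof.
rewrite /gf (@nneseries_split _ _ 0%N b.+1); last first.
  by move=> k _; rewrite lee_fin mulr_ge0 ?exprn_ge0// /fs_low; case: ifP.
rewrite add0n [X in (_ + X)%E]eseries0 ?adde0; last first.
  by move=> i bi _; rewrite /fs_low leqNgt bi mul0r.
rewrite sumEFin /Dn opprB addrC subrK big_mkord; congr EFin.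
by apply: eq_bigr => i _; rewrite /fs_low -ltnS ltn_ord.
Qed.

Lemma gf_high b : gf (fs_high b) z = (Gn b)%:E.
Proof.
have l0 n : 0 <= fs_low b n by rewrite /fs_low; case: ifP.
have h0 n : 0 <= fs_high b n by rewrite /fs_high; case: ifP.
have h1 n : fs_high b n <= 1 by rewrite /fs_high; case: ifP => // _; exact: ler01.
have : gf fs z = (gf (fs_low b) z + gf (fs_high b) z)%E.
  rewrite -gfD//; apply: eq_eseriesr => n _.
  by rewrite /fs_low /fs_high; case: ifP => _; rewrite ?addr0 ?add0r.
rewrite gf_fs gf_low -(fineK (gf_fin z0 z1 h0 h1)) -EFinD => -[h].
by congr EFin; rewrite /Gn; lra.
Qed.

Lemma Gn_ge0 b : 0 <= Gn b.
Proof.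
by rewrite -lee_fin -gf_high gf_ge0// => n; rewrite /fs_high; case: ifP.
Qed.

Lemma Dn_ge b : Dinf <= Dn b. Proof. by have := Gn_ge0 b; rewrite /Gn subr_ge0. Qed.

Lemma Dn_gt0 b : 0 < Dn b. Proof. exact: lt_le_trans Dinf_gt0 (Dn_ge b). Qed.

Lemma Gn_le_Dn b : Gn b <= Dn b.
Proof. by rewrite /Gn gerBl ltW// Dinf_gt0. Qed.

Lemma Dn0 : Dn 0 = 1.
Proof. by rewrite /Dn big_ord_recl big_ord0 mul0r !addr0 subr0. Qed.

Lemma DnS b : Dn b.+1 = Dn b - fs b.+1 * z ^+ b.+1.
Proof. by rewrite /Dn [in LHS]big_ord_recr /= opprD addrA. Qed.

(** Summation by parts. All terms are now nonnegative, which gives the lower bound [Dn_ge_qs]; in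
    the scaling limit the first becomes x^(-1/2) e^(-x) and the sum becomes gamma(1/2, x), the two
    parts of [denominator]. *)
Lemma Dn_abel b : Dn b = qs b * z ^+ b + (1 - z) * \sum_(l < b) qs l * z ^+ l.
Proof.
elim: b => [|b ih]; first by rewrite Dn0 big_ord0 mulr0 addr0 qs0 mul1r.
by rewrite DnS ih big_ord_recr /= exprS; ring.
Qed.

Lemma Dn_ge_qs b : qs b * z ^+ b <= Dn b.
Proof.
rewrite Dn_abel lerDl mulr_ge0//; first by rewrite subr_ge0 ltW.
by rewrite sumr_ge0// => i _; rewrite mulr_ge0// exprn_ge0.
Qed.

End StayGF.

(* [T b k n] stands for the probability that [n] is a record time and that at
   least [k] of the ages completed by then exceed [b]. *)
Definition tail_weights (T : nat -> nat -> nat -> R) :=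
  (forall b, T b 0%N =1 qs) /\
  (forall b k n, T b k.+1 n =
     \sum_(i < n.+1) fs i * T b (if (i <= b)%N then k.+1 else k) (n - i)%N).

Definition exact_weights (T : nat -> nat -> nat -> R) b k n : R :=
  T b k n - T b k.+1 n.

Section TailWeights.
Variable T : nat -> nat -> nat -> R.
Hypothesis Tw : tail_weights T.

Lemma tail0 b n : T b 0 n = qs n. Proof. by case: Tw => ->. Qed.

Lemma tailS b k n : T b k.+1 n =
  \sum_(i < n) fs i.+1 * T b (if (i < b)%N then k.+1 else k) (n - i.+1)%N.
Proof. by case: Tw => _ ->; rewrite big_ord_recl mul0r add0r. Qed.

Lemma renewalS n : qs n.+1 = \sum_(i < n.+1) fs i.+1 * qs (n.+1 - i.+1)%N :> R.
Proof. by rewrite -renewal /conv big_ord_recl mul0r add0r. Qed.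

Lemma tail_ge0 b k n : 0 <= T b k n.
Proof.
elim/ltn_ind: n k => n ih [|k]; first by rewrite tail0.
by rewrite tailS sumr_ge0// => i _; rewrite mulr_ge0//; apply: ih; have := ltn_ord i; lia.
Qed.

Lemma tail_le b k n : T b k n <= qs n.
Proof.
elim/ltn_ind: n k => -[|n] ih [|k]; rewrite ?tail0//; rewrite tailS; first by rewrite big_ord0.
rewrite renewalS; apply: ler_sum => i _; apply: ler_wpM2l => //.
by apply: ih; have := ltn_ord i; lia.
Qed.

Lemma tail_anti b k n : T b k.+1 n <= T b k n.
Proof.
elim/ltn_ind: n k => n ih [|k]; first by rewrite tail0 tail_le.
rewrite !tailS; apply: ler_sum => i _; apply: ler_wpM2l => //.
by case: ifP => _; apply: ih; have := ltn_ord i; lia.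
Qed.

Lemma exact_ge0 b k n : 0 <= exact_weights T b k n.
Proof. by rewrite subr_ge0 tail_anti. Qed.

Lemma exact_le b k n : exact_weights T b k n <= qs n.
Proof. by rewrite lerBlDr ler_wpDr// ?tail_ge0// tail_le. Qed.

Section TailGF.
Variable z : R.
Hypotheses (z0 : 0 <= z) (z1 : z < 1).

(** Splitting off one age according to whether it exceeds b gives T_(k+1) = (1 - D_b) T_(k+1) + G_b
    T_k for the transforms, so each unit of k costs a factor G_b / D_b, starting from Q. *)
Lemma gf_tail b k :
  gf (T b k) z = ((Dinf z)^-1 * (Gn z b / Dn z b) ^+ k)%:E.
Proof.
elim: k => [|k ih].
  by rewrite expr0 mulr1 -gf_qs//; apply: eq_eseriesr => n _; rewrite tail0.
have l0 n : 0 <= fs_low b n by rewrite /fs_low; case: ifP.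
have h0 n : 0 <= fs_high b n by rewrite /fs_high; case: ifP.
have t1 j n : T b j n <= 1 by apply: le_trans (qs_le1 n); exact: tail_le.
have fin j : gf (T b j) z \is a fin_num.
  by apply: gf_fin => // n; exact: tail_ge0.
have : gf (T b k.+1) z = (gf (fs_low b) z * gf (T b k.+1) z +
                          gf (fs_high b) z * gf (T b k) z)%E.
  rewrite -!gf_conv//; try by move=> n; exact: tail_ge0.
  rewrite -(gfD z0); last 2 first.
  - by move=> n; rewrite sumr_ge0// => i _; rewrite mulr_ge0// tail_ge0.
  - by move=> n; rewrite sumr_ge0// => i _; rewrite mulr_ge0// tail_ge0.
  apply: eq_eseriesr => n _; congr (_ * _)%:E.
  rewrite /conv -big_split; case: Tw => _ ->; apply: eq_bigr => i _ /=.
  by rewrite /fs_low /fs_high; case: ifP => _; rewrite mul0r ?addr0 ?add0r.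
rewrite ih gf_low// gf_high// -(fineK (fin k.+1)) -!EFinM -EFinD => -[h].
have D0 : Dn z b != 0 by rewrite gt_eqF// Dn_gt0.
congr EFin; rewrite exprSr mulrA mulrC.
have I0 : Dinf z != 0 by rewrite gt_eqF// Dinf_gt0.
have {}h : Dn z b * fine (gf (T b k.+1) z) =
    Gn z b * ((Dinf z)^-1 * (Gn z b / Dn z b) ^+ k) by lra.
by apply: (mulfI D0); rewrite h; field; rewrite D0 I0.
Qed.

(** In the difference of two consecutive terms of the geometric sequence of [gf_tail], the factor 1
    - G_b / D_b equals 1 / (Q D_b), so that Q cancels. *)
Lemma gf_exact b k :
  gf (exact_weights T b k) z = (Gn z b ^+ k / Dn z b ^+ k.+1)%:E.
Proof.
have t1 j n : T b j n <= 1 by apply: le_trans (qs_le1 n); exact: tail_le.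
have fin : gf (exact_weights T b k) z \is a fin_num.
  apply: gf_fin => // n; first exact: exact_ge0.
  by apply: le_trans (qs_le1 n); exact: exact_le.
have : gf (T b k) z = (gf (exact_weights T b k) z + gf (T b k.+1) z)%E.
  rewrite -gfD//; last 2 first.
  - by move=> n; exact: exact_ge0.
  - by move=> n; exact: tail_ge0.
  by apply: eq_eseriesr => n _; rewrite subrK.
rewrite !gf_tail -(fineK fin) -EFinD => -[h]; congr EFin.
have D0 : Dn z b != 0 by rewrite gt_eqF// Dn_gt0.
have I0 : Dinf z != 0 by rewrite gt_eqF// Dinf_gt0.
have e : Gn z b = Dn z b - Dinf z by [].
transitivity ((Dinf z)^-1 * (Gn z b / Dn z b) ^+ k * (1 - Gn z b / Dn z b)).
  by apply: (addIr ((Dinf z)^-1 * (Gn z b / Dn z b) ^+ k.+1)); rewrite -h exprSr; ring.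
have -> : 1 - Gn z b / Dn z b = Dinf z / Dn z b by rewrite e; field.
rewrite exprSr expr_div_n.
have Dk0 : Dn z b ^+ k != 0 by rewrite expf_neq0.
by field; rewrite D0 Dk0 I0.
Qed.

End TailGF.
End TailWeights.
End GeneratingFunctions.

(** * Riemann sums and the half-integer Gamma function *)

Section RiemannSums.
Context {R : realType}.
Local Notation leb := (@lebesgue_measure R).
Local Notation Rpos := (`]0%R, +oo[%classic : set R).
Local Notation Rnn := (`[0%R, +oo[%classic : set R).
Implicit Types (s x : R) (phi : nat -> R).

Let Rpos_Rnn : Rpos `<=` Rnn.
Proof. by move=> x /=; rewrite !in_itv /= !andbT; exact: ltW. Qed.

Let cell s a : set R := [set` `[s * a%:R, s * a.+1%:R[].

Let cellP s a x : 0 < s -> 0 <= x -> cell s a x <-> Num.truncn (x / s) = a.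
Proof.
move=> s0 x0; have xs0 : 0 <= x / s by rewrite divr_ge0// ltW.
rewrite /cell /= in_itv /= ![s * _]mulrC -ler_pdivlMr// -ltr_pdivrMr//.
split; first by move=> /truncn_def.
by move=> <-; exact: truncn_itv.
Qed.

Let cell_cover s : 0 < s -> Rnn = \bigcup_a cell s a.
Proof.
move=> s0; apply/seteqP; split => x /=.
  rewrite in_itv /= andbT => x0; exists (Num.truncn (x / s)) => //.
  exact/cellP.
move=> [a _]; rewrite /cell /= in_itv /= => /andP[+ _].
rewrite in_itv /= andbT; apply: le_trans.
by rewrite mulr_ge0// ltW.
Qed.

Let cell_ge0 s a x : 0 < s -> cell s a x -> 0 <= x.
Proof.
move=> s0; rewrite /cell /= in_itv /= => /andP[+ _]; apply: le_trans.
by rewrite mulr_ge0// ltW.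
Qed.

Lemma measurable_step phi s : 0 < s ->
  measurable_fun Rnn (fun x => phi (Num.truncn (x / s))).
Proof.
move=> s0; rewrite (cell_cover s0); apply/measurable_fun_bigcup => a.
  exact: measurable_itv.
apply: (eq_measurable_fun (cst (phi a))); last exact: measurable_cst.
move=> x /[!inE] xa; have x0 := cell_ge0 s0 xa.
by move/(cellP _ s0 x0): xa => ->.
Qed.

Lemma integral_step phi s : 0 < s -> (forall a, 0 <= phi a) ->
  (\int[leb]_(x in Rpos) (phi (Num.truncn (x / s)))%:E =
   s%:E * \sum_(0 <= a <oo) (phi a)%:E)%E.
Proof.
move=> s0 phi0.
have mf : measurable_fun Rnn
    (fun x => (phi (Num.truncn (x / s)))%:E).
  by apply/measurable_EFinP; exact: measurable_step.
rewrite integral_itv_obnd_cbnd; last first.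
  by apply: measurable_funS mf => //; exact: Rpos_Rnn.
rewrite (cell_cover s0) in mf *.
rewrite ge0_integral_bigcup//; last 3 first.
- by move=> a; exact: measurable_itv.
- by move=> x _; rewrite lee_fin.
- apply/trivIsetP => a b _ _ ab; apply/seteqP; split => x //= [xa xb].
  have x0 := cell_ge0 s0 xa.
  move/(cellP _ s0 x0): xa => xa; move/(cellP _ s0 x0): xb => xb.
  by rewrite -xa -xb eqxx in ab.
rewrite -nneseriesZl; last by move=> i _; rewrite lee_fin.
apply: eq_eseriesr => a _.
rewrite (eq_integral (cst (phi a)%:E)); last first.
  move=> x /[!inE] xa; have x0 := cell_ge0 s0 xa.
  by move/(cellP _ s0 x0): xa => ->.
have e : leb (cell s a) = s%:E.
  rewrite /cell lebesgue_measure_itv /= lte_fin ltr_pM2l// ltr_nat ltnSn.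
  by rewrite -EFinB -mulrBr -natrB// subSnn mulr1.
transitivity ((phi a)%:E * leb (cell s a))%E; last by rewrite e muleC.
by apply: integral_cst; exact: measurable_itv.
Qed.

(** By [integral_step], [s] times the series is the integral of a step function constant on cells of
    length [s]; dominated convergence applies to it along every sequence of positive [s] tending to
    0. *)
Lemma riemann_dominated (phi : R -> nat -> R) (g h : R -> R) :
  (forall s a, 0 < s -> s < 1 -> 0 <= phi s a) ->
  leb.-integrable Rpos (EFin \o h) ->
  (forall s x, 0 < s -> s < 1 -> 0 < x -> phi s (Num.truncn (x / s)) <= h x) ->
  (forall x, 0 < x -> phi s (Num.truncn (x / s)) @[s --> (0 : R)^'+] --> g x) ->
  [/\ leb.-integrable Rpos (EFin \o g),
      (forall s, 0 < s -> s < 1 ->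
        (\sum_(0 <= a <oo) (phi s a)%:E < +oo)%E) &
      (s%:E * \sum_(0 <= a <oo) (phi s a)%:E)%E @[s --> (0 : R)^'+] -->
      (\int[leb]_(x in Rpos) (g x)%:E)%E].
Proof.
move=> phi0 ih phih phig.
pose D : set R := Rpos.
have mD : measurable D by exact: measurable_itv.
have Dgt0 x : D x -> 0 < x by rewrite /D /= in_itv /= andbT.
pose u0 := fun n : nat => n.+2%:R^-1 : R.
have main (u : nat -> R) : (forall n, 0 < u n) -> (forall n, u n < 1) ->
    u n @[n --> \oo] --> (0 : R) ->
    leb.-integrable D (EFin \o g) /\
    (\int[leb]_(x in D) (phi (u n) (Num.truncn (x / u n)))%:E)%E
      @[n --> \oo] --> (\int[leb]_(x in D) (g x)%:E)%E.
  move=> upos u1 ucvg.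
  have mphi n : measurable_fun D
      (fun x => (phi (u n) (Num.truncn (x / u n)))%:E).
    apply/measurable_EFinP.
    by apply: (measurable_funS _ Rpos_Rnn (measurable_step (phi (u n)) (upos n))).
  have cvgD x : D x ->
      (phi (u n) (Num.truncn (x / u n)))%:E @[n --> \oo] --> (g x)%:E.
    move=> /Dgt0 x0; apply: cvg_EFin; first exact: nearW.
    have /cvg_at_rightP := phig x x0; apply; split => //.
  have mg : measurable_fun D (fun x => (g x)%:E).
    exact: emeasurable_fun_cvg cvgD.
  have [] := @dominated_convergence _ _ _ leb D mD
    (fun n x => (phi (u n) (Num.truncn (x / u n)))%:E)
    (EFin \o g) (EFin \o h) mphi mg _ ih.
  - by apply: aeW => x; exact: cvgD.
  - apply: aeW => x n Dx; rewrite /= lee_fin ger0_norm ?phi0//.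
    by apply: phih => //; exact: Dgt0.
  by move=> ig _ ?; split.
have fin s : 0 < s -> s < 1 -> (\sum_(0 <= a <oo) (phi s a)%:E < +oo)%E.
  move=> s0 s1; have phis0 a := @phi0 s a s0 s1.
  have : (\int[leb]_(x in D) (phi s (Num.truncn (x / s)))%:E < +oo)%E.
    apply: le_lt_trans (_ : \int[leb]_(x in D) `|(h x)%:E| < +oo)%E; last first.
      by case/integrableP : ih.
    apply: ge0_le_integral => //.
    - by move=> x _; rewrite lee_fin phi0.
    - apply/measurable_EFinP.
      by apply: (measurable_funS _ Rpos_Rnn (measurable_step (phi s) s0)).
    - by case/integrableP : ih => mh _; apply/measurableT_comp.
    - move=> x /Dgt0 x0; rewrite lee_fin.
      by apply: le_trans (ler_norm _); exact: phih.
  rewrite integral_step//.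
  have : (0 <= \sum_(0 <= a <oo) (phi s a)%:E)%E.
    by apply: nneseries_ge0 => a _ _; rewrite lee_fin.
  by case: (\sum_(0 <= a <oo) (phi s a)%:E)%E => [r _ _|_|_]; rewrite ?ltry// gt0_muley ?lte_fin.
have u0cvg : u0 n @[n --> \oo] --> (0 : R).
  have := @cvg_harmonic R; rewrite -(cvg_shiftn 1).
  by under eq_fun do rewrite /= addn1.
have [ig _] := main u0 (fun n => ltac:(by rewrite invr_gt0))
  (fun n => ltac:(by rewrite invf_lt1 ?ltr1n)) u0cvg.
split => //.
have gfin : (\int[leb]_(x in D) (g x)%:E)%E \is a fin_num.
  exact: integrable_fin_num ig.
rewrite -(fineK gfin).
have sumfin s : 0 < s -> s < 1 ->
    (s%:E * \sum_(0 <= a <oo) (phi s a)%:E)%E \is a fin_num.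
  move=> s0 s1; rewrite fin_numM// ge0_fin_numE ?fin//.
  by apply: nneseries_ge0 => a _ _; rewrite lee_fin phi0.
apply: cvg_EFin.
  near=> s; apply: sumfin; near: s; first exact: nbhs_right_gt.
  exact: nbhs_right_lt.
apply/cvg_at_rightP => u [upos ucvg].
(* The bounds hold for [s < 1] only, and an arbitrary sequence is below 1 only from some rank on;
   hence the shift by [N]. *)
have [N _ uN] : \forall n \near \oo, u n < 1.
  move/cvgrPdist_lt : ucvg => /(_ 1 ltr01) ucvg.
  near=> n; have : `|0 - u n| < 1 by near: n; exact: ucvg.
  by rewrite sub0r normrN gtr0_norm.
rewrite -(cvg_shiftn N).
have v1 n : u (n + N)%N < 1 by apply: uN; rewrite /= leq_addl.
have vcvg : u (n + N)%N @[n --> \oo] --> (0 : R) by rewrite (cvg_shiftn N).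
have [_ h1] := main (fun n => u (n + N)%N) (fun n => upos _) v1 vcvg.
rewrite -(fineK gfin) in h1.
move/fine_cvgP : h1 => [_]; apply: cvg_trans.
apply: near_eq_cvg; near=> n => /=.
by rewrite integral_step// => a; exact: phi0.
Unshelve. all: by end_near. Qed.

End RiemannSums.

(** * The value of Gamma(1/2) and the common integrable majorant *)

Section GammaHalf.
Context {R : realType}.
Local Notation leb := (@lebesgue_measure R).
Local Notation Rpos := (`]0%R, +oo[%classic : set R).
Local Notation Rnn := (`[0%R, +oo[%classic : set R).

(** The exponent is left unsimplified so that this is literally the integrand of [lower_gamma 2^-1].
    A multiple of this function dominates nearly every Riemann sum below. *)
Definition gamma_half (x : R) : R := expR (- x) * x `^ (2^-1 - 1).

Lemma powR_halfN (x : R) : 0 < x -> x `^ (- 2^-1) = (Num.sqrt x)^-1.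
Proof. by move=> x0; rewrite powRN powR12_sqrt// ltW. Qed.

Lemma gamma_halfE (x : R) : 0 < x -> gamma_half x = expR (- x) / Num.sqrt x.
Proof.
move=> x0; rewrite /gamma_half -powR_halfN//; congr (_ * _ `^ _).
by lra.
Qed.

Lemma measurable_gamma_half : measurable_fun [set: R] gamma_half.
Proof.
apply: measurable_funM; last exact: measurable_powR.
by apply: measurableT_comp => //; exact: measurable_oppr.
Qed.

Lemma gamma_half_ge0 (x : R) : 0 <= gamma_half x.
Proof. by rewrite mulr_ge0 ?expR_ge0 ?powR_ge0. Qed.

(** Substitution y = sqrt x. It is made away from 0, where the derivative of the square root is
    finite; [integral_gamma_half] then lets a tend to 0 on both sides by monotone convergence. *)
Let gauss_tail (a : R) : 0 < a ->
  (\int[leb]_(y in (`[Num.sqrt a, +oo[%classic : set R)) (2 * expR (- y ^+ 2))%:E =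
   \int[leb]_(x in (`[a, +oo[%classic : set R)) (gamma_half x)%:E)%E.
Proof.
move=> a0.
have dsqrt x : 0 < x -> is_derive (x : R) (1 : R) (@Num.sqrt R) (2 * Num.sqrt x)^-1.
  by move=> x0; exact: is_derive1_sqrt.
have dE x : 0 < x -> derive1 (@Num.sqrt R) x = (2 * Num.sqrt x)^-1.
  by move=> x0; rewrite derive1E; have [_ ->] := dsqrt x x0.
have cd x : 0 < x -> {for x, continuous (derive1 (@Num.sqrt R))}.
  move=> x0; apply: (@cvg_trans _ ((2 * Num.sqrt y)^-1 @[y --> x])).
    apply: near_eq_cvg; near=> y; rewrite dE//; near: y.
    exact: lt_nbhsr.
  have h : (2 * Num.sqrt y)^-1 @[y --> (x : R)] --> (2 * Num.sqrt (x : R))^-1.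
    apply: cvgV; first by rewrite mulf_neq0// gt_eqF// sqrtr_gt0.
    by apply: cvgM; [exact: cvg_cst|exact: sqrt_continuous].
  by rewrite -(dE x x0) in h.
rewrite (@increasing_ge0_integration_by_substitutiony R (@Num.sqrt R)
  (fun y => 2 * expR (- y ^+ 2)) a).
- apply: eq_integral => x; rewrite inE /= in_itv /= andbT => ax.
  have x0 : 0 < x by exact: lt_le_trans ax.
  transitivity ((2 * expR (- Num.sqrt x ^+ 2) * derive1 (@Num.sqrt R) x)%:E) => //.
  rewrite dE// sqr_sqrtr ?ltW// gamma_halfE// invfM; congr EFin.
  have sx0 : Num.sqrt (x : R) != 0 by rewrite gt_eqF// sqrtr_gt0.
  by field.
- move=> x y; rewrite !in_itv /= !andbT => ax ay xy.
  by rewrite ltr_sqrt// (lt_le_trans a0).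
- by move=> x; rewrite in_itv /= andbT => ax; apply: cd; exact: lt_trans ax.
- apply/cvg_ex; exists (derive1 (@Num.sqrt R) a).
  by apply: cvg_at_right_filter; exact: cd.
- apply/cvg_ex; exists 0.
  apply: (@cvg_trans _ ((2 * Num.sqrt y)^-1 @[y --> +oo])).
    by apply: near_eq_cvg; near=> y; rewrite dE.
  apply/cvgrPdist_le => e e0; near=> y.
  have y0 : 0 < y by [].
  rewrite sub0r normrN ger0_norm ?invr_ge0 ?mulr_ge0 ?sqrtr_ge0//.
  rewrite invf_ple ?posrE ?mulr_gt0 ?sqrtr_gt0//.
  apply: le_trans (_ : Num.sqrt y <= _); last by rewrite ler_peMl ?sqrtr_ge0// ler1n.
  rewrite -[leLHS]ger0_norm ?invr_ge0 ?(ltW e0)// -sqrtr_sqr; apply: ler_wsqrtr.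
  by near: y; apply: nbhs_pinfty_ge; exact: num_real.
- split; last by apply: cvg_at_right_filter; exact: sqrt_continuous.
  move=> x; rewrite in_itv /= andbT => ax.
  by have [] := dsqrt x (lt_trans a0 ax).
- apply/cvgryPge => A; near=> y.
  have : Num.sqrt (A ^+ 2) <= Num.sqrt y.
    apply: ler_wsqrtr; near: y; apply: nbhs_pinfty_ge; exact: num_real.
  by rewrite sqrtr_sqr; exact/le_trans/ler_norm.
- apply: continuous_subspaceT => y.
  apply: cvgM; first exact: cvg_cst.
  apply: continuous_comp; last exact: continuous_expR.
  by apply: cvgN; exact: exprn_continuous.
- by move=> y _; rewrite mulr_ge0// expR_ge0.
Unshelve. all: by end_near. Qed.

Lemma integral_gamma_half :
  (\int[leb]_(x in Rpos) (gamma_half x)%:E = (Num.sqrt pi)%:E)%E.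
Proof.
pose G y : R := 2 * expR (- y ^+ 2).
have G0 y : 0 <= G y by rewrite mulr_ge0// expR_ge0.
have mG : measurable_fun [set: R] G.
  apply: measurable_funM => //; apply: measurableT_comp => //.
  by apply: measurableT_comp => //; exact: measurable_funX.
pose a n : R := n.+1%:R^-1.
have a0 n : 0 < a n by rewrite invr_gt0.
have acvg : a n @[n --> \oo] --> (0 : R) by exact: cvg_harmonic.
have ub (b : nat -> R) : (forall n, 0 < b n) -> {homo b : m n / (m <= n)%N >-> n <= m} ->
    b n @[n --> \oo] --> (0 : R) ->
    forall f : R -> R, (forall x, 0 <= f x) -> measurable_fun [set: R] f ->
    (\int[leb]_(x in (`[b n, +oo[%classic : set R)) (f x)%:E)%E @[n --> \oo] -->
    (\int[leb]_(x in Rpos) (f x)%:E)%E.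
  move=> b0 bhomo bcvg f f0 mf.
  have -> : Rpos = \bigcup_n (`[b n, +oo[%classic : set R).
    apply/seteqP; split => x /=; rewrite ?in_itv /= ?andbT.
      move=> x0; have [N _ bN] : \forall n \near \oo, b n < x.
        move/cvgrPdist_lt : bcvg => /(_ x x0) bcvg.
        near=> n; have : `|0 - b n| < x by near: n; exact: bcvg.
        by rewrite sub0r normrN gtr0_norm.
      by exists N => //=; rewrite in_itv /= andbT ltW// bN /=.
    by move=> [n _]; rewrite /= in_itv /= andbT; exact: lt_le_trans.
  apply: ge0_nondecreasing_set_cvg_integral => //.
  - move=> m n mn; apply/subsetPset => x /=; rewrite !in_itv /= !andbT.
    by apply: le_trans; exact: bhomo.
  - by move=> n; apply/measurable_EFinP; exact: measurable_funTS.
  - by move=> n x _; rewrite lee_fin.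
have anoninc : {homo a : m n / (m <= n)%N >-> n <= m}.
  by move=> m n mn; rewrite lef_pV2 ?posrE// ler_nat ltnS.
have h1 := ub a a0 anoninc acvg _ gamma_half_ge0 measurable_gamma_half.
have h2 := ub (fun n => Num.sqrt (a n)) (fun n => ltac:(by rewrite sqrtr_gt0))
  (fun m n mn => ler_wsqrtr (anoninc _ _ mn))
  ltac:(rewrite -(sqrtr0 R); apply: continuous_cvg => //; exact: sqrt_continuous) _ G0 mG.
have e : (\int[leb]_(x in Rpos) (gamma_half x)%:E =
          \int[leb]_(x in Rpos) (G x)%:E)%E.
  apply: (cvg_unique _ h1) => //; apply: cvg_trans h2.
  by apply: near_eq_cvg; near=> n; exact: gauss_tail.
rewrite e integral_itv_obnd_cbnd; last first.
  by apply/measurable_EFinP; exact: measurable_funTS.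
under eq_integral do rewrite /G EFinM.
rewrite ge0_integralZl//; last first.
  apply/measurable_EFinP; apply: measurable_funTS.
  apply: measurableT_comp => //.
  by apply: measurableT_comp => //; exact: measurable_funX.
by rewrite integral0y_gauss -EFinM; congr EFin; lra.
Unshelve. all: by end_near. Qed.

Lemma integrable_gamma_half :
  leb.-integrable Rpos (EFin \o gamma_half).
Proof.
apply/integrableP; split.
  by apply/measurable_EFinP; apply: measurable_funTS; exact: measurable_gamma_half.
under eq_integral do rewrite /= ger0_norm ?gamma_half_ge0//.
by rewrite integral_gamma_half ltry.
Qed.

End GammaHalf.

(** * Scaling limits *)

Section ScalingLimits.
Context {R : realType}.
Local Notation leb := (@lebesgue_measure R).
Local Notation Rpos := (`]0%R, +oo[%classic : set R).
Implicit Types (s x y : R).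

Definition grid s x : nat := Num.truncn (x / s).
Definition zs s : R := expR (- s).

Lemma grid_le s x : 0 < s -> 0 < x -> s * (grid s x)%:R <= x.
Proof.
move=> s0 x0; have /truncn_itv/andP[h _] : 0 <= x / s by rewrite divr_ge0 ?ltW.
by rewrite mulrC -ler_pdivlMr.
Qed.

Lemma grid_gt s x : 0 < s -> 0 < x -> x < s * (grid s x).+1%:R.
Proof.
move=> s0 x0; have /truncn_itv/andP[_ h] : 0 <= x / s by rewrite divr_ge0 ?ltW.
by rewrite mulrC -ltr_pdivrMr.
Qed.

Lemma grid_gtB s x : 0 < s -> 0 < x -> x - s < s * (grid s x)%:R.
Proof.
by move=> s0 x0; have := grid_gt s0 x0; rewrite -natr1 mulrDr mulr1 ltrBlDr.
Qed.

Lemma grid_mono s x y : 0 < s -> x <= y -> (grid s x <= grid s y)%N.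
Proof. by move=> s0 xy; apply: le_truncn; rewrite ler_pM2r// invr_gt0. Qed.

Lemma cvg_grid x : 0 < x -> s * (grid s x)%:R @[s --> (0 : R)^'+] --> x.
Proof.
move=> x0; apply/cvgrPdist_le => e e0; near=> s.
have s0 : 0 < s by [].
have h1 := grid_le s0 x0; have h2 := grid_gtB s0 x0.
have se : s <= e by near: s; exact: nbhs_right_le.
by rewrite ger0_norm ?subr_ge0//; lra.
Unshelve. all: by end_near. Qed.

Lemma zs_gt0 s : 0 < zs s. Proof. exact: expR_gt0. Qed.

Lemma zs_lt1 s : 0 < s -> zs s < 1. Proof. by move=> ?; rewrite expR_lt1 oppr_lt0. Qed.

Lemma zsX s n : zs s ^+ n = expR (- (s * n%:R)).
Proof. by rewrite /zs -expRM_natr mulNr. Qed.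

Lemma zs_grid_le s x : 0 < s -> s < 1 -> 0 < x -> zs s ^+ grid s x <= expR 1 * expR (- x).
Proof.
move=> s0 s1 x0; rewrite zsX -expRD ler_expR; have := grid_gtB s0 x0; lra.
Qed.

Lemma zs_grid_ge s x : 0 < s -> 0 < x -> expR (- x) <= zs s ^+ grid s x.
Proof. by move=> s0 x0; rewrite zsX ler_expR lerN2 grid_le. Qed.

Lemma cvg_zs_grid x : 0 < x -> zs s ^+ grid s x @[s --> (0 : R)^'+] --> expR (- x).
Proof.
move=> x0; under eq_fun do rewrite zsX.
apply: continuous_cvg; first exact: continuous_expR.
by apply: cvgN; exact: cvg_grid.
Qed.

Lemma zs_ge s : 0 < s -> s < 1 -> 2^-1 * s <= 1 - zs s.
Proof.
move=> s0 s1; rewrite /zs expRN.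
have e1 : 1 + s <= expR s by exact: expR_ge1Dx.
have : (expR s)^-1 <= (1 + s)^-1 by rewrite lef_pV2 ?posrE ?expR_gt0//; lra.
have : (1 + s)^-1 <= 1 - 2^-1 * s.
  by rewrite -[leLHS]mul1r ler_pdivrMr; [nra|lra].
lra.
Qed.

Lemma zs_le s : 1 - zs s <= s.
Proof. by have := expR_ge1Dx (- s); rewrite /zs; lra. Qed.

Lemma cvg_one_minus_zs : (1 - zs s) / s @[s --> (0 : R)^'+] --> (1 : R).
Proof.
apply/cvgrPdist_le => e e0; near=> s.
have s0 : 0 < s by [].
have se : s <= e by near: s; exact: nbhs_right_le.
have h1 := zs_le s.
have h2 : s - s * s <= 1 - zs s.
  rewrite /zs expRN.
  have e1 : 1 + s <= expR s by exact: expR_ge1Dx.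
  have : (expR s)^-1 <= (1 + s)^-1 by rewrite lef_pV2 ?posrE ?expR_gt0//; lra.
  have : (1 + s)^-1 <= 1 - s + s * s.
    by rewrite -[leLHS]mul1r ler_pdivrMr; [nra|lra].
  lra.
have h3 : (1 - zs s) / s <= 1 by rewrite ler_pdivrMr// mul1r.
have h4 : 1 - s <= (1 - zs s) / s by rewrite ler_pdivlMr//; lra.
by rewrite ger0_norm ?subr_ge0//; lra.
Unshelve. all: by end_near. Qed.

Lemma Dinf_ge s : 0 < s -> s < 1 -> 2^-1 * Num.sqrt s <= Dinf (zs s).
Proof.
move=> s0 s1; have -> : 2^-1 = Num.sqrt ((2^-1 : R) ^+ 2).
  by rewrite sqrtr_sqr ger0_norm// invr_ge0.
rewrite -sqrtrM ?sqr_ge0//; apply: ler_wsqrtr.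
by have := zs_ge s0 s1; nra.
Qed.

Lemma cvg_Dinf : Dinf (zs s) / Num.sqrt s @[s --> (0 : R)^'+] --> (1 : R).
Proof.
apply: (@cvg_trans _ (Num.sqrt ((1 - zs s) / s) @[s --> (0 : R)^'+])).
  apply: near_eq_cvg; near=> s; have s0 : 0 < s by [].
  rewrite sqrtrM; last by rewrite subr_ge0 ltW// zs_lt1.
  by rewrite sqrtrV ?ltW.
have : Num.sqrt ((1 - zs s) / s) @[s --> (0 : R)^'+] --> Num.sqrt (1 : R).
  by apply: continuous_cvg; [exact: sqrt_continuous|exact: cvg_one_minus_zs].
by rewrite sqrtr1.
Unshelve. all: by end_near. Qed.

(** By Wallis's formula this is 1 / sqrt pi. Only its existence and positivity are used: it occurs
    to the same power in the numerators and denominators of the limits. *)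
Definition cq : R := limn (fun n => Num.sqrt n%:R * qs n).

Let qs_norm_ge n : (0 < n)%N -> 2^-1 <= Num.sqrt n%:R * qs n :> R.
Proof.
move=> n0; have := @qs_ge R n n0.
rewrite invfM mulrC ler_pdivrMl ?sqrtr_gt0 ?ltr0n//.
Qed.

Lemma cvg_qs : Num.sqrt n%:R * qs n @[n --> \oo] --> cq.
Proof.
have E n : Num.sqrt n%:R * qs n = Num.sqrt (n%:R * qs n ^+ 2) :> R.
  by rewrite sqrtrM ?ler0n// sqrtr_sqr ger0_norm.
apply: nondecreasing_is_cvgn.
  by move=> m n mn; rewrite !E; apply: ler_wsqrtr; exact: qs_sqr_mono.
exists 1 => _ [n _ <-]; rewrite E -[leRHS]sqrtr1; apply: ler_wsqrtr.
have := @qs_sqr_le R n; have := sqr_ge0 (@qs R n); have := ler0n R n.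
by set a : R := n%:R; set b := qs n ^+ 2 => *; nra.
Qed.

Lemma cq_gt0 : 0 < cq.
Proof.
apply: (@lt_le_trans _ _ 2^-1) => //.
apply: limr_ge; first by apply/cvg_ex; exists cq; exact: cvg_qs.
near=> n; apply: qs_norm_ge; near: n; exact: nbhs_infty_gt.
Unshelve. all: by end_near. Qed.

Lemma cvg_grid_oo x : 0 < x -> grid s x @[s --> (0 : R)^'+] --> \oo.
Proof.
move=> x0; apply/cvgnyPge => A; near=> s; have s0 : 0 < s by [].
rewrite /grid truncn_ge_nat ?divr_ge0 ?(ltW s0) ?(ltW x0)// ler_pdivlMr//.
have A0 : 0 < A.+1%:R :> R by [].
have : s <= x / A.+1%:R by near: s; apply: nbhs_right_le; rewrite divr_gt0.
rewrite ler_pdivlMr// mulrC; apply: le_trans; rewrite ler_pM2r// ler_nat.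
exact: leqnSn.
Unshelve. all: by end_near. Qed.

Lemma cvg_qs_grid x : 0 < x ->
  qs (grid s x) / Num.sqrt s @[s --> (0 : R)^'+] --> cq / Num.sqrt x.
Proof.
move=> x0.
have h1 : Num.sqrt (grid s x)%:R * qs (grid s x) @[s --> (0 : R)^'+] --> cq.
  exact: (cvg_comp _ _ (cvg_grid_oo x0) cvg_qs).
have h2 : (Num.sqrt (s * (grid s x)%:R))^-1 @[s --> (0 : R)^'+] --> (Num.sqrt x)^-1.
  apply: cvgV; first by rewrite gt_eqF// sqrtr_gt0.
  by apply: (cvg_comp _ _ (cvg_grid x0)); exact: sqrt_continuous.
apply: cvg_trans (cvgM h1 h2).
apply: near_eq_cvg; near=> s; have s0 : 0 < s by [].
have g0 : (0 < grid s x)%N.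
  near: s; have /cvgnyPgt := cvg_grid_oo x0; exact.
have gs0 : Num.sqrt (grid s x)%:R != 0 :> R by rewrite gt_eqF// sqrtr_gt0 ltr0n.
have ss0 : Num.sqrt s != 0 by rewrite gt_eqF// sqrtr_gt0.
by rewrite /= sqrtrM ?ltW//; field; rewrite gs0 ss0.
Unshelve. all: by end_near. Qed.

(** The bound 1 / sqrt (2m + 1), rather than one in terms of 1 / sqrt m, makes this valid on the
    first cell, where m = 0, because x < s (m + 1). *)
Lemma qs_grid_le s x : 0 < s -> 0 < x ->
  qs (grid s x) <= Num.sqrt s / Num.sqrt x.
Proof.
move=> s0 x0; apply: le_trans (@qs_le R _) _.
have sx0 : 0 < Num.sqrt x by rewrite sqrtr_gt0.
rewrite ler_pdivlMr// ler_pdivrMl ?sqrtr_gt0; last by have := ler0n R (grid s x); lra.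
rewrite -sqrtrM; last by have := ler0n R (grid s x); lra.
apply: ler_wsqrtr; have := grid_gt s0 x0; rewrite -natr1.
have := ler0n R (grid s x); set m : R := (grid s x)%:R => *; nra.
Qed.

Lemma fs_qs l : fs l.+1 = qs l.+1 / (2 * l%:R + 1) :> R.
Proof.
have l0 := ler0n R l.
have a0 : 2 * l%:R + 2 != 0 :> R by lra.
have b0 : 2 * l%:R + 1 != 0 :> R by lra.
rewrite fsS; apply/eqP; rewrite eqr_div//; apply/eqP.
by have := @qsSE R l; lra.
Qed.

Lemma fs_le l : fs l.+1 <= qs l.+1 / l.+1%:R :> R.
Proof.
rewrite fs_qs ler_wpM2l// lef_pV2 ?posrE ?ltr0n//.
  by rewrite -(natr1 l); have := ler0n R l; lra.
Qed.

(** For m > 0 one has f(m) = q(m) / (2m - 1), and s (2m - 1) tends to 2x at m = [grid s x]. *)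
Lemma cvg_fs_grid x : 0 < x ->
  fs (grid s x) / (s * Num.sqrt s) @[s --> (0 : R)^'+] -->
  2^-1 * cq * (x^-1 / Num.sqrt x).
Proof.
move=> x0.
have h : (2 * (s * (grid s x)%:R) - s)^-1 @[s --> (0 : R)^'+] --> (2 * x - 0)^-1.
  apply: cvgV; first by rewrite subr0 mulf_neq0// gt_eqF.
  apply: cvgB; last by apply: cvg_at_right_filter; exact: cvg_id.
  by apply: cvgM; [exact: cvg_cst|exact: cvg_grid].
have -> : 2^-1 * cq * (x^-1 / Num.sqrt x) = cq / Num.sqrt x * (2 * x - 0)^-1.
  by rewrite subr0 invfM; ring.
apply: cvg_trans (cvgM (cvg_qs_grid x0) h).
apply: near_eq_cvg; near=> s; have s0 : 0 < s by [].
have : (0 < grid s x)%N.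
  near: s; have /cvgnyPgt := cvg_grid_oo x0; exact.
move=> /=; case: (grid s x) => // l _; rewrite fs_qs.
have ss0 : Num.sqrt s != 0 by rewrite gt_eqF// sqrtr_gt0.
have s0' : s != 0 by rewrite gt_eqF.
have b0 : 2 * l%:R + 1 != 0 :> R by have := ler0n R l; lra.
rewrite -[in LHS](natr1 l).
have -> : 2 * (s * (l%:R + 1)) - s = s * (2 * l%:R + 1) by ring.
by field; rewrite ss0 s0' b0.
Unshelve. all: by end_near. Qed.

End ScalingLimits.

(** * Scaling limits of D_b and G_b *)

Section TruncatedLimits.
Context {R : realType}.
Local Notation leb := (@lebesgue_measure R).
Local Notation Rpos := (`]0%R, +oo[%classic : set R).
Implicit Types (s x y : R).

Let sqrt_gt0 s : 0 < s -> 0 < Num.sqrt s. Proof. by rewrite sqrtr_gt0. Qed.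

Lemma integrable_scaled_gamma_half (C : R) :
  leb.-integrable Rpos (EFin \o (fun x => C * gamma_half x)).
Proof.
have -> : EFin \o (fun x => C * gamma_half x) =
    (fun x => C%:E * (EFin \o gamma_half) x)%E by apply/funext => x.
by apply: integrableZl => //; exact: integrable_gamma_half.
Qed.

Lemma finite_nneseries (u : nat -> R) N : (forall n, (N <= n)%N -> u n = 0) ->
  (\sum_(0 <= n <oo) (u n)%:E = (\sum_(n < N) u n)%:E)%E.
Proof.
move=> u0; apply/cvg_lim => //.
apply: (@cvg_trans _ (cst (\sum_(n < N) u n)%:E @ \oo)); last exact: cvg_cst.
apply: near_eq_cvg; near=> n; rewrite sumEFin /=; congr EFin.
have Nn : (N <= n)%N by near: n; exact: nbhs_infty_ge.
rewrite [RHS](big_cat_nat (n := N))//= big_mkord [X in _ + X]big_nat_cond.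
by rewrite [X in _ + X]big1 ?addr0// => i /andP[/andP[Ni _] _]; exact: u0.
Unshelve. all: by end_near. Qed.

Lemma qs_term_le s y : 0 < s -> s < 1 -> 0 < y ->
  qs (grid s y) * zs s ^+ grid s y / Num.sqrt s <= expR 1 * gamma_half y.
Proof.
move=> s0 s1 y0; rewrite gamma_halfE// ler_pdivrMr ?sqrt_gt0//.
have -> : expR 1 * (expR (- y) / Num.sqrt y) * Num.sqrt s =
  (Num.sqrt s / Num.sqrt y) * (expR 1 * expR (- y)) by ring.
apply: ler_pM => //; first by rewrite exprn_ge0// ltW// zs_gt0.
- exact: qs_grid_le.
- exact: zs_grid_le.
Qed.

(** The cutoff of the sum moves with [s], so it is put into the summand; the integrand of the limit
    is then cut at x. *)
Lemma cvg_partial x : 0 < x ->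
  (Num.sqrt s * \sum_(l < grid s x) qs l * zs s ^+ l) @[s --> (0 : R)^'+] -->
  cq * lower_gamma 2^-1 x.
Proof.
move=> x0.
pose phi s l := if (l < grid s x)%N then qs l * zs s ^+ l / Num.sqrt s else 0 : R.
pose g y := if y < x then cq * gamma_half y else 0 : R.
have phi0 s a : 0 < s -> s < 1 -> 0 <= phi s a.
  move=> s0 s1; rewrite /phi; case: ifP => // _.
  by rewrite divr_ge0 ?mulr_ge0 ?exprn_ge0 ?sqrtr_ge0// ltW// zs_gt0.
have phih s y : 0 < s -> s < 1 -> 0 < y ->
    phi s (Num.truncn (y / s)) <= expR 1 * gamma_half y.
  move=> s0 s1 y0; rewrite /phi -/(grid s y); case: ifP => _.
    exact: qs_term_le.
  by rewrite mulr_ge0 ?expR_ge0 ?gamma_half_ge0.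
have phig y : 0 < y -> phi s (Num.truncn (y / s)) @[s --> (0 : R)^'+] --> g y.
  move=> y0; rewrite /g; have [yx|xy] := ltP y x; last first.
    apply: (@cvg_trans _ (cst (0 : R) @ (0 : R)^'+)); last exact: cvg_cst.
    apply: near_eq_cvg; near=> s; have s0 : 0 < s by [].
    by rewrite /phi /= -/(grid s y) ltnNge grid_mono.
  rewrite gamma_halfE// mulrCA mulrC.
  apply: cvg_trans (cvgM (cvg_qs_grid y0) (cvg_zs_grid y0)).
  apply: near_eq_cvg; near=> s; have s0 : 0 < s by [].
  rewrite /phi /= -/(grid s y) ifT; first by ring.
  have sxy : s <= x - y by near: s; apply: nbhs_right_le; rewrite subr_gt0.
  have h1 := grid_le s0 y0; have h2 := grid_gtB s0 x0.
  have : s * (grid s y)%:R < s * (grid s x)%:R by lra.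
  by rewrite ltr_pM2l// ltr_nat.
have [ig _ cv] := riemann_dominated phi0 (integrable_scaled_gamma_half (expR 1)) phih phig.
have gE : (\int[leb]_(y in Rpos) (g y)%:E = (cq * lower_gamma 2^-1 x)%:E)%E.
  pose A : set R := `]0%R, x[%classic.
  have AE : A = Rpos `&` [set y | y < x].
    by apply/seteqP; split => y; rewrite /A /= !in_itv /= andbT => /andP.
  have ih : leb.-integrable A (EFin \o gamma_half).
    apply: integrableS (integrable_gamma_half); try exact: measurable_itv.
    by rewrite AE; exact: subIsetl.
  transitivity (\int[leb]_(y in A) (cq%:E * (EFin \o gamma_half) y))%E.
    rewrite AE integral_mkcondr; apply: eq_integral => y _.
    rewrite /patch mem_setE /g; case: ifPn => [yx|yx].
      by rewrite ifT.
    by rewrite ifF//; apply/negbTE.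
  rewrite integralZl//; last exact: measurable_itv.
  rewrite EFinM; congr (_ * _)%E; rewrite /lower_gamma /Rintegral fineK//.
  by apply: integrable_fin_num => //; exact: measurable_itv.
rewrite gE in cv.
move/fine_cvgP : cv => [_]; apply: cvg_trans.
apply: near_eq_cvg; near=> s; have s0 : 0 < s by [].
rewrite /= (@finite_nneseries _ (grid s x)); last first.
  by move=> n; rewrite /phi ltnNge => ->.
rewrite -EFinM /=.
transitivity (s * \sum_(n < grid s x) (qs n * zs s ^+ n * (Num.sqrt s)^-1)).
  by congr (_ * _); apply: eq_bigr => i _; rewrite /phi ltn_ord.
rewrite -mulr_suml mulrCA mulrC.
have -> : s / Num.sqrt s = Num.sqrt s.
  rewrite -{1}(sqr_sqrtr (ltW s0)) expr2 mulfK// gt_eqF//.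
  exact: sqrt_gt0.
by [].
Unshelve. all: by end_near. Qed.

Lemma cvg_Dn x : 0 < x ->
  Dn (zs s) (grid s x) / Num.sqrt s @[s --> (0 : R)^'+] --> cq * denominator x.
Proof.
move=> x0.
have -> : cq * denominator x =
    cq / Num.sqrt x * expR (- x) + 1 * (cq * lower_gamma 2^-1 x).
  by rewrite /denominator powR_halfN//; ring.
apply: cvg_trans (cvgD (cvgM (cvg_qs_grid x0) (cvg_zs_grid x0))
                       (cvgM cvg_one_minus_zs (cvg_partial x0))).
apply: near_eq_cvg; near=> s; have s0 : 0 < s by [].
rewrite /= Dn_abel.
have ss0 : Num.sqrt s != 0 by rewrite gt_eqF// sqrt_gt0.
have e : Num.sqrt s / s = (Num.sqrt s)^-1.
  by rewrite -[X in _ / X](sqr_sqrtr (ltW s0)) expr2 invfM mulrA divff ?mul1r.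
set S := \sum_(l < _) _.
transitivity (qs (grid s x) / Num.sqrt s * zs s ^+ grid s x +
              (1 - zs s) / s * (Num.sqrt s * S)) => //.
by rewrite [X in _ = X]mulrDl -e; ring.
Unshelve. all: by end_near. Qed.

(** As 1 / Q = (1 - z) Q, [Dn_abel] shows that G_b is q(b) z^b minus (1 - z) times a tail of the
    nonnegative series Q. *)
Lemma Gn_le (z : R) b : 0 <= z -> z < 1 -> Gn z b <= qs b * z ^+ b.
Proof.
move=> z0 z1; rewrite /Gn Dn_abel// -addrA gerDl subr_le0.
have d0 := Dinf_gt0 z1.
have : \sum_(l < b) qs l * z ^+ l <= (Dinf z)^-1.
  rewrite -lee_fin -(gf_qs z0 z1) -sumEFin.
  have := @nneseries_lim_ge R (fun l => (qs l * z ^+ l)%:E) xpredT 0%N b.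
  rewrite big_mkord; apply => n _ _.
  by rewrite lee_fin mulr_ge0// exprn_ge0.
have e : Dinf z = (1 - z) * (Dinf z)^-1.
  by rewrite -(Dinf_sqr z1) expr2 mulfK// gt_eqF.
by move=> h; rewrite [leRHS]e ler_wpM2l// subr_ge0 ltW.
Qed.

Lemma Gn_sum (z : R) b : 0 <= z -> z < 1 ->
  (\sum_(0 <= l <oo) (if (l <= b)%N then 0 else fs l * z ^+ l)%:E = (Gn z b)%:E)%E.
Proof.
move=> z0 z1; rewrite -gf_high//; apply: eq_eseriesr => l _; congr EFin.
by rewrite /fs_high; case: ifP => _ //; rewrite mul0r.
Qed.

(** A Riemann sum for e^(-y) y^(-3/2) over y > x. This function is not integrable at 0; the cutoff
    at x is what makes a majorant possible. *)
Lemma cvg_Gn x : 0 < x ->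
  Gn (zs s) (grid s x) / Num.sqrt s @[s --> (0 : R)^'+] -->
  2^-1 * cq * upper_gamma (- 2^-1) x.
Proof.
move=> x0.
pose f y : R := expR (- y) * y `^ (- 2^-1 - 1).
have fE y : 0 < y -> f y = gamma_half y / y.
  move=> y0; rewrite /f gamma_halfE// -mulrA; congr (_ * _).
  rewrite powRD; last by rewrite (gt_eqF y0) implybT.
  by rewrite (powR_halfN y0) powR_inv1// ltW.
pose phi s l := if (l <= grid s x)%N then 0 else
  fs l * zs s ^+ l / (s * Num.sqrt s) : R.
pose g y := if x < y then 2^-1 * cq * f y else 0 : R.
have phi0 s a : 0 < s -> s < 1 -> 0 <= phi s a.
  move=> s0 s1; rewrite /phi; case: ifP => // _.
  by rewrite divr_ge0 ?mulr_ge0 ?exprn_ge0 ?sqrtr_ge0// ltW// zs_gt0.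
(* Beyond the cutoff f(m) <= q(m) / m and 1 / m <= 2 s / x, since x < s (m + 1) <= 2 s m; the factor
   [expR 1] comes from [qs_term_le]. *)
pose C := 2 / x * expR 1.
have phih s y : 0 < s -> s < 1 -> 0 < y ->
    phi s (Num.truncn (y / s)) <= C * gamma_half y.
  move=> s0 s1 y0; rewrite /phi -/(grid s y); case: leqP => [_|xy].
    by rewrite mulr_ge0 ?gamma_half_ge0// /C mulr_ge0 ?expR_ge0// divr_ge0// ltW.
  have yx : x <= y.
    by rewrite leNgt; apply/negP => /ltW/(grid_mono s0); rewrite leqNgt xy.
  have : fs (grid s y) <= qs (grid s y) * (2 * s / x).
    have := grid_gt s0 y0; move: xy; case: (grid s y) => // l _ h.
    apply: le_trans (fs_le l) _; rewrite ler_pM2l//.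
    rewrite ler_pdivlMr// -ler_pdivlMl ?invr_gt0 ?ltr0n// invrK.
    have : l.+2%:R <= 2 * l.+1%:R :> R by rewrite -natrM ler_nat; lia.
    move=> h2; have : s * l.+2%:R <= s * (2 * l.+1%:R) by rewrite ler_pM2l.
    move: h yx; rewrite [_ * (2 * s)]mulrCA [l.+1%:R * s]mulrC.
    by move: (s * l.+2%:R) => u; rewrite [s * (2 * _)]mulrCA => *; lra.
  move=> h; have h2 := qs_term_le s0 s1 y0.
  have zp : 0 <= zs s ^+ grid s y by rewrite exprn_ge0// ltW// zs_gt0.
  have ss0 := sqrt_gt0 s0.
  apply: (@le_trans _ _ (qs (grid s y) * (2 * s / x) * zs s ^+ grid s y / (s * Num.sqrt s))).
    by rewrite ler_wpM2r ?invr_ge0 ?mulr_ge0 ?(ltW s0) ?(ltW ss0)// ler_wpM2r.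
  have -> : qs (grid s y) * (2 * s / x) * zs s ^+ grid s y / (s * Num.sqrt s) =
      2 / x * (qs (grid s y) * zs s ^+ grid s y / Num.sqrt s).
    by field; rewrite !gt_eqF.
  by rewrite /C -[leRHS]mulrA ler_wpM2l// divr_ge0// ltW.
have phig y : 0 < y -> phi s (Num.truncn (y / s)) @[s --> (0 : R)^'+] --> g y.
  move=> y0; rewrite /g; have [xy|yx] := ltP x y; last first.
    apply: (@cvg_trans _ (cst (0 : R) @ (0 : R)^'+)); last exact: cvg_cst.
    apply: near_eq_cvg; near=> s; have s0 : 0 < s by [].
    by rewrite /phi /= -/(grid s y) grid_mono.
  have -> : 2^-1 * cq * f y = 2^-1 * cq * (y^-1 / Num.sqrt y) * expR (- y).
    by rewrite fE// gamma_halfE//; ring.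
  apply: cvg_trans (cvgM (cvg_fs_grid y0) (cvg_zs_grid y0)).
  apply: near_eq_cvg; near=> s; have s0 : 0 < s by [].
  rewrite /phi /= -/(grid s y) ifF; first by ring.
  have sxy : s <= y - x by near: s; apply: nbhs_right_le; rewrite subr_gt0.
  have h1 := grid_le s0 x0; have h2 := grid_gtB s0 y0.
  have : s * (grid s x)%:R < s * (grid s y)%:R by lra.
  by rewrite ltr_pM2l// ltr_nat ltnNge => /negbTE.
have [ig _ cv] := riemann_dominated phi0 (integrable_scaled_gamma_half C) phih phig.
have gE : (\int[leb]_(y in Rpos) (g y)%:E =
    (2^-1 * cq * upper_gamma (- 2^-1) x)%:E)%E.
  pose A : set R := `]x, +oo[%classic.
  have AE : A = Rpos `&` [set y | x < y].
    apply/seteqP; split => y; rewrite /A /= !in_itv /= !andbT.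
      by move=> xy; split => //; exact: lt_trans xy.
    by move=> [].
  have c0 : 2^-1 * cq != 0 :> R by rewrite mulf_neq0// ?invr_eq0 ?gt_eqF ?cq_gt0.
  have mf : measurable_fun [set: R] f.
    apply: measurable_funM; last exact: measurable_powR.
    by apply: measurableT_comp => //; exact: measurable_oppr.
  have ih : leb.-integrable A (EFin \o f).
    have : leb.-integrable A (EFin \o (fun y => x^-1 * gamma_half y)).
      apply: integrableS (integrable_scaled_gamma_half x^-1); try exact: measurable_itv.
      by rewrite AE; exact: subIsetl.
    apply: le_integrable; first exact: measurable_itv.
      by apply/measurable_EFinP; exact: measurable_funTS.
    move=> y; rewrite /A /= in_itv /= andbT => xy.
    have y0 := lt_trans x0 xy.
    rewrite fE// lee_fin !ger0_norm; last 2 first.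
    - by rewrite mulr_ge0 ?gamma_half_ge0// invr_ge0 ltW.
    - by rewrite divr_ge0 ?gamma_half_ge0// ltW.
    by rewrite mulrC ler_wpM2r ?gamma_half_ge0// lef_pV2 ?posrE// ltW.
  transitivity (\int[leb]_(y in A) ((2^-1 * cq)%:E * (EFin \o f) y))%E.
    rewrite AE integral_mkcondr; apply: eq_integral => y _.
    rewrite /patch mem_setE /g; case: ifPn => [yx|yx].
      by rewrite ifT.
    by rewrite ifF//; apply/negbTE.
  rewrite integralZl//; last exact: measurable_itv.
  rewrite /upper_gamma /Rintegral [RHS]EFinM fineK//.
  by apply: integrable_fin_num => //; exact: measurable_itv.
rewrite gE in cv.
move/fine_cvgP : cv => [_]; apply: cvg_trans.
apply: near_eq_cvg; near=> s; have s0 : 0 < s by [].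
have ss0 := sqrt_gt0 s0.
have z0 := zs_gt0 s; have z1 := zs_lt1 s0.
transitivity (fine (s%:E * ((s * Num.sqrt s)^-1%:E *
  \sum_(0 <= l <oo) (if (l <= grid s x)%N then 0 else fs l * zs s ^+ l)%:E))%E).
  rewrite -nneseriesZl; last first.
    move=> l _; case: ifP => // _.
    by rewrite lee_fin mulr_ge0// exprn_ge0// ltW.
  rewrite /=; congr (fine (_ * _)%E); apply: eq_eseriesr => l _.
  by rewrite -EFinM /phi; case: ifP => _; congr EFin; rewrite ?mulr0// mulrC.
rewrite Gn_sum ?ltW// -!EFinM /=.
by field; rewrite !gt_eqF.
Unshelve. all: by end_near. Qed.

End TruncatedLimits.

(** * Limits of the explicit series *)

Section LimitConstants.
Context {R : realType}.
Local Notation leb := (@lebesgue_measure R).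
Local Notation Rpos := (`]0%R, +oo[%classic : set R).
Implicit Types (s x y : R).

Let sqrt_gt0 s : 0 < s -> 0 < Num.sqrt s. Proof. by rewrite sqrtr_gt0. Qed.

Lemma integral_pos (D : set R) (f : R -> R) : measurable D -> (0 < leb D)%E ->
  measurable_fun D f -> (forall x, D x -> 0 < f x) ->
  (0 < \int[leb]_(x in D) (f x)%:E)%E.
Proof.
move=> mD D0 mf f0; rewrite lt0e integral_ge0 ?andbT; last first.
  by move=> x Dx; rewrite lee_fin ltW// f0.
apply/negP => /eqP i0.
have : (\int[leb]_(x in D) `|(EFin \o f) x| = 0)%E.
  rewrite -[RHS]i0; apply: eq_integral => x /[!inE] Dx.
  by rewrite /= ger0_norm// ltW// f0.
move/(ae_eq_integral_abs leb mD); case; first exact/measurable_EFinP.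
move=> N [mN N0 DN].
have : (leb D <= leb N)%E.
  apply: le_measure; rewrite ?inE//.
  move=> x Dx; apply: DN => /= h; have := h Dx => -[fx0].
  by have := f0 x Dx; rewrite fx0 ltxx.
by rewrite N0 leNgt D0.
Qed.

Lemma denominator_gt0 x : 0 < x -> 0 < denominator x :> R.
Proof.
move=> x0; rewrite /denominator ltr_wpDr//.
  by apply: Rintegral_ge0 => y _; rewrite mulr_ge0 ?expR_ge0 ?powR_ge0.
by rewrite mulr_gt0 ?expR_gt0// powR_gt0.
Qed.

(** [denominator] is measurable as the pointwise limit, up to the factor [cq], of the step functions
    of [cvg_Dn]. The exponent 1 matches the integrand of [C2_const] at k = 1. *)
Lemma measurable_denominatorV :
  measurable_fun Rpos (fun x : R => (denominator x ^+ 1)^-1).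
Proof.
have cq0 := @cq_gt0 R.
pose u n : R := n.+1%:R^-1.
have u0 n : 0 < u n by rewrite invr_gt0.
have md : measurable_fun Rpos (fun x : R => cq * denominator x).
  apply: (@measurable_fun_cvg _ _ _ _
    (fun n x => Dn (zs (u n)) (grid (u n) x) / Num.sqrt (u n))).
    move=> n; apply: measurable_funS
      (measurable_step (fun m => Dn (zs (u n)) m / Num.sqrt (u n)) (u0 n)).
      exact: measurable_itv.
    by move=> x /=; rewrite !in_itv /= !andbT; exact: ltW.
  move=> x; rewrite /= in_itv /= andbT => x0.
  have /cvg_at_rightP := cvg_Dn x0; apply; split => //.
  exact: cvg_harmonic.
have mpow : measurable_fun Rpos (fun x : R => (cq * denominator x) `^ (-1) * cq).
  apply: measurable_funM => //.
  by apply: (measurableT_comp (f := fun y : R => y `^ (-1))) => //; exact: measurable_powR.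
apply: (eq_measurable_fun _ _ mpow) => x; rewrite inE /= in_itv /= andbT => x0.
have d0 := denominator_gt0 x0.
rewrite powR_inv1 ?mulr_ge0 ?ltW// expr1 invfM mulrAC mulVf ?mul1r// gt_eqF//.
Qed.

Lemma upper_gamma_half_gt0 x : 0 < x -> 0 < upper_gamma (- 2^-1) x :> R.
Proof.
move=> x0; have cq0 := @cq_gt0 R.
pose A : set R := `]x, +oo[%classic.
pose f y : R := expR (- y) * y `^ (- 2^-1 - 1).
have mf : measurable_fun [set: R] f.
  apply: measurable_funM; last exact: measurable_powR.
  by apply: measurableT_comp => //; exact: measurable_oppr.
have mA : measurable A by exact: measurable_itv.
have ih : leb.-integrable A (EFin \o f).
  have : leb.-integrable A (EFin \o (fun y => x^-1 * gamma_half y)).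
    apply: integrableS (integrable_scaled_gamma_half x^-1); try exact: measurable_itv.
    by move=> y; rewrite /A /= !in_itv /= !andbT; exact: lt_trans.
  apply: le_integrable => //.
    by apply/measurable_EFinP; exact: measurable_funTS.
  move=> y; rewrite /A /= in_itv /= andbT => xy.
  have y0 := lt_trans x0 xy.
  have -> : f y = gamma_half y / y.
    rewrite /f gamma_halfE// -mulrA; congr (_ * _).
    rewrite powRD; last by rewrite (gt_eqF y0) implybT.
    by rewrite (powR_halfN y0) powR_inv1// ltW.
  rewrite lee_fin !ger0_norm; last 2 first.
  - by rewrite mulr_ge0 ?gamma_half_ge0// invr_ge0 ltW.
  - by rewrite divr_ge0 ?gamma_half_ge0// ltW.
  by rewrite mulrC ler_wpM2r ?gamma_half_ge0// lef_pV2 ?posrE// ltW.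
rewrite /upper_gamma /Rintegral fine_gt0//.
have : (\int[leb]_(y in A) (f y)%:E)%E \is a fin_num by exact: integrable_fin_num ih.
rewrite ge0_fin_numE; last first.
  by apply: integral_ge0 => y _; rewrite lee_fin mulr_ge0 ?expR_ge0 ?powR_ge0.
move=> ->; rewrite andbT; apply: integral_pos => //.
- by rewrite lebesgue_measure_itv /= ltry ?addye ?ltry.
- exact: measurable_funTS.
- move=> y; rewrite /A /= in_itv /= andbT => xy.
  by rewrite mulr_gt0 ?expR_gt0 ?powR_gt0// (lt_trans x0).
Qed.

(** Here [r] is the power of 2 in front of the integral. Positivity and finiteness of the constant
    are recorded because dividing by it, in [equiv_at0], requires both. *)
Lemma riemann_const (phi : R -> nat -> R) (r : R) (F h : R -> R) :
  0 < r ->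
  (forall s a, 0 < s -> s < 1 -> 0 <= phi s a) ->
  leb.-integrable Rpos (EFin \o h) ->
  (forall s x, 0 < s -> s < 1 -> 0 < x -> phi s (grid s x) <= h x) ->
  (forall x, 0 < x -> phi s (grid s x) @[s --> (0 : R)^'+] --> r * F x) ->
  (forall x, 0 < x -> 0 < F x) ->
  let C := (r%:E * \int[leb]_(x in Rpos) (F x)%:E)%E in
  [/\ (0 < C < +oo)%E,
      (forall s, 0 < s -> s < 1 ->
        (\sum_(0 <= a <oo) (phi s a)%:E < +oo)%E) &
      (s%:E * \sum_(0 <= a <oo) (phi s a)%:E)%E @[s --> (0 : R)^'+] --> C].
Proof.
move=> r0 phi0 ih phih phig F0 C.
have [ig fin cv] := riemann_dominated phi0 ih phih phig.
have mD : measurable Rpos by exact: measurable_itv.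
have iF : leb.-integrable Rpos (EFin \o F).
  have -> : EFin \o F = (fun x => ((r^-1)%R)%:E * (EFin \o (fun x => (r * F x)%R)) x)%E.
    by apply/funext => x /=; rewrite -EFinM mulKf// gt_eqF.
  exact: integrableZl.
have CE : C = (\int[leb]_(x in Rpos) (r * F x)%:E)%E.
  by rewrite /C -integralZl.
have mrF : measurable_fun Rpos (fun x => r * F x).
  by case/integrableP : ig => /measurable_EFinP.
split => //; rewrite CE//.
apply/andP; split.
  apply: integral_pos => //; first by rewrite lebesgue_measure_itv /= ltry ?addye ?ltry.
  by move=> x; rewrite /= in_itv /= andbT => x0; rewrite mulr_gt0// F0.
have : (\int[leb]_(x in Rpos) (r * F x)%:E)%E \is a fin_num.
  exact: integrable_fin_num ig.
rewrite ge0_fin_numE//.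
apply: integral_ge0 => x; rewrite /= in_itv /= andbT => x0.
by rewrite lee_fin mulr_ge0 ?(ltW r0)// ltW// F0.
Qed.

Section Rescaled.
Variables (s x : R).
Hypotheses (s0 : 0 < s) (s1 : s < 1) (x0 : 0 < x).
Let z := zs s.
Let z0 : 0 <= z. Proof. exact/ltW/zs_gt0. Qed.
Let z1 : z < 1. Proof. exact: zs_lt1. Qed.
Let m := grid s x.

Lemma ratio_le1 : Gn z m / Dn z m <= 1.
Proof. by rewrite ler_pdivrMr ?Dn_gt0// mul1r Gn_le_Dn. Qed.

Lemma ratio_ge0 : 0 <= Gn z m / Dn z m.
Proof. by rewrite divr_ge0 ?Gn_ge0// ltW// Dn_gt0. Qed.

(** The numerator is at most sqrt (s / x) and the denominator at least 1 / Q >= sqrt s / 2, so the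
    mesh disappears. *)
Lemma qs_div_Dn : qs m / Dn z m <= 2 / Num.sqrt x.
Proof.
have sx0 := sqrt_gt0 x0; have ss0 := sqrt_gt0 s0.
apply: (@le_trans _ _ ((Num.sqrt s / Num.sqrt x) / (2^-1 * Num.sqrt s))).
  apply: ler_pM => //; first by rewrite invr_ge0 ltW// Dn_gt0.
    exact: qs_grid_le.
  rewrite lef_pV2 ?posrE ?Dn_gt0 ?mulr_gt0//.
  exact: le_trans (Dinf_ge s0 s1) (Dn_ge z0 z1 m).
by rewrite le_eqVlt; apply/orP; left; apply/eqP; field; rewrite !gt_eqF.
Qed.

Lemma qsz_div_Dn : qs m * z ^+ m / Dn z m <= 2 * expR 1 * gamma_half x.
Proof.
rewrite gamma_halfE// mulrAC.
have -> : 2 * expR 1 * (expR (- x) / Num.sqrt x) =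
  2 / Num.sqrt x * (expR 1 * expR (- x)) by ring.
apply: ler_pM.
- by rewrite divr_ge0// ltW// Dn_gt0.
- exact: exprn_ge0.
- exact: qs_div_Dn.
- exact: zs_grid_le.
Qed.

Lemma Gn_div_Dn : Gn z m / Dn z m <= 2 * expR 1 * gamma_half x.
Proof.
apply: le_trans qsz_div_Dn; rewrite ler_wpM2r ?invr_ge0 ?(ltW (Dn_gt0 _ _ _))//.
exact: Gn_le.
Qed.

Lemma split_ratio j (c : R) : c * Gn z m ^+ j / Dn z m ^+ j.+1 =
  c / Dn z m * (Gn z m / Dn z m) ^+ j.
Proof. by rewrite expr_div_n exprSr invfM; ring. Qed.

End Rescaled.

Let cvg_expr (f : R -> R) (l : R) j : f s @[s --> (0 : R)^'+] --> l ->
  f s ^+ j @[s --> (0 : R)^'+] --> l ^+ j.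
Proof.
move=> fl; elim: j => [|j ih]; first by rewrite expr0; exact: cvg_cst.
by under eq_fun do rewrite exprS; rewrite exprS; exact: cvgM.
Qed.

(** Numerator and denominator each have j + 1 factors of order sqrt s, each carrying one [cq]: both
    scales cancel, and the 1/2 attached to each G_b leaves the power of 2. *)
Lemma cvg_split_ratio j x (c : R -> R) (l : R) : 0 < x ->
  c s / Num.sqrt s @[s --> (0 : R)^'+] --> cq * l ->
  (c s * Gn (zs s) (grid s x) ^+ j / Dn (zs s) (grid s x) ^+ j.+1)
     @[s --> (0 : R)^'+] -->
  (2 ^+ j)^-1 * (l * upper_gamma (- 2^-1) x ^+ j / denominator x ^+ j.+1).
Proof.
move=> x0 cl; have cq0 := @cq_gt0 R; have d0 := denominator_gt0 x0.
have h1 : (Gn (zs s) (grid s x) / Num.sqrt s) ^+ j @[s --> (0 : R)^'+] -->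
    (2^-1 * cq * upper_gamma (- 2^-1) x) ^+ j.
  by apply: cvg_expr; exact: cvg_Gn.
have h2 : ((Dn (zs s) (grid s x) / Num.sqrt s) ^+ j.+1)^-1 @[s --> (0 : R)^'+] -->
    ((cq * denominator x) ^+ j.+1)^-1.
  apply: cvgV; first by rewrite expf_neq0// gt_eqF// mulr_gt0.
  by apply: cvg_expr; exact: cvg_Dn.
have -> : (2 ^+ j)^-1 * (l * upper_gamma (- 2^-1) x ^+ j / denominator x ^+ j.+1) =
    cq * l * (2^-1 * cq * upper_gamma (- 2^-1) x) ^+ j *
    ((cq * denominator x) ^+ j.+1)^-1.
  rewrite !exprMn exprVn [cq ^+ j.+1]exprS.
  have cj : cq ^+ j != 0 :> R by rewrite expf_neq0// gt_eqF.
  have c1 : cq != 0 :> R by rewrite gt_eqF.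
  have dj : denominator x ^+ j.+1 != 0 by rewrite expf_neq0// gt_eqF.
  have tj : 2 ^+ j != 0 :> R by rewrite expf_neq0.
  move: (2 ^+ j) (cq ^+ j) (upper_gamma _ _ ^+ j) (denominator _ ^+ _) cj dj tj.
  by move=> a b g e *; field; rewrite ?c1; apply/and3P.
apply: cvg_trans (cvgM (cvgM cl h1) h2).
apply: near_eq_cvg; near=> s; have s0 : 0 < s by [].
have ss0 := sqrt_gt0 s0.
have D0 : 0 < Dn (zs s) (grid s x).
  by apply: Dn_gt0; [exact/ltW/zs_gt0|exact: zs_lt1].
rewrite /= !expr_div_n invf_div !exprS.
have a : Num.sqrt s ^+ j != 0 by rewrite expf_neq0// gt_eqF.
have b : Num.sqrt s != 0 by rewrite gt_eqF.
have c1 : Dn (zs s) (grid s x) ^+ j != 0 by rewrite expf_neq0// gt_eqF.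
have c2 : Dn (zs s) (grid s x) != 0 by rewrite gt_eqF.
by field; rewrite a b c1 c2.
Unshelve. all: by end_near. Qed.

Let G_gt0 x j : 0 < x -> 0 < upper_gamma (- 2^-1) x ^+ j / denominator x ^+ j.+1 :> R.
Proof.
by move=> x0; rewrite divr_gt0// exprn_gt0// ?denominator_gt0// upper_gamma_half_gt0.
Qed.

(** With j = k - 1, the summands of the transforms of p_k^(1) and p_k^(2), and then of 1 - z times
    the transforms of E L_k^(2) and E L_k^(3). The index is an age for the first two and a level for
    the last two. *)
Definition p1_term (z : R) j a := qs a * z ^+ a * Gn z a ^+ j / Dn z a ^+ j.+1.
Definition p2_term (z : R) j l :=
  fs l * (1 - z ^+ l) / (1 - z) * Gn z l ^+ j / Dn z l ^+ j.+1.
Definition C2_term (z : R) j a := qs a * Gn z a ^+ j / Dn z a ^+ j.+1.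
Definition C3_term (z : R) k a := Gn z a ^+ k / Dn z a ^+ k.

Let zle s : 0 < s -> 0 <= zs s. Proof. by move=> _; exact/ltW/zs_gt0. Qed.

Lemma asym_p1 j : [/\ (0 < @p1_const R j.+1 < +oo)%E,
  (forall s, 0 < s -> s < 1 -> (\sum_(0 <= a <oo) (p1_term (zs s) j a)%:E < +oo)%E) &
  (s%:E * \sum_(0 <= a <oo) (p1_term (zs s) j a)%:E)%E @[s --> (0 : R)^'+] -->
    @p1_const R j.+1].
Proof.
apply: (@riemann_const (fun s a => p1_term (zs s) j a) (2 ^+ j)^-1 _
    (fun x => 2 * expR 1 * gamma_half x)).
- by rewrite invr_gt0 exprn_gt0.
- move=> s a s0 s1; have z1 := zs_lt1 s0; have z0 := zle s0.
  by rewrite divr_ge0 ?mulr_ge0 ?exprn_ge0 ?Gn_ge0// ltW// Dn_gt0.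
- exact: integrable_scaled_gamma_half.
- move=> s x s0 s1 x0; rewrite /p1_term split_ratio.
  apply: le_trans (qsz_div_Dn s0 s1 x0).
  rewrite ler_piMr ?exprn_ile1 ?ratio_ge0 ?ratio_le1//.
  by rewrite divr_ge0 ?mulr_ge0 ?exprn_ge0 ?zle// ltW// Dn_gt0 ?zle ?zs_lt1.
- move=> x x0; apply: cvg_split_ratio => //.
  rewrite powR_halfN// mulrA.
  apply: cvg_trans (cvgM (cvg_qs_grid x0) (cvg_zs_grid x0)).
  by apply: near_eq_cvg; near=> s => /=; ring.
- move=> x x0; rewrite -mulrA; apply: mulr_gt0; last exact: G_gt0.
  by rewrite mulr_gt0 ?expR_gt0 ?powR_gt0.
Unshelve. all: by end_near. Qed.

(** Unlike [p1_term], the summand has no factor z^a; the decay at infinity must come from one factor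
    G_a / D_a, whence the condition on j. *)
Lemma asym_C2 j : (0 < j)%N -> [/\ (0 < @C2_const R j.+1 < +oo)%E,
  (forall s, 0 < s -> s < 1 -> (\sum_(0 <= a <oo) (C2_term (zs s) j a)%:E < +oo)%E) &
  (s%:E * \sum_(0 <= a <oo) (C2_term (zs s) j a)%:E)%E @[s --> (0 : R)^'+] -->
    @C2_const R j.+1].
Proof.
move=> j0.
apply: (@riemann_const (fun s a => C2_term (zs s) j a) (2 ^+ j)^-1 _
    (fun x => 4 * expR 1 * gamma_half x)).
- by rewrite invr_gt0 exprn_gt0.
- move=> s a s0 s1; have z1 := zs_lt1 s0; have z0 := zle s0.
  by rewrite divr_ge0 ?mulr_ge0 ?exprn_ge0 ?Gn_ge0// ltW// Dn_gt0.
- exact: integrable_scaled_gamma_half.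
- move=> s x s0 s1 x0; rewrite /C2_term split_ratio.
  have z1 := zs_lt1 s0; have z0 := zle s0.
  have D0 := Dn_gt0 z0 z1 (grid s x).
  have r0 := ratio_ge0 x s0; have r1 := ratio_le1 x s0.
  have q0 : 0 <= qs (grid s x) / Dn (zs s) (grid s x) by rewrite divr_ge0// ltW.
  have sx0 := sqrt_gt0 x0.
  have step : qs (grid s x) / Dn (zs s) (grid s x) *
      (Gn (zs s) (grid s x) / Dn (zs s) (grid s x)) ^+ j <=
      2 / Num.sqrt x * (Gn (zs s) (grid s x) / Dn (zs s) (grid s x)).
    apply: ler_pM => //; rewrite ?exprn_ge0//; first exact: qs_div_Dn.
    case: j j0 => // j _; rewrite exprS ler_piMr// exprn_ile1//.
  apply: (le_trans step); rewrite gamma_halfE//.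
  have e1 : expR 1 * expR (- 1) = 1 :> R by rewrite -expRD subrr expR0.
  have ge1 := expR_gt0 (1 : R); have gex := expR_gt0 (- x).
  have [xle1|xgt1] := leP x 1.
    apply: (@le_trans _ _ (2 / Num.sqrt x)).
      by rewrite ler_piMr// divr_ge0// ltW.
    rewrite [leRHS]mulrA ler_wpM2r ?invr_ge0 ?(ltW sx0)//.
    have : expR (- 1) <= expR (- x) by rewrite ler_expR lerN2.
    by rewrite -(ler_pM2l ge1) e1; lra.
  have sx1 : 1 <= Num.sqrt x by rewrite -sqrtr1; apply: ler_wsqrtr; exact: ltW.
  have h := Gn_div_Dn s0 s1 x0; rewrite gamma_halfE// in h.
  have -> : 4 * expR 1 * (expR (- x) / Num.sqrt x) =
    2 * (2 * expR 1 * (expR (- x) / Num.sqrt x)) by ring.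
  apply: ler_pM; [|exact: r0| |exact: h]; first by rewrite divr_ge0// ltW.
  by rewrite ler_pdivrMr// ler_peMr.
- move=> x x0; apply: cvg_split_ratio => //.
  by rewrite powR_halfN//; exact: cvg_qs_grid.
- move=> x x0; rewrite -mulrA; apply: mulr_gt0; last exact: G_gt0.
  by rewrite powR_gt0.
Qed.

Lemma asym_C3 j : [/\ (0 < @C3_const R j.+1 < +oo)%E,
  (forall s, 0 < s -> s < 1 -> (\sum_(0 <= a <oo) (C3_term (zs s) j.+1 a)%:E < +oo)%E) &
  (s%:E * \sum_(0 <= a <oo) (C3_term (zs s) j.+1 a)%:E)%E @[s --> (0 : R)^'+] -->
    @C3_const R j.+1].
Proof.
apply: (@riemann_const (fun s a => C3_term (zs s) j.+1 a) (2 ^+ j.+1)^-1 _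
    (fun x => 2 * expR 1 * gamma_half x)).
- by rewrite invr_gt0 exprn_gt0.
- move=> s a s0 s1; have z1 := zs_lt1 s0; have z0 := zle s0.
  by rewrite divr_ge0 ?exprn_ge0 ?Gn_ge0// ltW// Dn_gt0.
- exact: integrable_scaled_gamma_half.
- move=> s x s0 s1 x0; rewrite /C3_term -expr_div_n.
  apply: le_trans (Gn_div_Dn s0 s1 x0).
  by rewrite exprS ler_piMr ?exprn_ile1 ?ratio_ge0 ?ratio_le1.
- move=> x x0; have h : Gn (zs s) (grid s x) / Num.sqrt s @[s --> (0 : R)^'+] -->
      cq * (2^-1 * upper_gamma (- 2^-1) x).
    by rewrite mulrA [cq * _]mulrC; exact: cvg_Gn.
  have := @cvg_split_ratio j x _ _ x0 h.
  have -> : (2 ^+ j)^-1 * (2^-1 * upper_gamma (- 2^-1) x *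
      upper_gamma (- 2^-1) x ^+ j / denominator x ^+ j.+1) =
      (2 ^+ j.+1)^-1 * (upper_gamma (- 2^-1) x ^+ j.+1 / denominator x ^+ j.+1).
    by rewrite [in RHS]exprS invfM [upper_gamma _ _ ^+ j.+1]exprS; ring.
  apply: cvg_trans; apply: near_eq_cvg; near=> s => /=.
  by rewrite /C3_term [Gn _ _ ^+ j.+1]exprS.
- by move=> x x0; rewrite divr_gt0// exprn_gt0// ?denominator_gt0// upper_gamma_half_gt0.
Unshelve. all: by end_near. Qed.

(** This majorant for [p2_term] is bounded near 0 and of order x^(-3/2) at infinity; its integral is
    a telescoping sum of values of f. *)
Lemma integrable_fs_step (C : R) :
  leb.-integrable Rpos (EFin \o (fun x => C * fs (Num.truncn (x / 1)).+1)).
Proof.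
have -> : EFin \o (fun x => C * fs (Num.truncn (x / 1)).+1) =
    (fun x => C%:E * (fs (Num.truncn (x / 1)).+1)%:E)%E by apply/funext => x.
apply: integrableZl; first exact: measurable_itv.
have m1 : measurable_fun Rpos (fun x : R => fs (Num.truncn (x / 1)).+1 : R).
  apply: measurable_funS (measurable_step (fun n => fs n.+1) ltr01).
    exact: measurable_itv.
  by move=> x /=; rewrite !in_itv /= !andbT; exact: ltW.
apply/integrableP; split; first exact/measurable_EFinP.
under eq_integral => x _ do rewrite gee0_abs ?lee_fin//.
rewrite (integral_step (phi := fun n => fs n.+1))// mul1e.
apply: (@le_lt_trans _ _ 1%:E); last exact: ltry.
apply: lime_le; first by apply: is_cvg_nneseries => n _ _; rewrite lee_fin.
apply: nearW => n; rewrite sumEFin lee_fin.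
rewrite -(big_add1 _ _ 0 n.+1 xpredT) fs_sum// qs0 gerBl//.
Qed.

Lemma asym_p2 j : [/\ (0 < @p2_const R j.+1 < +oo)%E,
  (forall s, 0 < s -> s < 1 -> (\sum_(0 <= a <oo) (p2_term (zs s) j a)%:E < +oo)%E) &
  (s%:E * \sum_(0 <= a <oo) (p2_term (zs s) j a)%:E)%E @[s --> (0 : R)^'+] -->
    @p2_const R j.+1].
Proof.
apply: (@riemann_const (fun s a => p2_term (zs s) j a) (2 ^+ j.+1)^-1 _
    (fun x => 64 * fs (Num.truncn (x / 1)).+1)).
- by rewrite invr_gt0 exprn_gt0.
- move=> s a s0 s1; have z1 := zs_lt1 s0; have z0 := zle s0.
  have D0 := Dn_gt0 z0 z1 a.
  apply: divr_ge0; last by rewrite exprn_ge0// ltW.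
  apply: mulr_ge0; last by rewrite exprn_ge0// Gn_ge0.
  apply: divr_ge0; last by rewrite subr_ge0 ltW.
  by rewrite mulr_ge0// subr_ge0 exprn_ile1// ltW.
- exact: integrable_fs_step.
- move=> s x s0 s1 x0; rewrite /p2_term split_ratio divr1.
  have z1 := zs_lt1 s0; have z0 := zle s0.
  have D0 := Dn_gt0 z0 z1 (grid s x).
  have zm1 : zs s ^+ grid s x <= 1 by rewrite exprn_ile1// ltW.
  have zs1 : 0 < 1 - zs s by rewrite subr_gt0.
  apply: (@le_trans _ _ (fs (grid s x) * (1 - zs s ^+ grid s x) / (1 - zs s) /
      Dn (zs s) (grid s x))).
    rewrite ler_piMr ?exprn_ile1 ?ratio_ge0 ?ratio_le1//.
    by rewrite divr_ge0 ?(ltW D0)// divr_ge0 ?(ltW zs1)// mulr_ge0// subr_ge0.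
  have sx0 := sqrt_gt0 x0; have ss0 := sqrt_gt0 s0.
  case E : (grid s x) => [|l]; first by rewrite [fs 0]/= !mul0r mulr_ge0.
  (* For x < 1 and m = [grid s x]: (1 - z^m) / (1 - z) <= m, m f(m) <= q(m), and D_m >= q(m) z^m >=
     q(m) / 32, so the quotient is at most 32 = 64 f(1). *)
  have [xlt1|x1] := ltP x 1.
    have -> : Num.truncn x = 0%N by apply: truncn_def; rewrite xlt1 ltW.
    have -> : fs 1 = 2^-1 :> R by rewrite fsS qs0 mulr0 add0r mul1r.
    have b1 : (1 - zs s ^+ l.+1) / (1 - zs s) <= l.+1%:R.
      rewrite ler_pdivrMr// -[in leLHS](expr1n _ l.+1) subrXX mulrC ler_wpM2r ?(ltW zs1)//.
      have -> : l.+1%:R = \sum_(i < l.+1) 1 :> R by rewrite sumr_const card_ord.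
      by apply: ler_sum => i _; rewrite expr1n mul1r exprn_ile1// ltW.
    have b2 : fs l.+1 * l.+1%:R <= qs l.+1 :> R by rewrite -ler_pdivlMr ?ltr0n// fs_le.
    have b3 := Dn_ge_qs z0 z1 l.+1.
    have b4 : expR (- x) <= zs s ^+ l.+1 by rewrite -E zs_grid_ge.
    have b5 : expR (- 1) <= expR (- x) by rewrite ler_expR lerN2 ltW.
    (* A crude bound: e^(-1/2) >= 1/2, so e^(-1) is at least 1/4. *)
    have b6 : 32^-1 <= expR (- 1) :> R.
      have e : expR (- 1 / 2) ^+ 2 = expR (-1) :> R.
        by rewrite -expRM_natl; congr expR; lra.
      have h : 2^-1 <= expR (- 1 / 2) :> R by have := @expR_ge1Dx R (- 1 / 2); lra.
      by rewrite -e expr2; nra.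
    rewrite E in D0; rewrite ler_pdivrMr//.
    have q0 := @qs_gt0 R l.+1.
    apply: (@le_trans _ _ (qs l.+1)).
      by apply: le_trans b2; rewrite -mulrA ler_wpM2l.
    have : qs l.+1 * 32^-1 <= qs l.+1 * zs s ^+ l.+1.
      by rewrite ler_pM2l//; exact: le_trans b6 (le_trans b5 b4).
    lra.
  have g1 : (0 < Num.truncn x)%N by rewrite truncn_gt0.
  have xi : (Num.truncn x)%:R <= x by have /truncn_itv/andP[] := ltW x0.
  (* For x >= 1 the quotient is at most 8 x^(-3/2), and f at the integer part of x plus 1 is at
     least x^(-3/2) / 8; hence the constant 64. *)
  have lower : (8 * (x * Num.sqrt x))^-1 <= fs (Num.truncn x).+1 :> R.
    rewrite fsS; have n0 : 0 < (Num.truncn x)%:R :> R by rewrite ltr0n.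
    apply: (@le_trans _ _ ((2 * Num.sqrt (Num.truncn x)%:R)^-1 / (2 * (Num.truncn x)%:R + 2))); last first.
      by rewrite ler_wpM2r ?qs_ge// invr_ge0; lra.
    rewrite -invfM lef_pV2 ?posrE; last 2 first.
    - by rewrite !mulr_gt0.
    - by rewrite !mulr_gt0 ?sqrt_gt0//; lra.
    have a1 : 2 * Num.sqrt (Num.truncn x)%:R <= 2 * Num.sqrt x.
      by rewrite ler_pM2l//; apply: ler_wsqrtr.
    have a2 : 2 * (Num.truncn x)%:R + 2 <= 4 * x by lra.
    have : 2 * Num.sqrt (Num.truncn x)%:R * (2 * (Num.truncn x)%:R + 2) <= 2 * Num.sqrt x * (4 * x).
      by apply: ler_pM => //; rewrite ?mulr_ge0 ?sqrtr_ge0//; lra.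
    lra.
  apply: le_trans (_ : 8 / (x * Num.sqrt x) <= _); last first.
    by move: lower; rewrite invfM; lra.
  have upper : fs l.+1 <= (Num.sqrt s / Num.sqrt x) * (2 * s / x).
    apply: le_trans (fs_le l) _; apply: ler_pM => //.
      by rewrite -E; exact: qs_grid_le.
    rewrite -[2 * s / x]invf_div lef_pV2 ?posrE ?ltr0n ?divr_gt0 ?mulr_gt0//.
    rewrite ler_pdivrMr ?mulr_gt0//.
    have := grid_gt s0 x0; rewrite E => /ltW/le_trans; apply.
    have l1 : l.+2%:R <= 2 * l.+1%:R :> R.
      by rewrite -(natr1 l.+1) -(natr1 l); have := ler0n R l; lra.
    by have := ler_wpM2l (ltW s0) l1; lra.
  have low1 : 2^-1 * s <= 1 - zs s by exact: zs_ge.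
  have low2 : 2^-1 * Num.sqrt s <= Dn (zs s) l.+1.
    exact: le_trans (Dinf_ge s0 s1) (Dn_ge z0 z1 _).
  apply: (@le_trans _ _ ((Num.sqrt s / Num.sqrt x) * (2 * s / x) / (2^-1 * s) / (2^-1 * Num.sqrt s))).
    apply: ler_pM => //.
    - rewrite divr_ge0 ?(ltW zs1)// mulr_ge0// subr_ge0 exprn_ile1// ltW//.
    - by rewrite invr_ge0 ltW// Dn_gt0.
    - apply: ler_pM => //.
      + by rewrite mulr_ge0// subr_ge0 exprn_ile1// ltW.
      + by rewrite invr_ge0 ltW.
      + apply: le_trans upper; rewrite ler_piMr//.
        by rewrite gerBl// exprn_ge0.
      + by rewrite lef_pV2 ?posrE// mulr_gt0.
    - by rewrite lef_pV2 ?posrE ?mulr_gt0 ?Dn_gt0.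
  by rewrite le_eqVlt; apply/orP; left; apply/eqP; field; rewrite !gt_eqF.
- move=> x x0.
  have h : fs (grid s x) * (1 - zs s ^+ grid s x) / (1 - zs s) / Num.sqrt s
      @[s --> (0 : R)^'+] --> cq * (2^-1 * (x `^ (- (3 / 2)) * (1 - expR (- x)))).
    have -> : cq * (2^-1 * (x `^ (- (3 / 2)) * (1 - expR (- x)))) =
        2^-1 * cq * (x^-1 / Num.sqrt x) * (1 - expR (- x)) * 1^-1.
      have -> : - (3 / 2) = -1 - 2^-1 :> R by lra.
      rewrite powRD; last by rewrite (gt_eqF x0) implybT.
      by rewrite (powR_halfN x0) powR_inv1 ?ltW// invr1; ring.
    have h2 : 1 - zs s ^+ grid s x @[s --> (0 : R)^'+] --> 1 - expR (- x).
      by apply: cvgB; [exact: cvg_cst|exact: cvg_zs_grid].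
    have h3 : ((1 - zs s) / s)^-1 @[s --> (0 : R)^'+] --> (1 : R)^-1.
      by apply: cvgV; [exact: oner_neq0|exact: cvg_one_minus_zs].
    apply: cvg_trans (cvgM (cvgM (cvg_fs_grid x0) h2) h3).
    apply: near_eq_cvg; near=> s; have s0 : 0 < s by [].
    have ss0 := sqrt_gt0 s0.
    have zs1 : 0 < 1 - zs s by rewrite subr_gt0 zs_lt1.
    by rewrite /=; field; rewrite !gt_eqF.
  have := @cvg_split_ratio j x _ _ x0 h.
  have -> : (2 ^+ j)^-1 * (2^-1 * (x `^ (- (3 / 2)) * (1 - expR (- x))) *
      upper_gamma (- 2^-1) x ^+ j / denominator x ^+ j.+1) =
      (2 ^+ j.+1)^-1 * (x `^ (- (3 / 2)) * (1 - expR (- x)) *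
      upper_gamma (- 2^-1) x ^+ j / denominator x ^+ j.+1).
    by rewrite [in RHS]exprS invfM; ring.
  by apply: cvg_trans.
- move=> x x0; rewrite -mulrA; apply: mulr_gt0; last exact: G_gt0.
  by rewrite mulr_gt0 ?powR_gt0// subr_gt0 expR_lt1 oppr_lt0.
Unshelve. all: by end_near. Qed.

(** On x >= 1 the denominator is at most 1 + Gamma(1/2), so the integrand is at least a multiple of
    x^(-1/2), which is not integrable at infinity. *)
Lemma C2_const1 : @C2_const R 1 = +oo%E.
Proof.
have pi0 : 0 < Num.sqrt pi :> R by rewrite sqrtr_gt0 pi_gt0.
pose K : R := 1 + Num.sqrt pi.
have K0 : 0 < K by rewrite /K; lra.
have dK x : 1 <= x -> denominator x <= K.
  move=> x1; have x0 : 0 < x by lra.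
  apply: lerD.
    rewrite powR_halfN// mulr_ile1 ?invr_ge0 ?sqrtr_ge0 ?expR_ge0//.
      rewrite invf_le1 ?sqrt_gt0//.
      by rewrite -[leLHS]sqrtr1; apply: ler_wsqrtr.
    by rewrite expR_le1 oppr_le0 ltW.
  rewrite -lee_fin /lower_gamma /Rintegral.
  pose A : set R := `]0%R, x[%classic.
  have mA : measurable A by exact: measurable_itv.
  have AP : A `<=` Rpos by move=> y; rewrite /A /= !in_itv /= andbT => /andP[].
  have ih : leb.-integrable A (EFin \o gamma_half).
    by apply: integrableS (integrable_gamma_half); try exact: measurable_itv.
  rewrite fineK; last by apply: integrable_fin_num.
  rewrite -integral_gamma_half; apply: ge0_subset_integral => //.
  - by apply/measurable_EFinP; apply: measurable_funTS; exact: measurable_gamma_half.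
  - by move=> y _; rewrite lee_fin; exact: gamma_half_ge0.
have mupper : measurable_fun Rpos (fun x : R => x `^ (- 2^-1) * upper_gamma (- 2^-1) x ^+ 0 / denominator x ^+ 1).
  apply: measurable_funM; last exact: measurable_denominatorV.
  by apply: measurable_funTS; apply: measurable_funM => //; exact: measurable_powR.
rewrite /C2_const expr0 invr1 mul1e.
apply/eqyP => A A0.
(* Chosen so that (N - 1) / (K sqrt N), a lower bound for the integral over [1, N], is at least
   A. *)
pose N := (Num.truncn ((A * K + 1) ^+ 2)).+2.
have N1 : 1 <= N%:R :> R by rewrite ler1n.
have AN : A * K + 1 <= Num.sqrt N%:R.
  have AK : 0 <= A * K + 1 by rewrite addr_ge0// mulr_ge0// ltW.
  rewrite -[leLHS]ger0_norm// -sqrtr_sqr; apply: ler_wsqrtr.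
  have /truncn_itv/andP[_ /ltW/le_trans] : 0 <= (A * K + 1) ^+ 2 by exact: sqr_ge0.
  by apply; rewrite ler_nat.
pose B : set R := `[1, N%:R]%classic.
have mB : measurable B by exact: measurable_itv.
have BP : B `<=` Rpos.
  by move=> y; rewrite /B /= !in_itv /= andbT => /andP[h _]; lra.
have NN : 0 < Num.sqrt N%:R :> R by rewrite sqrtr_gt0; lra.
apply: (@le_trans _ _ (\int[leb]_(x in B) (cst (K * Num.sqrt N%:R)^-1%:E x))%E).
  have e : leb B = (N%:R - 1)%:E.
    have N1' : 1 < N%:R :> R by rewrite ltr1n.
    by rewrite /B lebesgue_measure_itv /= lte_fin N1' -EFinB.
  apply: (@le_trans _ _ ((K * Num.sqrt N%:R)^-1%:E * leb B)%E); last first.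
    by rewrite (integral_cst leb mB).
  rewrite e -EFinM lee_fin mulrC ler_pdivlMr ?mulr_gt0//.
  have := sqr_sqrtr (ltW (lt_le_trans ltr01 N1)).
  move: AN NN; set t := Num.sqrt _ => AN NN e2; rewrite -e2 mulrA.
  have AK : 0 <= A * K by rewrite mulr_ge0// ltW.
  have : A * K * t <= (t - 1) * t by rewrite ler_wpM2r// ?(ltW NN)//; lra.
  rewrite expr2; lra.
apply: (@le_trans _ _ (\int[leb]_(x in B) (x `^ (- 2^-1) * upper_gamma (- 2^-1) x ^+ 0 / denominator x ^+ 1)%:E)%E).
  apply: ge0_le_integral => //.
  - by move=> y _; rewrite lee_fin invr_ge0 mulr_ge0 ?ltW.
  - by apply/measurable_EFinP; exact: measurable_funS mupper.
  - move=> y; rewrite /B /= in_itv /= => /andP[y1 yN]; rewrite lee_fin expr0 mulr1 expr1.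
    have y0 : 0 < y by lra.
    rewrite powR_halfN// -invfM lef_pV2 ?posrE ?mulr_gt0 ?sqrt_gt0 ?denominator_gt0//.
    rewrite mulrC; apply: ler_pM; rewrite ?sqrtr_ge0 ?(ltW (denominator_gt0 _))//.
      exact: dK.
    exact: ler_wsqrtr.
apply: ge0_subset_integral => //.
  by apply/measurable_EFinP.
move=> y; rewrite /= in_itv /= andbT => y0; rewrite lee_fin.
by rewrite expr0 mulr1 divr_ge0 ?powR_ge0// exprn_ge0// ltW// denominator_gt0.
Qed.

End LimitConstants.

(** * Karamata's theorem, the Abelian theorem and slow oscillation *)

Section Karamata.
Context {R : realType}.
Implicit Types (a : nat -> R) (h p : R -> R) (s t : R).

(** Karamata's functional: the explicit factor z^n makes the series converge for every bounded h,
    and a suitable h turns it into a partial sum of [a]. *)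
Definition wsum a h s : \bar R :=
  (\sum_(0 <= n <oo) (a n * zs s ^+ n * h (zs s ^+ n))%:E)%E.

Definition ws a h s : R := fine (wsum a h s).

Definition unit_bounded h := exists M : R, forall t, 0 <= t -> t <= 1 -> 0 <= h t <= M.

Lemma zsX01 s n : 0 < s -> 0 <= zs s ^+ n <= 1.
Proof.
move=> s0; rewrite exprn_ge0 ?exprn_ile1// ltW// ?zs_lt1//; exact: zs_gt0.
Qed.

Definition transformable a := (forall n, 0 <= a n) /\
  (forall s, 0 < s -> s < 1 -> (gf a (zs s) < +oo)%E).

Lemma transformable1 : transformable (fun=> 1).
Proof.
split=> // s s0 s1; rewrite gf1 ?ltry ?zs_lt1//; exact/ltW/zs_gt0.
Qed.

Section Weighted.
Variable a : nat -> R.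
Hypothesis ta : transformable a.

Lemma wterm_ge0 h s n : unit_bounded h -> 0 < s ->
  (0 <= (a n * zs s ^+ n * h (zs s ^+ n))%:E)%E.
Proof.
move=> [M hM] s0; have /andP[z0 z1] := zsX01 n s0.
have /andP[h0 _] := hM _ z0 z1; rewrite lee_fin !mulr_ge0//.
by case: ta.
Qed.

Lemma wsum_fin h s : unit_bounded h -> 0 < s -> s < 1 ->
  wsum a h s \is a fin_num.
Proof.
move=> bh s0 s1; have [a0 afin] := ta.
rewrite ge0_fin_numE; last by apply: nneseries_ge0 => n _ _; exact: wterm_ge0.
have [M hM] := bh.
have M0 : 0 <= M by have /andP[/le_trans] := hM 0 (lexx _) ler01; apply.
have az0 n : 0 <= a n * zs s ^+ n by rewrite mulr_ge0//; case/andP: (zsX01 n s0).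
apply: (@le_lt_trans _ _ (M%:E * gf a (zs s))%E).
  rewrite /gf -nneseriesZl; last by move=> n _; rewrite lee_fin.
  apply: lee_nneseries => n *; first exact: wterm_ge0.
  rewrite -EFinM lee_fin mulrC ler_wpM2r//.
  by have /andP[z0 z1] := zsX01 n s0; have /andP[] := hM _ z0 z1.
by rewrite lte_mul_pinfty// ?lee_fin// afin.
Qed.

Lemma wsE h s : unit_bounded h -> 0 < s -> s < 1 -> wsum a h s = (ws a h s)%:E.
Proof. by move=> *; rewrite /ws fineK// wsum_fin. Qed.

Lemma ws_ge0 h s : unit_bounded h -> 0 < s -> 0 <= ws a h s.
Proof.
by move=> bh s0; apply/fine_ge0/nneseries_ge0 => n _ _; exact: wterm_ge0.
Qed.

Lemma unit_boundedD h p : unit_bounded h -> unit_bounded p ->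
  unit_bounded (fun t => h t + p t).
Proof.
move=> [M hM] [N pN]; exists (M + N) => t t0 t1.
have /andP[h0 h1] := hM t t0 t1; have /andP[p0 p1] := pN t t0 t1.
by rewrite addr_ge0//= lerD.
Qed.

Lemma unit_boundedZ (c : R) h : 0 <= c -> unit_bounded h ->
  unit_bounded (fun t => c * h t).
Proof.
move=> c0 [M hM]; exists (c * M) => t t0 t1.
have /andP[h0 h1] := hM t t0 t1.
by rewrite mulr_ge0//= ler_wpM2l.
Qed.

Lemma unit_bounded_cst (c : R) : 0 <= c -> unit_bounded (fun=> c).
Proof. by move=> c0; exists c => t _ _; rewrite c0 lexx. Qed.

Lemma wsD h p s : unit_bounded h -> unit_bounded p -> 0 < s -> s < 1 ->
  ws a (fun t => h t + p t) s = ws a h s + ws a p s.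
Proof.
move=> bh bp s0 s1; apply: EFin_inj; rewrite EFinD -!wsE//; last exact: unit_boundedD.
rewrite /wsum -nneseriesD; last 2 first.
- by move=> n _ _; exact: wterm_ge0.
- by move=> n _ _; exact: wterm_ge0.
by apply: eq_eseriesr => n _; rewrite -EFinD mulrDr.
Qed.

Lemma wsZ (c : R) h s : 0 <= c -> unit_bounded h -> 0 < s -> s < 1 ->
  ws a (fun t => c * h t) s = c * ws a h s.
Proof.
move=> c0 bh s0 s1; apply: EFin_inj; rewrite EFinM -!wsE//; last exact: unit_boundedZ.
rewrite /wsum -nneseriesZl; last by move=> n _; exact: wterm_ge0.
by apply: eq_eseriesr => n _; rewrite -EFinM; congr EFin; ring.
Qed.

Lemma le_ws h p s : unit_bounded h -> unit_bounded p -> 0 < s -> s < 1 ->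
  (forall t, 0 <= t -> t <= 1 -> h t <= p t) -> ws a h s <= ws a p s.
Proof.
move=> bh bp s0 s1 hp; rewrite -lee_fin -!wsE//.
apply: lee_nneseries => n *; first exact: wterm_ge0.
have /andP[z0 z1] := zsX01 n s0.
by rewrite lee_fin ler_wpM2l ?hp// mulr_ge0//; case: ta.
Qed.

Lemma eq_ws h p s : 0 < s ->
  (forall t, 0 <= t -> t <= 1 -> h t = p t) -> ws a h s = ws a p s.
Proof.
move=> s0 hp; congr fine; apply: eq_eseriesr => n _.
by have /andP[z0 z1] := zsX01 n s0; rewrite hp.
Qed.

Lemma ws_gf s k : ws a (fun t => t ^+ k) s = fine (gf a (zs (k.+1%:R * s))).
Proof.
congr fine; apply: eq_eseriesr => n _; congr EFin; rewrite -mulrA; congr (_ * _).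
by rewrite -exprS -exprM !zsX; congr expR; rewrite natrM; ring.
Qed.

End Weighted.

Section Compare.
Variables (a : nat -> R) (A : R).
Hypothesis ta : transformable a.
Hypothesis aA : s * fine (gf a (zs s)) @[s --> (0 : R)^'+] --> A.

Let one : nat -> R := fun=> 1.
Let t1 : transformable one := transformable1.

(* The sequence [a] is compared with the constant sequence [A], so that the
   limit functional need not be identified. *)
Let E h := s * ws a h s - A * (s * ws one h s) @[s --> (0 : R)^'+] --> (0 : R).

Lemma cvg_gf1 : s * fine (gf one (zs s)) @[s --> (0 : R)^'+] --> (1 : R).
Proof.
have h : ((1 - zs s) / s)^-1 @[s --> (0 : R)^'+] --> (1 : R)^-1.
  by apply: cvgV; [exact: oner_neq0|exact: cvg_one_minus_zs].
rewrite invr1 in h; apply: cvg_trans h; apply: near_eq_cvg; near=> s.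
have s0 : 0 < s by [].
by rewrite gf1 ?zs_lt1//= ?invf_div//; exact/ltW/zs_gt0.
Unshelve. all: by end_near. Qed.

(** On t^k the functional is the transform taken at (k + 1) s, whence the factor 1 / (k + 1). *)
Let scale (b : nat -> R) (B : R) k :
  s * fine (gf b (zs s)) @[s --> (0 : R)^'+] --> B ->
  s * ws b (fun t => t ^+ k) s @[s --> (0 : R)^'+] --> k.+1%:R^-1 * B.
Proof.
move=> bB.
have cs : k.+1%:R * s @[s --> (0 : R)^'+] --> (0 : R)^'+.
  move=> V [e /= e0 V0].
  change (\forall s \near (0 : R)^'+, V (k.+1%:R * s)).
  near=> s; have s0 : 0 < s by [].
  have ks0 : 0 < k.+1%:R * s by rewrite mulr_gt0.
  apply: V0 => //=.
  rewrite sub0r normrN gtr0_norm ?mulr_gt0//.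
  rewrite mulrC -ltr_pdivlMr ?ltr0n//; near: s; apply: nbhs_right_lt.
  by rewrite divr_gt0.
have h : k.+1%:R^-1 * (k.+1%:R * s * fine (gf b (zs (k.+1%:R * s))))
    @[s --> (0 : R)^'+] --> k.+1%:R^-1 * B.
  by apply: cvgM; [exact: cvg_cst|exact: (cvg_comp _ _ cs bB)].
apply: cvg_trans h; apply: near_eq_cvg; near=> s => /=.
by rewrite ws_gf -mulrA mulKf.
Unshelve. all: by end_near. Qed.

Let E_expr k : E (fun t => t ^+ k).
Proof.
have h1 := @scale a A k aA; have h2 := @scale one 1 k cvg_gf1.
rewrite /E.
have : s * ws a (fun t => t ^+ k) s - A * (s * ws one (fun t => t ^+ k) s)
    @[s --> (0 : R)^'+] --> k.+1%:R^-1 * A - A * (k.+1%:R^-1 * 1).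
  by apply: cvgB => //; apply: cvgM => //; exact: cvg_cst.
by rewrite mulr1 [A * _]mulrC subrr.
Qed.

Let near01 (P : R -> Prop) : (forall s, 0 < s -> s < 1 -> P s) ->
  \forall s \near (0 : R)^'+, P s.
Proof.
move=> HP; near=> s; apply: HP; first by [].
by near: s; apply: nbhs_right_lt.
Unshelve. all: by end_near. Qed.

Let cvg_eq01 (f g : R -> R) (l l' : R) : (forall s, 0 < s -> s < 1 -> f s = g s) ->
  l = l' -> f s @[s --> (0 : R)^'+] --> l -> g s @[s --> (0 : R)^'+] --> l'.
Proof.
move=> fg -> fl; apply: cvg_trans fl; apply: near_eq_cvg; exact: near01.
Qed.

Let E_add h p : unit_bounded h -> unit_bounded p -> E h -> E p ->
  E (fun t => h t + p t).
Proof.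
rewrite /E => bh bp Eh Ep; apply: (cvg_eq01 _ (addr0 0) (cvgD Eh Ep)) => s s0 s1.
by rewrite /= !wsD//; ring.
Qed.

Let E_scale (c : R) h : 0 <= c -> unit_bounded h -> E h -> E (fun t => c * h t).
Proof.
rewrite /E => c0 bh Eh.
apply: (cvg_eq01 _ (mulr0 c) (cvgM (cvg_cst c) Eh)) => s s0 s1.
by rewrite /= !wsZ//; ring.
Qed.

Let E_eq h p : (forall t, 0 <= t -> t <= 1 -> h t = p t) -> E h -> E p.
Proof.
rewrite /E => hp Eh; apply: (cvg_eq01 _ erefl Eh) => s s0 s1.
by rewrite (eq_ws a s0 hp) (eq_ws one s0 hp).
Qed.

(** The functional is only handled on nonnegative functions, so signed combinations of monomials are
    reached by subtraction. *)
Let E_sub h p : unit_bounded h -> unit_bounded p -> E h ->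
  E (fun t => h t + p t) -> E p.
Proof.
rewrite /E => bh bp Eh Ehp.
have h0 : (s * ws a (fun t => h t + p t) s - A * (s * ws one (fun t => h t + p t) s)) -
    (s * ws a h s - A * (s * ws one h s)) @[s --> (0 : R)^'+] --> (0 : R) - 0.
  exact: cvgB.
apply: (cvg_eq01 _ (subr0 0) h0) => s s0 s1.
by rewrite /= !wsD//; ring.
Qed.

(** These products are nonnegative on [0, 1], and in terms of them Bernstein's polynomials of a
    nonnegative function have nonnegative coefficients. *)
Definition bmono i m t : R := t ^+ i * (1 - t) ^+ m.

Lemma bmono_bounded i m : unit_bounded (bmono i m).
Proof.
exists 1 => t t0 t1'; rewrite /bmono mulr_ge0 ?exprn_ge0 ?subr_ge0//=.
by rewrite mulr_ile1 ?exprn_ge0 ?subr_ge0 ?exprn_ile1 ?subr_ge0// gerBl.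
Qed.

Let E_bmono i m : E (bmono i m).
Proof.
elim: m i => [|m ih] i.
  by apply: (E_eq _ (E_expr i)) => t _ _; rewrite /bmono expr0 mulr1.
apply: (E_sub (bmono_bounded i.+1 m) (bmono_bounded i m.+1) (ih i.+1)).
by apply: (E_eq _ (ih i)) => t _ _; rewrite /bmono !exprS; ring.
Qed.

(* Bernstein's operator, by recursion on the degree: [bern n f t] is the mean
   of [f] under the binomial law of parameters [n] and [t]. *)
Fixpoint bern n (f : nat -> R) t : R :=
  if n is n'.+1 then t * bern n' (fun k => f k.+1) t + (1 - t) * bern n' f t
  else f 0%N.

Lemma le_bern n (f g : nat -> R) t : 0 <= t -> t <= 1 ->
  (forall k, (k <= n)%N -> f k <= g k) -> bern n f t <= bern n g t.
Proof.
move=> t0 tle1; elim: n f g => [|n ih] f g fg /=; first exact: fg.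
apply: lerD; apply: ler_wpM2l; rewrite ?subr_ge0//; apply: ih => k kn.
  exact: fg.
by apply: fg; exact: leqW.
Qed.

Lemma bern_cst n (c : R) t : bern n (fun=> c) t = c.
Proof. by elim: n => //= n ->; ring. Qed.

Lemma bernD n (f g : nat -> R) t : bern n (fun k => f k + g k) t = bern n f t + bern n g t.
Proof. by elim: n f g => //= n ih f g; rewrite !ih; ring. Qed.

Lemma bernZ n (c : R) (f : nat -> R) t : bern n (fun k => c * f k) t = c * bern n f t.
Proof. by elim: n f => //= n ih f; rewrite !ih; ring. Qed.

(** Squared bias plus variance of the binomial law. The centre c is arbitrary because the recursion
    on the degree replaces it by c - 1; the use is with c = n t. *)
Lemma bern_sqr n (c : R) t :
  bern n (fun k => (k%:R - c) ^+ 2) t = (n%:R * t - c) ^+ 2 + n%:R * (t * (1 - t)).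
Proof.
elim: n c => [|n ih] c /=; first by rewrite !mul0r addr0.
have -> : bern n (fun k => (k.+1%:R - c) ^+ 2) t = bern n (fun k => (k%:R - (c - 1)) ^+ 2) t.
  by congr (bern n _ t); apply/funext => k; rewrite -natr1; ring.
by rewrite !ih -natr1; ring.
Qed.

(** The factor [bmono i m] is there for the induction: each degree multiplies by t or by 1 - t, that
    is, raises i or m. *)
Let E_bern n f i m : (forall k, 0 <= f k) ->
  unit_bounded (fun t => bmono i m t * bern n f t) /\
  E (fun t => bmono i m t * bern n f t).
Proof.
elim: n f i m => [|n ih] f i m f0 /=.
  split.
    have [M hM] := unit_boundedZ (f0 0%N) (bmono_bounded i m).
    by exists M => t t0 t1'; rewrite mulrC hM.
  by apply: (E_eq _ (E_scale (f0 0%N) (bmono_bounded i m) (E_bmono i m))) => t _ _; rewrite mulrC.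
have [b1 e1] := ih (fun k => f k.+1) i.+1 m (fun k => f0 k.+1).
have [b2 e2] := ih f i m.+1 f0.
have eq t : bmono i.+1 m t * bern n (fun k => f k.+1) t + bmono i m.+1 t * bern n f t =
    bmono i m t * (t * bern n (fun k => f k.+1) t + (1 - t) * bern n f t).
  by rewrite /bmono !exprS; ring.
split; last by apply: (E_eq _ (E_add b1 b2 e1 e2)) => t _ _; rewrite eq.
by have [M hM] := unit_boundedD b1 b2; exists M => t t0 t1'; rewrite -eq hM.
Qed.

Let ws1 (b : nat -> R) s : ws b (fun=> 1) s = fine (gf b (zs s)).
Proof. by congr fine; apply: eq_eseriesr => n _; rewrite mulr1. Qed.

Let E_approx h : unit_bounded h ->
  (forall e, 0 < e -> exists2 p, unit_bounded p /\ E p &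
     forall t, 0 <= t -> t <= 1 -> `|h t - p t| <= e) -> E h.
Proof.
move=> bh happ; apply/cvgrPdist_le => e e0.
(* The approximation error e / K enters with total weight at most (|A| + 1) + 2 |A|, which leaves at
   most 3e/4; the last e/4 is for [p]. *)
pose K := `|A| * 4 + 4.
have K0 : 0 < K by rewrite /K; have := normr_ge0 A; lra.
have [p [bp Ep] hp] := happ (e / K) ltac:(by rewrite divr_gt0).
have eK : 0 <= e / K by rewrite ltW// divr_gt0.
have bc : unit_bounded (fun=> e / K : R) by exact: unit_bounded_cst.
have key b s : transformable b -> 0 < s -> s < 1 ->
    `|ws b h s - ws b p s| <= e / K * fine (gf b (zs s)).
  move=> tb s0 s1; rewrite -ws1 -(wsZ tb eK) //; last exact: unit_bounded_cst.
  have bc1 : unit_bounded (fun=> e / K * 1 : R).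
    by apply: unit_bounded_cst; rewrite mulr1.
  have u1 : ws b p s <= ws b h s + ws b (fun=> e / K * 1) s.
    rewrite -wsD//; apply: le_ws => //; first exact: unit_boundedD.
    by move=> t t0 tle1; have := hp t t0 tle1; rewrite ler_norml mulr1; lra.
  have u2 : ws b h s <= ws b p s + ws b (fun=> e / K * 1) s.
    rewrite -wsD//; apply: le_ws => //; first exact: unit_boundedD.
    by move=> t t0 tle1; have := hp t t0 tle1; rewrite ler_norml mulr1; lra.
  by rewrite ler_norml; apply/andP; split; lra.
near=> s.
have s0 : 0 < s by [].
have s1 : s < 1 by near: s; exact: nbhs_right_lt.
have ka := key a s ta s0 s1; have k1 := key one s t1 s0 s1.
have pe : `|s * ws a p s - A * (s * ws one p s)| <= e / 4.
  rewrite -normrN -[X in `|X|]sub0r.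
  near: s; move/cvgrPdist_le : Ep; apply; by rewrite divr_gt0.
have ga : s * fine (gf a (zs s)) <= `|A| + 1.
  have : `|A - s * fine (gf a (zs s))| <= 1.
    by near: s; move/cvgrPdist_le : aA; apply.
  by rewrite ler_norml => /andP[h1 _]; have := ler_norm A; lra.
have g1 : s * fine (gf one (zs s)) <= 2.
  have : `|1 - s * fine (gf one (zs s))| <= 1.
    by near: s; move/cvgrPdist_le : cvg_gf1; apply.
  by rewrite ler_norml => /andP[h1 _]; lra.
have ga0 : 0 <= fine (gf a (zs s)).
  by apply/fine_ge0/gf_ge0; [exact/ltW/zs_gt0|case: ta].
have b1 : s * `|ws a h s - ws a p s| <= e / K * (`|A| + 1).
  apply: (@le_trans _ _ (e / K * (s * fine (gf a (zs s))))).
    by rewrite mulrCA ler_wpM2l// ltW.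
  by rewrite ler_wpM2l.
have b2 : s * `|ws one h s - ws one p s| <= e / K * 2.
  apply: (@le_trans _ _ (e / K * (s * fine (gf one (zs s))))).
    by rewrite mulrCA ler_wpM2l// ltW.
  by rewrite ler_wpM2l.
rewrite sub0r normrN.
have -> : s * ws a h s - A * (s * ws one h s) =
  s * (ws a h s - ws a p s) - A * (s * (ws one h s - ws one p s)) +
  (s * ws a p s - A * (s * ws one p s)) by ring.
apply: le_trans (ler_normD _ _) _.
have b3 : `|s * (ws a h s - ws a p s)| <= e / K * (`|A| + 1).
  by rewrite normrM gtr0_norm.
have b4 : `|A * (s * (ws one h s - ws one p s))| <= `|A| * (e / K * 2).
  by rewrite !normrM (gtr0_norm s0) ler_wpM2l.
have b5 : e / K * (`|A| + 1) + `|A| * (e / K * 2) <= e * (3 / 4).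
  have -> : e / K * (`|A| + 1) + `|A| * (e / K * 2) = e / K * (3 * `|A| + 1) by ring.
  rewrite -mulrA ler_wpM2l ?(ltW e0)// mulrC ler_pdivrMr// /K.
  have := normr_ge0 A; lra.
have := ler_normB (s * (ws a h s - ws a p s)) (A * (s * (ws one h s - ws one p s))).
lra.
Unshelve. all: by end_near. Qed.

(** Bernstein's proof of the Weierstrass theorem. The Lipschitz bound replaces the modulus of
    continuity: |y| <= d + y^2 / d reduces the mean of |k/N - t| to a variance. *)
Lemma karamata_lipschitz h (L : R) : unit_bounded h ->
  (forall x y, 0 <= x -> x <= 1 -> 0 <= y -> y <= 1 ->
    `|h x - h y| <= L * `|x - y|) ->
  s * ws a h s - A * (s * ws (fun=> 1) h s) @[s --> (0 : R)^'+] --> (0 : R).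
Proof.
move=> bh hL; apply: E_approx => // e e0.
pose d := e / (2 * (`|L| + 1)).
have L0 := normr_ge0 L.
have d0 : 0 < d by rewrite divr_gt0// mulr_gt0//; lra.
(* With N d^2 >= 1 the variance term t (1 - t) / (N d) is at most d, so the error is at most 2 |L| d
   <= e. *)
pose N := (Num.truncn (d ^- 2)).+1.
have N0 : 0 < N%:R :> R by rewrite ltr0n.
have Nd : 1 <= N%:R * d ^+ 2.
  rewrite -ler_pdivrMr ?exprn_gt0// div1r.
  by have /truncn_itv/andP[_ /ltW] : 0 <= d ^- 2 by rewrite invr_ge0 sqr_ge0.
(* The operator reads only k <= N; the value 0 beyond keeps f nonnegative everywhere, as [E_bern]
   demands. *)
pose f k := if (k <= N)%N then h (k%:R / N%:R) else 0.
have kN k : (k <= N)%N -> (0 <= k%:R / N%:R :> R) && (k%:R / N%:R <= 1 :> R).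
  by move=> kN; rewrite divr_ge0//= ler_pdivrMr// mul1r ler_nat.
have f0 k : 0 <= f k.
  rewrite /f; case: ifPn => // /kN/andP[k0 k1].
  by have [M /(_ _ k0 k1)/andP[]] := bh.
have [bp Ep] := E_bern N 0 0 f0.
exists (fun t => bmono 0 0 t * bern N f t) => // t t0 tle1.
rewrite /bmono !expr0 !mul1r.
have bound k : (k <= N)%N -> `|f k - h t| <= `|L| * (d + (N%:R ^- 2 / d) * (k%:R - N%:R * t) ^+ 2).
  move=> kleN; rewrite /f kleN; have /andP[k0 k1] := kN k kleN.
  apply: le_trans (hL _ _ k0 k1 t0 tle1) _.
  apply: (@le_trans _ _ (`|L| * `|k%:R / N%:R - t|)).
    by rewrite ler_wpM2r// ler_norm.
  rewrite ler_wpM2l//.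
  have -> : N%:R ^- 2 / d * (k%:R - N%:R * t) ^+ 2 = `|k%:R / N%:R - t| ^+ 2 / d.
    rewrite -normrX ger0_norm ?sqr_ge0//; field.
    by rewrite !gt_eqF.
  move: `|_ - _| (normr_ge0 (k%:R / N%:R - t)) => y y0.
  rewrite -subr_ge0; have -> : d + y ^+ 2 / d - y = ((d - y / 2) ^+ 2 + y ^+ 2 * (3 / 4)) / d.
    by field; rewrite gt_eqF.
  apply: divr_ge0; last exact: ltW.
  have := sqr_ge0 (d - y / 2); have := sqr_ge0 y; lra.
have upper : bern N (fun k => `|L| * (d + (N%:R ^- 2 / d) * (k%:R - N%:R * t) ^+ 2)) t <= e.
  rewrite bernZ bernD bern_cst bernZ bern_sqr subrr expr0n /= add0r.
  have h1 : N%:R ^- 2 / d * (N%:R * (t * (1 - t))) <= d.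
    have -> : N%:R ^- 2 / d * (N%:R * (t * (1 - t))) = t * (1 - t) / (N%:R * d).
      by field; rewrite !gt_eqF.
    rewrite ler_pdivrMr ?mulr_gt0//.
    have : t * (1 - t) <= 1 by nra.
    by move: Nd; rewrite expr2; lra.
  have : `|L| * (d + N%:R ^- 2 / d * (N%:R * (t * (1 - t)))) <= `|L| * (2 * d).
    by rewrite ler_wpM2l//; lra.
  move/le_trans; apply; rewrite /d.
  have -> : `|L| * (2 * (e / (2 * (`|L| + 1)))) = e * (`|L| / (`|L| + 1)).
    by field; rewrite gt_eqF//; lra.
  by rewrite ler_piMr ?(ltW e0)// ler_pdivrMr; lra.
rewrite ler_norml; apply/andP; split.
  rewrite lerBrDl lerBlDr; apply: le_trans (_ : bern N (fun k => h t + `|L| * (d + (N%:R ^- 2 / d) * (k%:R - N%:R * t) ^+ 2)) t <= _).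
    apply: le_bern => // k kleN; have := bound k kleN; rewrite ler_norml; lra.
  by rewrite bernD bern_cst; lra.
rewrite lerBlDr; apply: le_trans (_ : bern N (fun k => f k + `|L| * (d + (N%:R ^- 2 / d) * (k%:R - N%:R * t) ^+ 2)) t <= _).
  rewrite -[leLHS](bern_cst N (h t) t).
  apply: le_bern => // k kleN; have := bound k kleN; rewrite ler_norml; lra.
by rewrite bernD; lra.
Qed.

End Compare.
End Karamata.

(** * From transforms to averages and limits *)

Section Tauberian.
Context {R : realType}.
Implicit Types (a : nat -> R) (s t : R).

Let clamp (u : R) : R := if u <= 0 then 0 else if 1 <= u then 1 else u.

Let clamp01 (u : R) : 0 <= clamp u <= 1.
Proof.
by rewrite /clamp; case: (leP u 0) => ?; [|case: (leP 1 u) => ?]; apply/andP; split; lra.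
Qed.

Let clamp_lip (u v : R) : `|clamp u - clamp v| <= `|u - v|.
Proof.
have h1 := ler_norm (u - v); have h2 := ler_norm (v - u).
rewrite distrC in h2; rewrite ler_norml /clamp.
by case: (leP u 0) => ?; case: (leP v 0) => ?; try (case: (leP 1 u) => ?);
  try (case: (leP 1 v) => ?); apply/andP; split; lra.
Qed.

(* [t * h t] is a Lipschitz ramp from [0] at [alpha] to [1] at [beta]. *)
Lemma ramp (alpha beta : R) : 0 < alpha -> alpha < beta -> exists h : R -> R,
  [/\ unit_bounded h,
      exists L, forall x y, 0 <= x -> x <= 1 -> 0 <= y -> y <= 1 ->
        `|h x - h y| <= L * `|x - y|,
      forall t, beta <= t -> t * h t = 1,
      forall t, t <= alpha -> h t = 0 &
      forall t, 0 <= t -> 0 <= t * h t <= 1].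
Proof.
(* The function is a clamped ramp divided by t. Replacing t by its maximum with alpha keeps the
   division Lipschitz and changes nothing, since the ramp vanishes below alpha. *)
move=> a0 ab; pose M t := if t <= alpha then alpha else t.
have Ma t : alpha <= M t by rewrite /M; case: (leP t alpha) => [|/ltW].
have M0 t : 0 < M t by exact: lt_le_trans (Ma t).
have tM t : t <= M t by rewrite /M; case: (leP t alpha).
have Mlip x y : `|M x - M y| <= `|x - y|.
  have h1 := ler_norm (x - y); have h2 := ler_norm (y - x).
  rewrite distrC in h2; rewrite ler_norml /M.
  by case: (leP x alpha) => ?; case: (leP y alpha) => ?; apply/andP; split; lra.
pose r t := clamp ((t - alpha) / (beta - alpha)).
have ba : 0 < beta - alpha by rewrite subr_gt0.
have r01 t : 0 <= r t <= 1 by exact: clamp01.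
exists (fun t => r t / M t); split.
- exists alpha^-1 => t _ _; have /andP[r0 r1] := r01 t.
  rewrite divr_ge0 ?(ltW (M0 t))//= -[leRHS]mul1r ler_pM ?invr_ge0 ?(ltW (M0 t))//.
  by rewrite lef_pV2 ?posrE.
- exists ((beta - alpha)^-1 * alpha^-1 + (alpha * alpha)^-1) => x y _ _ _ _.
  have -> : r x / M x - r y / M y = (r x - r y) / M x + r y * ((M x)^-1 - (M y)^-1) by ring.
  apply: le_trans (ler_normD _ _) _; rewrite [leRHS]mulrDl; apply: lerD.
    rewrite normrM mulrAC; apply: ler_pM => //.
      apply: le_trans (clamp_lip _ _) _.
      have nb : `|(beta - alpha)^-1| = (beta - alpha)^-1.
        by rewrite gtr0_norm ?invr_gt0.
      by rewrite -mulrBl opprB addrA subrK normrM nb mulrC.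
    by rewrite gtr0_norm ?invr_gt0// lef_pV2 ?posrE.
  rewrite normrM -[leRHS]mul1r; apply: ler_pM => //.
    by have /andP[r0 r1] := r01 y; rewrite ger0_norm.
  have -> : (M x)^-1 - (M y)^-1 = (M y - M x) / (M x * M y).
    by field; rewrite !gt_eqF.
  rewrite normrM mulrC; apply: ler_pM => //; last by rewrite distrC.
  rewrite gtr0_norm ?invr_gt0 ?mulr_gt0// lef_pV2 ?posrE ?mulr_gt0//.
  by apply: ler_pM => //; exact: ltW.
- move=> t bt; have ta : alpha < t by exact: lt_le_trans bt.
  rewrite /M leNgt ta /= /r /clamp leNgt divr_gt0 ?subr_gt0//=.
  rewrite ler_pdivlMr// mul1r lerD2r bt mul1r divff// gt_eqF//.
  exact: lt_trans ta.
- move=> t ta; rewrite /r /clamp ifT ?mul0r//.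
  by rewrite pmulr_lle0 ?invr_gt0// subr_le0.
- move=> t t0; have /andP[r0 r1] := r01 t.
  rewrite mulr_ge0 ?divr_ge0 ?(ltW (M0 t))//= mulrCA mulr_ile1//.
    by rewrite divr_ge0// ltW.
  by rewrite ler_pdivrMr// mul1r.
Qed.

Lemma ws_head a h s n : transformable a -> unit_bounded h -> 0 < s -> s < 1 ->
  \sum_(i < n) a i * zs s ^+ i * h (zs s ^+ i) <= ws a h s.
Proof.
move=> ta bh s0 s1; rewrite -lee_fin -wsE// -sumEFin.
have := @nneseries_lim_ge R (fun i => (a i * zs s ^+ i * h (zs s ^+ i))%:E) xpredT 0%N n.
by rewrite big_mkord; apply => i _ _; exact: wterm_ge0.
Qed.

Lemma ws_finite a h s n : 0 < s -> s < 1 ->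
  (forall i, (n <= i)%N -> h (zs s ^+ i) = 0) ->
  ws a h s = \sum_(i < n) a i * zs s ^+ i * h (zs s ^+ i).
Proof.
move=> s0 s1 h0; rewrite /ws /wsum (@finite_nneseries _ _ n)//.
by move=> i ni; rewrite h0// mulr0.
Qed.

Let invn_cvg : n%:R^-1 @[n --> \oo] --> (0 : R)^'+.
Proof.
move=> V [e /= e0 V0]; change (\forall n \near \oo, V (n%:R^-1)).
near=> n; have n0 : (0 < n)%N by near: n; exact: nbhs_infty_gt.
apply: V0; rewrite /= ?invr_gt0 ?ltr0n//.
rewrite sub0r normrN gtr0_norm ?invr_gt0 ?ltr0n//.
rewrite invf_plt ?posrE ?ltr0n//; near: n; exact: nbhs_infty_gtr.
Unshelve. all: by end_near. Qed.

(** For s = 1/n the condition i < n reads z^i > e^(-1). Ramps ending at, and starting from, this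
    value bound the partial sum from both sides; the comparison with the constant sequence reduces
    the bounds to counting the i below (1 + d) n and (1 - d) n. *)
Theorem karamata a (A : R) : transformable a ->
  s * fine (gf a (zs s)) @[s --> (0 : R)^'+] --> A ->
  (\sum_(i < n) a i) / n%:R @[n --> \oo] --> A.
Proof.
move=> ta aA; have a0 := ta.1.
have A0 : 0 <= A.
  apply: (cvgr_to_ge aA); near=> s; rewrite mulr_ge0//.
  by apply/fine_ge0/gf_ge0 => //; exact/ltW/zs_gt0.
have main h : unit_bounded h ->
    (exists L, forall x y, 0 <= x -> x <= 1 -> 0 <= y -> y <= 1 ->
        `|h x - h y| <= L * `|x - y|) -> forall e, 0 < e ->
    \forall n \near \oo, `|n%:R^-1 * ws a h n%:R^-1 -
       A * (n%:R^-1 * ws (fun=> 1) h n%:R^-1)| <= e.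
  move=> bh [L hL] e e0.
  have := karamata_lipschitz ta aA bh hL; move=> /(cvg_comp _ _ invn_cvg).
  move/cvgrPdist_le => /(_ e e0); apply: filterS => n /=.
  by rewrite sub0r normrN.
apply/cvgrPdist_le => e e0.
(* The error consists of A d, of A / n from rounding in the count, and of the comparison error: each
   is made at most e/4. *)
pose d := Num.min 2^-1 (e / (4 * (A + 1))).
have A1 : 0 < 4 * (A + 1) by lra.
have d0 : 0 < d by rewrite lt_min divr_gt0// andbT; lra.
have d1 : d <= 2^-1 by rewrite ge_min lexx.
have dA : A * d <= e / 4.
  apply: (@le_trans _ _ ((A + 1) * (e / (4 * (A + 1))))).
    by apply: ler_pM; rewrite ?(ltW d0)//; [lra|rewrite ge_min lexx orbT].
  by rewrite le_eqVlt; apply/orP; left; apply/eqP; field; rewrite gt_eqF//; lra.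
have ab1 : expR (- (1 + d)) < expR (- 1) by rewrite ltr_expR; lra.
have ab2 : expR (- 1) < expR (- (1 - d)) by rewrite ltr_expR; lra.
have [h1 [bh1 lip1 h1one h1zero h101]] := ramp (expR_gt0 _) ab1.
have [h2 [bh2 lip2 h2one h2zero h201]] := ramp (expR_gt0 _) ab2.
have e4 : 0 < e / 4 by rewrite divr_gt0.
have m1 := main h1 bh1 lip1 _ e4.
have m2 := main h2 bh2 lip2 _ e4.
near=> n.
have n2 : (1 < n)%N by near: n; exact: nbhs_infty_gt.
have n0 : 0 < n%:R :> R by rewrite ltr0n (ltnW n2).
pose s := n%:R^-1 : R.
have s0 : 0 < s by rewrite invr_gt0.
have s1 : s < 1 by rewrite invf_lt1 ?ltr1n.
have k1 : `|s * ws a h1 s - A * (s * ws (fun=> 1) h1 s)| <= e / 4.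
  by rewrite /s; near: n; exact: m1.
have k2 : `|s * ws a h2 s - A * (s * ws (fun=> 1) h2 s)| <= e / 4.
  by rewrite /s; near: n; exact: m2.
have An : A / n%:R <= e / 4.
  rewrite ler_pdivrMr// mulrC -ler_pdivrMr//; near: n; exact: nbhs_infty_ger.
have term b (h : R -> R) i : b i * zs s ^+ i * h (zs s ^+ i) = b i * (zs s ^+ i * h (zs s ^+ i)).
  by rewrite mulrA.
have sn i : s * i%:R = i%:R / n%:R by rewrite /s mulrC.
pose S := \sum_(i < n) a i.
have up1 : S <= ws a h1 s.
  apply: le_trans (ws_head n ta bh1 s0 s1); apply: ler_sum => i _.
  rewrite term h1one ?mulr1// zsX ler_expR lerN2 sn ler_pdivrMr// mul1r ler_nat.
  exact: ltnW.
have up2 : ws (fun=> 1) h1 s <= (1 + d) * n%:R + 1.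
  pose N := (Num.truncn ((1 + d) * n%:R)).+1.
  have Nr : 0 <= (1 + d) * n%:R by rewrite mulr_ge0 ?(ltW n0)//; lra.
  have /andP[N1 N2] := truncn_itv Nr.
  rewrite (@ws_finite _ _ _ N)//; last first.
    move=> i Ni; apply: h1zero; rewrite zsX ler_expR lerN2 sn ler_pdivlMr//.
    by apply/ltW/(lt_le_trans N2); rewrite ler_nat.
  apply: (@le_trans _ _ (\sum_(i < N) 1)).
    apply: ler_sum => i _; rewrite mul1r.
    by have /andP[z0 _] := zsX01 i s0; have /andP[] := h101 _ z0.
  by rewrite sumr_const card_ord /N -natr1; lra.
have lo1 : ws a h2 s <= S.
  rewrite (@ws_finite _ _ _ n)//; last first.
    move=> i ni; apply: h2zero; rewrite zsX ler_expR lerN2 sn ler_pdivlMr// mul1r.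
    by rewrite ler_nat.
  apply: ler_sum => i _; rewrite term ler_piMr//.
  by have /andP[z0 _] := zsX01 i s0; have /andP[] := h201 _ z0.
have lo2 : (1 - d) * n%:R <= ws (fun=> 1) h2 s.
  pose N := (Num.truncn ((1 - d) * n%:R)).+1.
  have Nr : 0 <= (1 - d) * n%:R by rewrite mulr_ge0 ?(ltW n0)//; lra.
  have /andP[N1 N2] := truncn_itv Nr.
  apply: le_trans (ws_head N transformable1 bh2 s0 s1).
  apply: (@le_trans _ _ (\sum_(i < N) 1)).
    by rewrite sumr_const card_ord ltW.
  apply: ler_sum => i _; rewrite mul1r h2one//.
  rewrite zsX ler_expR lerN2 sn ler_pdivrMr//; apply: le_trans N1.
  by rewrite ler_nat -ltnS.
have snE : s * n%:R = 1 by rewrite /s mulVf// gt_eqF.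
have su1 := ler_wpM2l (ltW s0) up1; have su2 := ler_wpM2l (ltW s0) up2.
have sl1 := ler_wpM2l (ltW s0) lo1; have sl2 := ler_wpM2l (ltW s0) lo2.
have asu2 := ler_wpM2l A0 su2; have asl2 := ler_wpM2l A0 sl2.
have e1 : A * (s * ((1 + d) * n%:R + 1)) = A + A * d + A / n%:R.
  by rewrite /s; field; rewrite gt_eqF.
have e2 : A * (s * ((1 - d) * n%:R)) = A - A * d.
  by rewrite /s; field; rewrite gt_eqF.
rewrite e1 in asu2; rewrite e2 in asl2.
have -> : S / n%:R = s * S by rewrite mulrC.
move: k1 k2; rewrite !ler_norml => /andP[k11 k12] /andP[k21 k22].
apply/andP; split; lra.
Unshelve. all: by end_near. Qed.

Lemma indicator_gf (K : R) N z : 0 <= z -> z < 1 -> 0 <= K ->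
  (gf (fun n => if (n < N)%N then K else 0)%R z <= (K * N%:R)%:E)%E.
Proof.
move=> z0 z1 K0; rewrite /gf (@finite_nneseries _ _ N); last first.
  by move=> n Nn; rewrite ltnNge Nn mul0r.
rewrite lee_fin; apply: (@le_trans _ _ (\sum_(n < N) K)).
  apply: ler_sum => i _; rewrite ltn_ord ler_piMr// exprn_ile1// ltW//.
by rewrite sumr_const card_ord mulr_natr.
Qed.

(** The finitely many indices where the estimate fails contribute a bounded amount, negligible
    against the transform of w, which tends to infinity. *)
Theorem abelian (u w : nat -> R) (l : R) : (forall n, 0 <= u n) -> 0 <= l ->
  transformable w -> fine (gf w (zs s)) @[s --> (0 : R)^'+] --> +oo ->
  (forall e, 0 < e -> \forall n \near \oo, `|u n - l * w n| <= e * w n) ->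
  transformable u /\
  fine (gf u (zs s)) / fine (gf w (zs s)) @[s --> (0 : R)^'+] --> l.
Proof.
move=> u0 l0 tw wy uw; have [w0 wfin] := tw.
have bound e : 0 < e -> exists N K, [/\ 0 <= K,
   forall n, u n <= (l + e) * w n + (if (n < N)%N then K else 0) &
   forall n, l * w n <= u n + e * w n + (if (n < N)%N then K else 0)].
  move=> e0; have [N _ HN] := uw e e0.
  (* The sum of the exceptional terms dominates each one of them. *)
  exists N, (\sum_(n < N) (u n + l * w n)).
  have t0 n : 0 <= u n + l * w n by rewrite addr_ge0// mulr_ge0.
  have tK n : (n < N)%N -> u n + l * w n <= \sum_(n < N) (u n + l * w n).
    by move=> nN; rewrite (bigD1 (Ordinal nN))//= lerDl sumr_ge0.
  split; first by rewrite sumr_ge0.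
    move=> n; have lw : 0 <= l * w n by rewrite mulr_ge0.
    have ew : 0 <= e * w n by rewrite mulr_ge0// ltW.
    case: ltnP => [/tK|/HN /=]; first by lra.
    by rewrite ler_norml => /andP[]; lra.
  move=> n; have ew : 0 <= e * w n by rewrite mulr_ge0// ltW.
  have := u0 n; case: ltnP => [/tK|/HN /=]; first by lra.
  by rewrite ler_norml => /andP[]; lra.
have zz s : 0 <= zs s := ltW (zs_gt0 s).
have ind0 N (K : R) n : 0 <= K -> 0 <= (if (n < N)%N then K else 0) by case: ifP.
have up e N K s : 0 < e -> 0 <= K ->
   (forall n, u n <= (l + e) * w n + (if (n < N)%N then K else 0)) -> 0 < s -> s < 1 ->
   (gf u (zs s) <= ((l + e) * fine (gf w (zs s)) + K * N%:R)%:E)%E.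
  move=> e0 K0 H s0 s1; apply: (le_trans (le_gf (zz s) u0 H)).
  rewrite gfD//; last 2 first.
  - by move=> n; rewrite mulr_ge0//; lra.
  - by move=> n; exact: ind0.
  rewrite gfZ// [leRHS]EFinD; apply: leeD; last by apply: indicator_gf; rewrite ?zs_lt1.
  by rewrite EFinM fineK// ge0_fin_numE ?wfin// gf_ge0.
have tu : transformable u.
  split=> // s s0 s1; have [N [K [K0 H1 _]]] := bound 1 ltr01.
  exact: le_lt_trans (up 1 N K s ltr01 K0 H1 s0 s1) (ltry _).
split=> //; apply/cvgrPdist_le => e e0.
have wyA (B : R) : \forall s \near (0 : R)^'+, B <= fine (gf w (zs s)).
  by have /cvgryPge := wy; apply.
have e2 : 0 < e / 2 by rewrite divr_gt0.
have [N [K [K0 H1 H2]]] := bound (e / 2) e2.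
near=> s.
have s0 : 0 < s by [].
have s1 : s < 1 by near: s; exact: nbhs_right_lt.
pose W := fine (gf w (zs s)).
have W1 : 1 <= W by rewrite /W; near: s; exact: wyA.
have W0 : 0 < W by lra.
have WK : K * N%:R <= e / 2 * W.
  by rewrite mulrC -ler_pdivrMl// /W; near: s; exact: wyA.
have ufin : gf u (zs s) \is a fin_num by rewrite ge0_fin_numE ?gf_ge0//; exact: tu.2.
have wf : gf w (zs s) \is a fin_num by rewrite ge0_fin_numE ?gf_ge0//; exact: wfin.
have h1 := up _ N K s e2 K0 H1 s0 s1; rewrite -(fineK ufin) lee_fin -/W in h1.
have h2 : l * W <= fine (gf u (zs s)) + e / 2 * W + K * N%:R.
  rewrite -lee_fin !EFinD fineK// !EFinM /W fineK// -gfZ// -gfZ//.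
  have lw0 n : 0 <= l * w n by rewrite mulr_ge0.
  have ew0 n : 0 <= e / 2 * w n by rewrite mulr_ge0// ltW.
  apply: (le_trans (le_gf (zz s) lw0 H2)).
  rewrite gfD//; last 2 first.
  - by move=> n; rewrite addr_ge0.
  - by move=> n; exact: ind0.
  rewrite gfD//; apply: leeD => //.
  by rewrite -EFinM; apply: indicator_gf; rewrite ?zs_lt1.
rewrite -(ler_pM2r W0) -[X in _ * X <= _](gtr0_norm W0) -normrM mulrBl divfK ?gt_eqF//.
rewrite ler_norml; apply/andP; split; lra.
Unshelve. all: by end_near. Qed.

(** The average of u over a block of length about d n after n is near A, as a difference of two
    averages, and near u(n) by the oscillation hypothesis. *)
Theorem slow_oscillation (u : nat -> R) (A : R) :
  (\sum_(i < n) u i) / n%:R @[n --> \oo] --> A ->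
  (forall e, 0 < e -> exists2 d : R, 0 < d & exists N : nat, forall n h : nat,
     (N <= n)%N -> (h%:R : R) <= d * n%:R -> `|u (n + h)%N - u n| <= e) ->
  u n @[n --> \oo] --> A.
Proof.
move=> uA osc; apply/cvgrPdist_le => e e0.
have e2 : 0 < e / 2 by rewrite divr_gt0.
have [d' d'0 [N oscN]] := osc _ e2.
pose d := Num.min 1 d'.
have d0 : 0 < d by rewrite lt_min ltr01.
have d1 : d <= 1 by rewrite ge_min lexx.
have dd' : d <= d' by rewrite ge_min lexx orbT.
(* The two averages contribute at most 3 eta n to the block sum, which is below (e/2) H because the
   length H is at least d n / 2. *)
pose eta := e * d / 16.
have eta0 : 0 < eta by rewrite divr_gt0// mulr_gt0.
have [M _ HM] : \forall n \near \oo, `|A - (\sum_(i < n) u i) / n%:R| <= eta.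
  by move/cvgrPdist_le : uA; apply.
near=> n.
have Nn : (N <= n)%N by near: n; exact: nbhs_infty_ge.
have Mn : (M <= n)%N by near: n; exact: nbhs_infty_ge.
have n0 : 0 < n%:R :> R by rewrite ltr0n; near: n; exact: nbhs_infty_gt.
have dn2 : 2 <= d * n%:R by rewrite mulrC -ler_pdivrMr//; near: n; exact: nbhs_infty_ger.
pose H := Num.truncn (d * n%:R).
have dn0 : 0 <= d * n%:R by lra.
have /andP[H1 H2] := truncn_itv dn0; rewrite -/H in H1 H2.
have H0 : d * n%:R / 2 <= H%:R by move: H2; rewrite -natr1; lra.
pose S m := \sum_(i < m) u i.
have Sb m : (n <= m)%N -> `|S m - A * m%:R| <= eta * m%:R.
  move=> nm; have m0 : 0 < m%:R :> R by apply: lt_le_trans n0 _; rewrite ler_nat.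
  have := HM m (leq_trans Mn nm) => h.
  have -> : S m - A * m%:R = - ((A - S m / m%:R) * m%:R).
    by field; rewrite gt_eqF.
  by rewrite normrN normrM (gtr0_norm m0) ler_pM2r.
have SH : S (n + H)%N - S n = \sum_(i < H) u (n + i)%N.
  by rewrite /S big_split_ord /= [X in X - _]addrC addrK.
have dev : `|S (n + H)%N - S n - H%:R * u n| <= e / 2 * H%:R.
  rewrite SH -[H%:R]/(H%:R) mulr_natl -[X in u n *+ X](card_ord H) -sumr_const -sumrB.
  apply: le_trans (ler_norm_sum _ _ _) _.
  apply: (@le_trans _ _ (\sum_(i < H) e / 2)).
    apply: ler_sum => i _; apply: oscN => //.
    apply: le_trans (_ : d * n%:R <= _); last by rewrite ler_pM2r.
    by apply: le_trans H1; rewrite ler_nat ltnW.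
  by rewrite sumr_const card_ord mulr_natr.
have s1 := Sb n (leqnn n); have s2 := Sb (n + H)%N (leq_addr _ _).
rewrite natrD in s2.
have Hn : H%:R <= n%:R :> R.
  by apply: le_trans H1 _; rewrite ler_piMl// ltW.
have Hp : 0 < H%:R :> R by apply: lt_le_trans H0; rewrite divr_gt0//; lra.
have key : `|A * H%:R - H%:R * u n| <= e * H%:R.
  have b1 : eta * n%:R + eta * (n%:R + H%:R) <= e / 2 * H%:R.
    have : eta * n%:R + eta * (n%:R + H%:R) <= eta * (3 * n%:R).
      by rewrite -mulrDr ler_pM2l//; lra.
    have : eta * (3 * n%:R) <= e / 2 * (d * n%:R / 2).
      have -> : eta * (3 * n%:R) = e * (d * n%:R) * (3 / 16) by rewrite /eta; field.
      have -> : e / 2 * (d * n%:R / 2) = e * (d * n%:R) * (4 / 16) by field.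
      by rewrite ler_pM2l ?mulr_gt0//; lra.
    have : e / 2 * (d * n%:R / 2) <= e / 2 * H%:R by rewrite ler_pM2l.
    lra.
  move: s1 s2 dev; rewrite !ler_norml => /andP[? ?] /andP[? ?] /andP[? ?].
  apply/andP; split; lra.
rewrite -(ler_pM2r Hp) -[X in _ * X <= _](gtr0_norm Hp) -normrM mulrBl [u n * _]mulrC.
exact: key.
Unshelve. all: by end_near. Qed.

End Tauberian.

(** * Slow oscillation of the probability that the current age is the kth longest *)

Section LastAgeOscillation.
Context {R : realType}.
Variable T : nat -> nat -> nat -> R.
Hypothesis Tw : tail_weights T.
Implicit Types (a b h i j k l m n : nat).

(** The formula for p_(j+1)^(1)(n): a is the current age, and the last record is at n - a. *)
Definition last_weight j n : R := \sum_(a < n.+1) qs a * exact_weights T a j (n - a).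

Let mid a h i : R := if (a < i <= a + h)%N then fs i else 0.

Let mid_ge0 a h i : 0 <= mid a h i. Proof. by rewrite /mid; case: ifP. Qed.

Lemma fs_cumul r : \sum_(i < r.+1) fs i = 1 - qs r :> R.
Proof.
rewrite big_ord_recl /= add0r -(big_mkord xpredT (fun i => fs i.+1)).
by rewrite -(big_add1 _ _ 0 r.+1 xpredT) fs_sum// qs0.
Qed.

Let mid_cumul a h m : \sum_(i < m.+1) mid a h i <= qs a - qs (a + h).
Proof.
rewrite -fs_sum ?leq_addr//.
rewrite -(big_mkord xpredT (mid a h)) /=.
have z : \sum_(0 <= i < a.+1) mid a h i = 0.
  rewrite big_nat_cond big1// => i /andP[/andP[_ ia] _].
  by rewrite /mid ltnNge -ltnS ia.
rewrite [leRHS](_ : _ = \sum_(0 <= i < (a + h).+1) mid a h i); last first.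
  rewrite [RHS](big_cat_nat (n := a.+1))//= ?ltnS ?leq_addr// z add0r.
  rewrite big_nat_cond [RHS]big_nat_cond; apply: eq_bigr => i /andP[/andP[i1 i2] _].
  by rewrite /mid i1 -ltnS i2.
have [mh|hm] := leqP m.+1 (a + h).+1.
  by rewrite [leRHS](big_cat_nat (n := m.+1))//= lerDl sumr_ge0.
rewrite [leLHS](big_cat_nat (n := (a + h).+1))//= ?(ltnW hm)//.
rewrite [X in _ + X](_ : _ = 0) ?addr0//.
rewrite big_nat_cond big1// => i /andP[/andP[i1 _] _].
by rewrite /mid [(i <= _)%N]leqNgt i1 andbF.
Qed.

Let tri (u v : nat -> R) m :
  \sum_(i < m.+1) u i * \sum_(l < (m - i).+1) v l =
  \sum_(l < m.+1) v l * \sum_(i < (m - l).+1) u i.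
Proof.
have E (x y : nat -> R) : \sum_(i < m.+1) x i * \sum_(l < (m - i).+1) y l =
    \sum_(i < m.+1) \sum_(l < m.+1) (if (i + l <= m)%N then x i * y l else 0).
  apply: eq_bigr => i _; rewrite mulr_sumr.
  rewrite (big_ord_widen m.+1 (fun l => x i * y l)); last by rewrite ltnS leq_subr.
  rewrite big_mkcond; apply: eq_bigr => l _.
  have im : (i <= m)%N by rewrite -ltnS.
  by rewrite ltnS leq_subRL.
rewrite !E exchange_big; apply: eq_bigr => l _; apply: eq_bigr => i _.
by rewrite addnC mulrC.
Qed.

(** The two weights differ only if some age falls in the window (a, a + h]. The expected number of
    such ages before a record at m is the convolution q * mid * q, and q * q = 1 turns it into the
    plain sum of [mid]. The induction below proves this bound without mentioning expectations. *)
Lemma tail_shift a h k m : T a k m - T (a + h) k m <= qs a - qs (a + h).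
Proof.
apply: le_trans (mid_cumul a h m).
elim/ltn_ind: m k => m ih [|k].
  by rewrite !(tail0 Tw) subrr sumr_ge0.
have -> : T a k.+1 m - T (a + h) k.+1 m =
    \sum_(i < m.+1) fs i * (T a (if (i <= a)%N then k.+1 else k) (m - i)%N -
       T (a + h) (if (i <= a + h)%N then k.+1 else k) (m - i)%N).
  case: Tw => _ H; rewrite !H -sumrB; apply: eq_bigr => i _.
  by rewrite mulrBr.
pose B r := \sum_(l < r.+1) mid a h l.
have B0 r : 0 <= B r by rewrite sumr_ge0.
apply: (@le_trans _ _ (\sum_(i < m.+1) (fs i * B (m - i)%N + mid a h i * qs (m - i)%N))).
  apply: ler_sum => i _; rewrite /mid.
  have [ia|ai] /= := leqP i a.
    rewrite (leq_trans ia (leq_addr _ _)) mul0r addr0.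
    case: (posnP i) => [->|i0]; first by rewrite !mul0r.
    by apply: ler_wpM2l => //; apply: ih; have := ltn_ord i; lia.
  have [iah|ahi] := leqP i (a + h).
    rewrite -mulrDr; apply: ler_wpM2l => //.
    have t1 := tail_le Tw a k (m - i)%N.
    have t2 := tail_ge0 Tw (a + h) k.+1 (m - i)%N.
    have := B0 (m - i)%N; lra.
  rewrite mul0r addr0; apply: ler_wpM2l => //; apply: ih.
  by have := ltn_ord i; lia.
(* After exchanging the sums, the mass of f up to m - l is 1 - q(m - l), and the second half of the
   bound supplies the missing q(m - l). *)
rewrite big_split /= (tri fs (mid a h)) -big_split /=.
apply: ler_sum => l _; rewrite fs_cumul -mulrDr subrK mulr1//.
Qed.

Lemma tail_mono a h k m : T a k m >= T (a + h) k m.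
Proof.
elim/ltn_ind: m k => m ih [|k]; first by rewrite !(tail0 Tw).
rewrite !(tailS Tw); apply: ler_sum => i _; apply: ler_wpM2l => //.
have im : (m - i.+1 < m)%N by have := ltn_ord i; lia.
case: (ltnP i a) => ia; first by rewrite (leq_trans ia (leq_addr _ _)) ih.
by case: ifP => _; [apply: le_trans (tail_anti Tw _ _ _) _|]; exact: ih.
Qed.

Lemma exact_shift a h j m :
  `|exact_weights T (a + h) j m - exact_weights T a j m| <= 2 * (qs a - qs (a + h)).
Proof.
have h1 := tail_shift a h j m; have h2 := tail_shift a h j.+1 m.
have h3 := tail_mono a h j m; have h4 := tail_mono a h j.+1 m.
by rewrite ler_norml /exact_weights; apply/andP; split; lra.
Qed.

Lemma qs_drop a h : (0 < a)%N -> qs a - qs (a + h) <= h%:R / a%:R * qs a :> R.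
Proof.
move=> a0; have ar : 0 < a%:R :> R by rewrite ltr0n.
elim: h => [|h ih]; first by rewrite addn0 subrr mul0r mul0r.
have step : qs (a + h) - qs (a + h.+1) <= qs a / a%:R :> R.
  rewrite addnS -[leLHS]/(fs (a + h).+1) fsS.
  apply: ler_pM => //.
    by rewrite qs_nonincr// leq_addr.
  have ah0 : 0 < 2 * (a + h)%:R + 2 :> R by have := ler0n R (a + h); lra.
  by rewrite lef_pV2 ?posrE// natrD; have := ler0n R h; lra.
rewrite -(natr1 h) mulrDl mulrDl mul1r [a%:R^-1 * _]mulrC; lra.
Qed.

Let sum_small n r : (r <= n)%N ->
  \sum_(a < r) qs a * qs (n - a)%N <= 2 * r%:R * qs r * qs (n - r)%N :> R.
Proof.
move=> rn; rewrite -qs_sum mulr_suml; apply: ler_sum => a _.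
by apply: ler_wpM2l => //; apply: qs_nonincr; apply: leq_sub2l; exact: ltnW.
Qed.

(** The four terms bound: current ages below h at time n + h; indices a < r, estimated crudely; for
    a >= r, the change of q(a); and for a >= r, the change of the threshold. *)
Lemma last_weight_shift j n h r : (0 < r)%N -> (r <= n)%N ->
  `|last_weight j (n + h) - last_weight j n| <=
  2 * h%:R * qs h * qs n + 2 * (2 * r%:R * qs r * qs (n - r)%N) +
  h%:R / r%:R + n.+1%:R * (2 * (h%:R / r%:R) * qs r ^+ 2).
Proof.
move=> r0 rn.
pose V := exact_weights T.
have V0 a m : 0 <= V a j m by exact: exact_ge0.
have Vq a m : V a j m <= qs m by exact: exact_le.
(* The index a at time n is matched with a + h at time n + h, so that the last record is at n - a in
   both; h initial terms remain. *)
have e1 : last_weight j (n + h) = \sum_(b < h) qs b * V b j (n + h - b)%N +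
    \sum_(a < n.+1) qs (a + h)%N * V (a + h)%N j (n - a)%N.
  rewrite /last_weight -addSn addnC big_split_ord /=; congr (_ + _).
  by apply: eq_bigr => i _; rewrite /V [(h + i)%N]addnC subnDr.
pose t1 := \sum_(b < h) qs b * V b j (n + h - b)%N.
pose dA a : R := (qs a - qs (a + h)%N) * qs (n - a)%N.
pose dB a := qs a * `|V (a + h)%N j (n - a)%N - V a j (n - a)%N|.
have q0 a : 0 <= qs a - qs (a + h)%N :> R by rewrite subr_ge0 qs_nonincr ?leq_addr.
have bnd : `|last_weight j (n + h) - last_weight j n| <=
    t1 + \sum_(a < n.+1) (dA a + dB a).
  rewrite e1 -/t1 /last_weight -addrA -sumrB.
  apply: le_trans (ler_normD _ _) _; apply: lerD.
    by rewrite ger0_norm// sumr_ge0// => b _; rewrite mulr_ge0.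
  apply: le_trans (ler_norm_sum _ _ _) _; apply: ler_sum => a _.
  have -> : qs (a + h)%N * V (a + h)%N j (n - a)%N - qs a * exact_weights T a j (n - a) =
     - ((qs a - qs (a + h)%N) * V (a + h)%N j (n - a)%N) +
     qs a * (V (a + h)%N j (n - a)%N - V a j (n - a)%N) by rewrite /V; ring.
  apply: le_trans (ler_normD _ _) _; apply: lerD.
    by rewrite normrN ger0_norm ?mulr_ge0//; apply: ler_wpM2l.
  by rewrite normrM ger0_norm.
apply: (le_trans bnd).
have b1 : t1 <= 2 * h%:R * qs h * qs n.
  rewrite -qs_sum mulr_suml; apply: ler_sum => b _; apply: ler_wpM2l => //.
  by apply: le_trans (Vq _ _) _; apply: qs_nonincr; have := ltn_ord b; lia.
have split_sum (d : nat -> R) : \sum_(a < n.+1) d a =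
    \sum_(a < r) d a + \sum_(r <= a < n.+1) d a.
  by rewrite -(big_mkord xpredT d) (big_cat_nat (n := r))//= ?(leqW rn)// big_mkord.
have rr : 0 < r%:R :> R by rewrite ltr0n.
have b2 : \sum_(a < r) (dA a + dB a) <= 2 * (2 * r%:R * qs r * qs (n - r)%N).
  apply: (@le_trans _ _ (\sum_(a < r) 2 * (qs a * qs (n - a)%N))).
    apply: ler_sum => a _; rewrite mulr_natl mulr2n; apply: lerD.
      by apply: ler_wpM2r => //; rewrite gerBl.
    apply: ler_wpM2l => //; rewrite ler_norml.
    have := V0 (a + h)%N (n - a)%N; have := V0 a (n - a)%N.
    have := Vq (a + h)%N (n - a)%N; have := Vq a (n - a)%N.
    by move=> *; apply/andP; split; lra.
  by rewrite -mulr_sumr ler_pM2l// sum_small.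
have drop a : (r <= a)%N -> qs a - qs (a + h)%N <= h%:R / r%:R * qs a :> R.
  move=> ra; apply: le_trans (qs_drop h (leq_trans r0 ra)) _.
  apply: ler_wpM2r => //; apply: ler_wpM2l => //.
  by rewrite lef_pV2 ?posrE ?ler_nat// ltr0n (leq_trans r0 ra).
have hr0 : 0 <= h%:R / r%:R :> R by rewrite divr_ge0.
have b3 : \sum_(r <= a < n.+1) dA a <= h%:R / r%:R.
  apply: (@le_trans _ _ (\sum_(r <= a < n.+1) h%:R / r%:R * (qs a * qs (n - a)%N))).
    rewrite big_nat_cond [leRHS]big_nat_cond; apply: ler_sum => a /andP[/andP[ra _] _].
    by rewrite mulrA; apply: ler_wpM2r => //; exact: drop.
  rewrite -mulr_sumr ler_piMr// -(@qs_conv R n) (split_sum (fun a => qs a * qs (n - a)%N)) lerDr.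
  by rewrite sumr_ge0// => i _; rewrite mulr_ge0.
have b4 : \sum_(r <= a < n.+1) dB a <= n.+1%:R * (2 * (h%:R / r%:R) * qs r ^+ 2).
  apply: (@le_trans _ _ (\sum_(r <= a < n.+1) (2 * (h%:R / r%:R) * qs r ^+ 2))).
    rewrite big_nat_cond [leRHS]big_nat_cond; apply: ler_sum => a /andP[/andP[ra _] _].
    have qar : qs a <= qs r :> R by exact: qs_nonincr.
    apply: (@le_trans _ _ (qs r * (2 * (h%:R / r%:R * qs r)))); last by rewrite expr2; lra.
    apply: ler_pM => //; apply: le_trans (exact_shift _ _ _ _) _; rewrite ler_pM2l//.
    by apply: le_trans (drop a ra) _; rewrite ler_wpM2l.
  rewrite big_const_nat iter_addr addr0 -[leLHS]mulr_natl; apply: ler_wpM2r.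
    by rewrite !mulr_ge0 ?sqr_ge0.
  by rewrite ler_nat leq_subr.
rewrite (split_sum (fun a => dA a + dB a)) [X in _ + (_ + X)]big_split /=; lra.
Qed.

(** The last error term is of order (h / r) (n / r), which is why h must be small against the square
    of r / n. *)
Lemma last_weight_slow j e : 0 < e -> exists2 d : R, 0 < d & exists N : nat,
  forall n h, (N <= n)%N -> (h%:R : R) <= d * n%:R ->
    `|last_weight j (n + h) - last_weight j n| <= e.
Proof.
move=> e0.
(* [r] is about [eps * n] and [h] at most [d * n], with [d] small compared to [eps ^ 2] *)
pose eps := Num.min 4^-1 ((e / 32) ^+ 2).
have eps0 : 0 < eps by rewrite lt_min exprn_gt0 ?divr_gt0// andbT.
have eps4 : eps <= 4^-1 by rewrite ge_min lexx.
have epse : eps <= (e / 32) ^+ 2 by rewrite ge_min lexx orbT.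
pose d := Num.min ((e / 16) ^+ 2) (e / 64 * eps ^+ 2).
have d0 : 0 < d by rewrite lt_min exprn_gt0 ?divr_gt0//= !mulr_gt0// exprn_gt0.
exists d => //; exists (Num.truncn (eps^-1)).+1 => n h Nn hd.
have n0 : (0 < n)%N by lia.
have nr : 0 < n%:R :> R by rewrite ltr0n.
have en1 : 1 < eps * n%:R.
  rewrite mulrC -ltr_pdivrMr// div1r.
  apply: lt_le_trans (_ : (Num.truncn (eps^-1)).+1%:R <= _); last by rewrite ler_nat.
  by have /truncn_itv/andP[] : 0 <= eps^-1 by rewrite invr_ge0 ltW.
pose r := (Num.truncn (eps * n%:R)).+1.
have /andP[rl rg] : (Num.truncn (eps * n%:R))%:R <= eps * n%:R < r%:R.
  by apply: truncn_itv; lra.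
have ru : r%:R <= 2 * eps * n%:R by rewrite /r -natr1; lra.
have rn2 : r%:R <= n%:R / 2 :> R.
  apply: le_trans ru _; have : eps * n%:R <= 4^-1 * n%:R by rewrite ler_pM2r.
  lra.
have rn : (r <= n)%N by rewrite -(ler_nat R); lra.
have r0n : (0 < r)%N by [].
apply: le_trans (last_weight_shift j h r0n rn) _.
have sn : 0 < Num.sqrt n%:R :> R by rewrite sqrtr_gt0.
have snn : Num.sqrt n%:R ^+ 2 = n%:R :> R by rewrite sqr_sqrtr// ltW.
have qb m : m%:R * qs m <= Num.sqrt m%:R :> R.
  case: m => [|m]; first by rewrite mul0r sqrtr_ge0.
  have m0 : 0 < m.+1%:R :> R by [].
  have sm0 : 0 < Num.sqrt m.+1%:R :> R by rewrite sqrtr_gt0.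
  have : qs m.+1 <= (Num.sqrt m.+1%:R)^-1 :> R.
    have m1 : 0 < 2 * m.+1%:R + 1 :> R by lra.
    apply: le_trans (qs_le _) _; rewrite lef_pV2 ?posrE ?sqrtr_gt0//.
    by apply: ler_wsqrtr; lra.
  rewrite -(ler_pM2l m0) => /le_trans; apply.
  by rewrite -{1}(sqr_sqrtr (ltW m0)) expr2 mulfK// gt_eqF.
have qn (m : nat) (c : R) : 0 < c -> c ^-2 * n%:R <= m%:R -> qs m <= c / Num.sqrt n%:R.
  move=> c0 cm.
  have cm0 : 0 < c ^- 2 * n%:R by rewrite mulr_gt0// invr_gt0 exprn_gt0.
  apply: le_trans (qs_le _) _.
  have m1 : 0 < 2 * m%:R + 1 :> R by lra.
  rewrite -[c / _]invf_div lef_pV2 ?posrE ?sqrtr_gt0 ?divr_gt0//.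
  have -> : Num.sqrt n%:R / c = Num.sqrt (c ^- 2 * n%:R).
    by rewrite sqrtrM ?invr_ge0 ?sqr_ge0// sqrtrV ?sqr_ge0// sqrtr_sqr gtr0_norm// mulrC.
  by apply: ler_wsqrtr; lra.
have P1 : 2 * h%:R * qs h * qs n <= e / 4.
  have : h%:R * qs h <= e / 16 * Num.sqrt n%:R.
    apply: le_trans (qb h) _.
    have -> : e / 16 * Num.sqrt n%:R = Num.sqrt ((e / 16) ^+ 2 * n%:R).
      by rewrite sqrtrM ?sqr_ge0// sqrtr_sqr gtr0_norm// divr_gt0.
    apply: ler_wsqrtr; apply: le_trans hd _; rewrite ler_pM2r//.
    by rewrite ge_min lexx.
  move=> a1; have a2 : qs n <= 1 / Num.sqrt n%:R :> R.
    by apply: qn => //; rewrite expr1n invr1 mul1r.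
  have : (h%:R * qs h) * qs n <= e / 16 * Num.sqrt n%:R * (1 / Num.sqrt n%:R).
    by apply: ler_pM => //; rewrite mulr_ge0.
  have -> : e / 16 * Num.sqrt n%:R * (1 / Num.sqrt n%:R) = e / 16.
    by field; rewrite gt_eqF.
  lra.
have P2 : 2 * (2 * r%:R * qs r * qs (n - r)%N) <= e / 2.
  have a1 : r%:R * qs r <= e / 32 * (2 * Num.sqrt n%:R).
    apply: le_trans (qb r) _.
    have -> : e / 32 * (2 * Num.sqrt n%:R) = Num.sqrt ((e / 32) ^+ 2 * (2 ^+ 2 * n%:R)).
      rewrite sqrtrM ?sqr_ge0// [Num.sqrt (2 ^+ 2 * _)]sqrtrM ?sqr_ge0// !sqrtr_sqr gtr0_norm ?divr_gt0//.
      by rewrite gtr0_norm.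
    apply: ler_wsqrtr; apply: le_trans ru _.
    have : eps * n%:R <= (e / 32) ^+ 2 * n%:R by rewrite ler_pM2r.
    have := mulr_ge0 (sqr_ge0 (e / 32)) (ltW nr); lra.
  have a2 : qs (n - r)%N <= 2 / Num.sqrt n%:R :> R.
    by apply: qn => //; rewrite natrB//; lra.
  have : (r%:R * qs r) * qs (n - r)%N <= e / 32 * (2 * Num.sqrt n%:R) * (2 / Num.sqrt n%:R).
    by apply: ler_pM => //; rewrite mulr_ge0.
  have -> : e / 32 * (2 * Num.sqrt n%:R) * (2 / Num.sqrt n%:R) = e / 8.
    by field; rewrite gt_eqF.
  lra.
have hr : h%:R / r%:R <= e / 64 * eps.
  have r0 : 0 < r%:R :> R by [].
  rewrite ler_pdivrMr//; apply: le_trans hd _.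
  apply: (@le_trans _ _ (e / 64 * eps * (eps * n%:R))).
    have -> : e / 64 * eps * (eps * n%:R) = e / 64 * eps ^+ 2 * n%:R by ring.
    by rewrite ler_pM2r// ge_min lexx orbT.
  by rewrite ler_pM2l ?ltW// mulr_gt0// divr_gt0.
have P3 : h%:R / r%:R <= e / 64.
  by apply: le_trans hr _; rewrite ler_piMr ?divr_ge0 ?ltW//; lra.
have P4 : n.+1%:R * (2 * (h%:R / r%:R) * qs r ^+ 2) <= e / 8.
  have r0 : 0 < r%:R :> R by [].
  have qr : qs r ^+ 2 <= (eps * n%:R)^-1.
    have := @qs_sqr_le R r; have q2 := sqr_ge0 (@qs R r).
    move=> hq; rewrite -[leRHS]div1r ler_pdivlMr; last by lra.
    have : qs r ^+ 2 * (eps * n%:R) <= qs r ^+ 2 * r%:R by rewrite ler_wpM2l// ltW.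
    lra.
  have n1 : n.+1%:R <= 2 * n%:R :> R.
    have n1r : 1 <= n%:R :> R by rewrite ler1n.
    by rewrite -(natr1 n); lra.
  apply: (@le_trans _ _ ((2 * n%:R) * (2 * (e / 64 * eps) * (eps * n%:R)^-1))).
    apply: ler_pM => //; first by rewrite !mulr_ge0 ?sqr_ge0 ?invr_ge0.
    by apply: ler_pM => //; rewrite ?mulr_ge0 ?sqr_ge0 ?invr_ge0//; rewrite ler_pM2l.
  have -> : 2 * n%:R * (2 * (e / 64 * eps) * (eps * n%:R)^-1) = e / 16.
    by field; rewrite !gt_eqF.
  lra.
apply: (@le_trans _ _ (e / 4 + e / 2 + e / 64 + e / 8)); last by lra.
by apply: lerD P4; apply: lerD P3; exact: lerD P1 P2.
Qed.

End LastAgeOscillation.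

(** * The logarithmic series *)

Section LogarithmicSum.
Context {R : realType}.
Implicit Types (z s : R) (j l n N : nat).

Definition p3_term z j l := fs l * z ^+ l * Gn z l ^+ j / Dn z l ^+ j.+1.

Lemma sum_odd_sqr N :
  \sum_(l < N) (2 * l%:R + 1) ^- 2 <= 3 - 2 / (2 * N%:R + 1) :> R.
Proof.
elim: N => [|N ih]; first by rewrite big_ord0 mulr0 add0r divr1; lra.
rewrite big_ord_recr /=; apply: le_trans (lerD ih (lexx _)) _.
have N0 := ler0n R N; rewrite -(natr1 N).
have a0 : 0 < 2 * N%:R + 1 :> R by lra.
have b0 : 0 < 2 * (N%:R + 1) + 1 :> R by lra.
rewrite -lerBrDl.
have -> : 3 - 2 / (2 * (N%:R + 1) + 1) - (3 - 2 / (2 * N%:R + 1)) =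
    4 / ((2 * N%:R + 1) * (2 * (N%:R + 1) + 1)) :> R.
  by field; rewrite !gt_eqF.
rewrite ler_pdivlMr ?mulr_gt0// expr2 invfM.
have -> : (2 * N%:R + 1)^-1 * (2 * N%:R + 1)^-1 * ((2 * N%:R + 1) * (2 * (N%:R + 1) + 1))
   = (2 * (N%:R + 1) + 1) / (2 * N%:R + 1) :> R by field; rewrite gt_eqF.
by rewrite ler_pdivrMr//; lra.
Qed.

Lemma ln1p_ge (r : R) : 0 <= r -> r - r ^+ 2 <= ln (1 + r).
Proof.
move=> r0; have r1 : 0 < 1 + r by lra.
have h : - ln (1 + r) <= - (r / (1 + r)).
  rewrite -lnV ?posrE//.
  rewrite [X in ln X](_ : _ = 1 + - (r / (1 + r))); last by field; rewrite gt_eqF.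
  by apply: le_ln1Dx; rewrite ltrN2 ltr_pdivrMr//; lra.
apply: (@le_trans _ _ (r / (1 + r))); last by rewrite -lerN2.
rewrite ler_pdivlMr//.
have := exprn_ge0 3 r0; rewrite !exprS expr0 mulr1; lra.
Qed.

Lemma bernoulli_ineq (x : R) j : 0 <= x <= 1 -> 1 - j%:R * x <= (1 - x) ^+ j.
Proof.
move=> /andP[x0 x1]; elim: j => [|j ih]; first by rewrite mul0r subr0 expr0.
rewrite exprS -(natr1 j); apply: (@le_trans _ _ ((1 - x) * (1 - j%:R * x))).
  by have := mulr_ge0 (ler0n R j) (sqr_ge0 x); rewrite expr2; lra.
by apply: ler_wpM2l => //; lra.
Qed.

Section FixedPoint.
Variables (z : R) (j : nat).
Hypotheses (z0 : 0 < z) (z1 : z < 1).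

Let z0' : 0 <= z. Proof. exact: ltW. Qed.

(** The relative decrement of D. As 1 + rho(l) is the ratio of consecutive values, ln (1 + rho(l))
    telescopes, and rho(l) exceeds it by at most rho(l)^2, a summable error uniform in z. *)
Let rho l := fs l.+1 * z ^+ l.+1 / Dn z l.+1.

Let rho_ge0 l : 0 <= rho l.
Proof. by rewrite divr_ge0 ?mulr_ge0 ?exprn_ge0 ?(ltW (Dn_gt0 z0' z1 _)). Qed.

Let rho_le l : rho l <= (2 * l%:R + 1)^-1.
Proof.
have l0 : 0 < 2 * l%:R + 1 :> R by have := ler0n R l; lra.
rewrite /rho ler_pdivrMr ?Dn_gt0// fs_qs.
rewrite mulrAC [leRHS]mulrC ler_pM2r ?invr_gt0//; exact: Dn_ge_qs.
Qed.

Let rhoE l : 1 + rho l = Dn z l / Dn z l.+1.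
Proof.
have := Dn_gt0 z0' z1 l.+1; rewrite /rho => h.
have := DnS z l => ->; field.
by rewrite gt_eqF// -DnS.
Qed.

Let ln_rho l : ln (1 + rho l) = ln (Dn z l) - ln (Dn z l.+1).
Proof. by rewrite rhoE ln_div ?posrE ?Dn_gt0. Qed.

Let ratioE l : Gn z l / Dn z l = 1 - Dinf z / Dn z l.
Proof. by rewrite /Gn mulrBl divff// gt_eqF// Dn_gt0. Qed.

Let termE l : p3_term z j l.+1 = rho l * (1 - Dinf z / Dn z l.+1) ^+ j.
Proof.
rewrite -ratioE /p3_term /rho expr_div_n [Dn z l.+1 ^+ j.+1]exprS invfM; ring.
Qed.

Let y01 l : 0 <= Dinf z / Dn z l <= 1.
Proof.
have D0 := Dn_gt0 z0' z1 l.
rewrite divr_ge0 ?(ltW D0) ?(ltW (Dinf_gt0 _))//=.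
by rewrite ler_pdivrMr// mul1r Dn_ge.
Qed.

Lemma p3_term_ge0 l : 0 <= p3_term z j l.
Proof.
by rewrite /p3_term divr_ge0 ?mulr_ge0 ?exprn_ge0 ?Gn_ge0 ?(ltW (Dn_gt0 z0' z1 _)).
Qed.

Let term_le l : p3_term z j l.+1 <= ln (Dn z l) - ln (Dn z l.+1) + (2 * l%:R + 1) ^- 2.
Proof.
have /andP[y0 y1] := y01 l.+1.
have h : p3_term z j l.+1 <= rho l.
  by rewrite termE ler_piMr// exprn_ile1//; lra.
have h2 : rho l ^+ 2 <= (2 * l%:R + 1) ^- 2.
  by rewrite -exprVn; apply: lerXn2r; rewrite ?nnegrE// (le_trans (rho_ge0 l)).
have := ln1p_ge (rho_ge0 l); rewrite ln_rho; lra.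
Qed.

(** By Bernoulli's inequality the power j costs at most j rho(l) / (Q D_(l+1)). As rho(l) <= 1, this
    is at most 2 j times the increment of 1 / (Q D), which telescopes and stays bounded. *)
Let term_ge l : ln (Dn z l) - ln (Dn z l.+1) -
  2 * j%:R * (Dinf z / Dn z l.+1 - Dinf z / Dn z l) <= p3_term z j l.+1.
Proof.
have /andP[y0 y1] := y01 l.+1.
have D1 := Dn_gt0 z0' z1 l.+1; have D2 := Dn_gt0 z0' z1 l; have Di := Dinf_gt0 z1.
rewrite -ln_rho termE.
have h : rho l * (1 - j%:R * (Dinf z / Dn z l.+1)) <= rho l * (1 - Dinf z / Dn z l.+1) ^+ j.
  by apply: ler_wpM2l => //; exact: bernoulli_ineq.
apply: le_trans h.
have l1 : ln (1 + rho l) <= rho l by apply: le_ln1Dx; have := rho_ge0 l; lra.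
have r1 : rho l <= 1.
  by apply: le_trans (rho_le l) _; rewrite invf_le1; have := ler0n R l; lra.
have e1 : Dinf z / Dn z l.+1 - Dinf z / Dn z l = Dinf z / Dn z l * rho l.
  have -> : rho l = Dn z l / Dn z l.+1 - 1 by rewrite -rhoE; ring.
  by field; rewrite !gt_eqF.
have e2 : rho l * (Dinf z / Dn z l.+1) <= 2 * (Dinf z / Dn z l * rho l).
  have -> : Dinf z / Dn z l.+1 = Dinf z / Dn z l * (1 + rho l).
    by rewrite rhoE; field; rewrite !gt_eqF.
  have a0 : 0 <= Dinf z / Dn z l * rho l by rewrite mulr_ge0// divr_ge0 ?ltW.
  have := ler_wpM2l a0 r1; lra.
rewrite e1; have := ler_wpM2l (ler0n R j) e2; lra.
Qed.

Let partial_le N : \sum_(l < N) p3_term z j l.+1 <= - ln (Dn z N) + 3.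
Proof.
apply: (@le_trans _ _ (\sum_(l < N) (ln (Dn z l) - ln (Dn z l.+1)) +
   \sum_(l < N) (2 * l%:R + 1) ^- 2)).
  by rewrite -big_split; apply: ler_sum => l _; exact: term_le.
have -> : \sum_(l < N) (ln (Dn z l) - ln (Dn z l.+1)) = - ln (Dn z N).
  elim: N => [|N ih]; first by rewrite big_ord0 Dn0 ln1 oppr0.
  by rewrite big_ord_recr /= ih; ring.
apply: lerD => //; apply: le_trans (sum_odd_sqr N) _.
by rewrite gerBl divr_ge0//; have := ler0n R N; lra.
Qed.

Let partial_ge N : - ln (Dn z N) - 2 * j%:R <= \sum_(l < N) p3_term z j l.+1.
Proof.
apply: (@le_trans _ _ (\sum_(l < N) (ln (Dn z l) - ln (Dn z l.+1) -
  2 * j%:R * (Dinf z / Dn z l.+1 - Dinf z / Dn z l)))); last first.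
  by apply: ler_sum => l _; exact: term_ge.
have -> : \sum_(l < N) (ln (Dn z l) - ln (Dn z l.+1) -
  2 * j%:R * (Dinf z / Dn z l.+1 - Dinf z / Dn z l)) =
  - ln (Dn z N) - 2 * j%:R * (Dinf z / Dn z N - Dinf z).
  elim: N => [|N ih]; first by rewrite big_ord0 Dn0 ln1; lra.
  by rewrite big_ord_recr /= ih; ring.
have /andP[_ y1] := y01 N; have Di := Dinf_gt0 z1.
have : Dinf z / Dn z N - Dinf z <= 1 by lra.
by move=> /(ler_wpM2l (ler0n R j)); lra.
Qed.

(** The partial sums are - ln D_N up to constants independent of z and N, and D_N decreases to
    [Dinf z]. *)
Lemma p3_sum_bounds : exists2 L : R,
  (\sum_(0 <= l <oo) (p3_term z j l)%:E = L%:E)%E &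
  - ln (Dinf z) - 2 * j%:R <= L <= - ln (Dinf z) + 3.
Proof.
have Di := Dinf_gt0 z1.
have t0 l : (0 <= (p3_term z j l)%:E)%E by rewrite lee_fin p3_term_ge0.
pose S := (\sum_(0 <= l <oo) (p3_term z j l)%:E)%E.
have SE : S = (\sum_(0 <= l <oo) (p3_term z j l.+1)%:E)%E.
  rewrite /S nneseries_recl// [X in (X%:E + _)%E](_ : _ = 0) ?add0e; last first.
    by rewrite /p3_term /= !mul0r.
  rewrite -(nneseries_addn 1)//.
  by apply: eq_eseriesr => n _; rewrite addn1.
have Sle : (S <= (- ln (Dinf z) + 3)%:E)%E.
  rewrite SE; apply: lime_le; first exact: is_cvg_nneseries.
  near=> N; rewrite sumEFin lee_fin big_mkord; apply: le_trans (partial_le N) _.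
  by rewrite lerD2r lerN2 ler_ln ?posrE ?Dn_gt0// Dn_ge.
have Sge0 : (0 <= S)%E by apply: nneseries_ge0.
have Sfin : S \is a fin_num by rewrite ge0_fin_numE//; apply: le_lt_trans Sle (ltry _).
exists (fine S); first by rewrite fineK.
rewrite -!lee_fin fineK// Sle andbT.
have lb N : ((- ln (Dn z N) - 2 * j%:R)%:E <= S)%E.
  apply: (@le_trans _ _ (\sum_(0 <= l < N) (p3_term z j l.+1)%:E)%E).
    by rewrite sumEFin lee_fin big_mkord; exact: partial_ge.
  by rewrite SE; apply: (nneseries_lim_ge N) => // n _ _; exact: t0.
have c : (- ln (Dn z N) - 2 * j%:R)%:E @[N --> \oo] --> (- ln (Dinf z) - 2 * j%:R)%:E.
  apply: cvg_EFin; first by near=> N.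
  apply: cvgB; last exact: cvg_cst.
  apply: cvgN; apply: continuous_cvg; first exact: continuous_ln.
  rewrite (_ : Dn z = (fun N => Dinf z + Gn z N)); last first.
    by apply/funext => N; rewrite /Gn; ring.
  rewrite -[X in _ --> X]addr0; apply: cvgD; first exact: cvg_cst.
  apply: (@squeeze_cvgr _ _ _ _ (fun=> 0) (fun N => z ^+ N)).
  - near=> N; rewrite Gn_ge0//=; apply: le_trans (Gn_le _ _ _) _ => //.
    by rewrite ler_piMl ?exprn_ge0// qs_le1.
  - exact: cvg_cst.
  - by apply: cvg_expr; rewrite ger0_norm.
have cl := cvg_lim (@ereal_hausdorff _) c.
rewrite -cl; apply: lime_le; first by apply/cvg_ex; eexists; exact: c.
by near=> N; exact: lb.
Unshelve. all: by end_near.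
Qed.

End FixedPoint.

(** The bounded error of [p3_sum_bounds] is negligible against the logarithm, and Dinf is equivalent
    to sqrt s. *)
Lemma asym_p3 j :
  (Dinf (zs s))^-1 * fine (\sum_(0 <= l <oo) (p3_term (zs s) j l)%:E)%E /
    ((Num.sqrt s)^-1 * ln ((Num.sqrt s)^-1)) @[s --> (0 : R)^'+] --> (1 : R).
Proof.
pose r (s : R) := Dinf (zs s) / Num.sqrt s.
pose lam (s : R) := ln ((Num.sqrt s)^-1).
pose L (s : R) := fine (\sum_(0 <= l <oo) (p3_term (zs s) j l)%:E)%E.
have cr : r s @[s --> (0 : R)^'+] --> (1 : R) by exact: cvg_Dinf.
have lamy : lam s @[s --> (0 : R)^'+] --> +oo.
  apply/cvgryPge => A; near=> s.
  have s0 : 0 < s by [].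
  rewrite /lam -(expRK A) ler_ln ?posrE ?invr_gt0 ?sqrtr_gt0 ?expR_gt0//.
  rewrite -[expR A]invrK lef_pV2 ?posrE ?invr_gt0 ?sqrtr_gt0 ?expR_gt0//.
  rewrite -[leRHS]ger0_norm ?invr_ge0 ?expR_ge0// -sqrtr_sqr.
  apply: ler_wsqrtr; apply: ltW; near: s; apply: nbhs_right_lt.
  by rewrite exprn_gt0// invr_gt0 expR_gt0.
have lamV : (lam s)^-1 @[s --> (0 : R)^'+] --> (0 : R).
  by apply/gtr0_cvgV0 => //; apply: (cvgryPgt _).1.
have clr : ln (r s) @[s --> (0 : R)^'+] --> (0 : R).
  by rewrite -[X in _ --> X](@ln1 R); apply: continuous_cvg => //; exact: continuous_ln.
have cL : L s / lam s @[s --> (0 : R)^'+] --> (1 : R).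
  apply: (@squeeze_cvgr _ _ _ _ (fun s => 1 - (ln (r s) + 2 * j%:R) * (lam s)^-1)
    (fun s => 1 + (3 - ln (r s)) * (lam s)^-1)).
  - near=> s.
    have s0 : 0 < s by [].
    have s1 : s < 1 by near: s; exact: nbhs_right_lt.
    have l0 : 0 < lam s by near: s; apply: (cvgryPgt _).1 => //.
    have D0 := Dinf_gt0 (zs_lt1 s0).
    have [x Ex] := p3_sum_bounds j (zs_gt0 s) (zs_lt1 s0).
    have -> : - ln (Dinf (zs s)) = lam s - ln (r s).
      have q0 : 0 < Num.sqrt s by rewrite sqrtr_gt0.
      by rewrite /r ln_div ?posrE// /lam lnV ?posrE//; ring.
    rewrite /L Ex /= => /andP[x1 x2].
    have -> : 1 - (ln (r s) + 2 * j%:R) * (lam s)^-1 = (lam s - ln (r s) - 2 * j%:R) / lam s.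
      by field; rewrite gt_eqF.
    have -> : 1 + (3 - ln (r s)) * (lam s)^-1 = (lam s - ln (r s) + 3) / lam s.
      by field; rewrite gt_eqF.
    by apply/andP; split; apply: ler_wpM2r; rewrite ?invr_ge0 ?(ltW l0)//; lra.
  - rewrite -[X in _ --> X](_ : 1 - (0 + 2 * j%:R) * 0 = 1 :> R); last by ring.
    apply: cvgB; first exact: cvg_cst.
    by apply: cvgM => //; apply: cvgD => //; exact: cvg_cst.
  - rewrite -[X in _ --> X](_ : 1 + (3 - 0) * 0 = 1 :> R); last by ring.
    apply: cvgD; first exact: cvg_cst.
    by apply: cvgM => //; apply: cvgB => //; exact: cvg_cst.
have c := cvgM (cvgV (oner_neq0 R) cr) cL.
rewrite -[X in _ --> X](_ : 1^-1 * 1 = 1 :> R); last by rewrite invr1 mulr1.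
apply: cvg_trans (c _ _); apply: near_eq_cvg; near=> s.
rewrite /r /L /lam /= !invfM !invrK; ring.
Unshelve. all: by end_near.
Qed.

End LogarithmicSum.

(** * The comparison sequence for p_k^(3) *)

Section LogarithmicWeight.
Context {R : realType}.
Local Notation leb := (@lebesgue_measure R).
Local Notation Rpos := (`]0%R, +oo[%classic : set R).
Implicit Types (s x y : R).

Definition log_weight n : R := ln n%:R / Num.sqrt n%:R.

Lemma log_weight_ge0 n : 0 <= log_weight n.
Proof.
case: n => [|n]; first by rewrite /log_weight ln0// mul0r.
by rewrite divr_ge0 ?sqrtr_ge0// ln_ge0// ler1n.
Qed.

Lemma ln_le_sqrt x : 0 < x -> ln x <= 2 * Num.sqrt x.
Proof.
move=> x0; have q0 : 0 < Num.sqrt x by rewrite sqrtr_gt0.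
rewrite -{1}(sqr_sqrtr (ltW x0)) lnXn// -[ln _ *+ 2]mulr_natl ler_pM2l//.
have := @le_ln1Dx R (Num.sqrt x - 1); rewrite addrCA subrr addr0; lra.
Qed.

Lemma cvg_ln_small : (1 - ln s)^-1 @[s --> (0 : R)^'+] --> (0 : R).
Proof.
have c : 1 - ln s @[s --> (0 : R)^'+] --> +oo.
  apply/cvgryPge => A; near=> s.
  have : ln s <= 1 - A by near: s; apply: (cvgrNyPle _).1; exact: lnNy.
  lra.
by apply/gtr0_cvgV0 => //; apply: (cvgryPgt _).1.
Unshelve. all: by end_near. Qed.

(** The normalization 1 - ln s is equivalent to ln (1/s) at 0 and, unlike it, is at least 1 on the
    whole of ]0, 1[. *)
Let phi s a := zs s ^+ a * ln a%:R / (Num.sqrt s * Num.sqrt a%:R * (1 - ln s)).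

Let lns s : 0 < s -> s < 1 -> 1 <= 1 - ln s.
Proof. by move=> s0 s1; have := @ln_le0 R s (ltW s1); lra. Qed.

Let phi_ge0 s a : 0 < s -> s < 1 -> 0 <= phi s a.
Proof.
move=> s0 s1; have ls := lns s0 s1; rewrite /phi; case: a => [|a]; first by rewrite ln0// mulr0 mul0r.
rewrite divr_ge0 ?mulr_ge0 ?exprn_ge0 ?sqrtr_ge0 ?ln_ge0 ?ler1n// ?(ltW (zs_gt0 s))//; lra.
Qed.

Let h x := 2 * expR 1 * (gamma_half x + 2 * expR (- x)).

Let phi_le s x : 0 < s -> s < 1 -> 0 < x -> phi s (grid s x) <= h x.
Proof.
move=> s0 s1 x0; have ls := lns s0 s1; rewrite /phi /h gamma_halfE//.
have sx0 : 0 < Num.sqrt x by rewrite sqrtr_gt0.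
have := grid_gt s0 x0; have := grid_le s0 x0; have := zs_grid_le s0 s1 x0.
case: (grid s x) => [|a] hz hl hg.
  rewrite ln0// mulr0 mul0r.
  by rewrite !mulr_ge0 ?expR_ge0// addr_ge0 ?divr_ge0 ?mulr_ge0 ?expR_ge0// ltW.
have a0 : 1 <= a.+1%:R :> R by rewrite ler1n.
set b : R := a.+1%:R in hz hl a0 *.
have b0 : 0 < b by lra.
have hg2 : x <= 2 * (s * b).
  apply: ltW; apply: lt_le_trans hg _; rewrite -natr1 -/b.
  by have := ler_wpM2l (ltW s0) a0; lra.
have sb0 : 0 < s * b by rewrite mulr_gt0.
have l1 : ln b <= (1 + 2 * Num.sqrt x) * (1 - ln s).
  have -> : ln b = ln (s * b) - ln s by rewrite lnM ?posrE//; ring.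
  have q1 : Num.sqrt (s * b) <= Num.sqrt x by apply: ler_wsqrtr.
  have := ln_le_sqrt sb0; have : 0 <= 2 * Num.sqrt x * - ln s.
    by rewrite !mulr_ge0 ?(ltW sx0)//; lra.
  lra.
have q2 : Num.sqrt x <= 2 * (Num.sqrt s * Num.sqrt b).
  rewrite -sqrtrM ?(ltW s0)//.
  have -> : 2 * Num.sqrt (s * b) = Num.sqrt (2 ^+ 2 * (s * b)).
    by rewrite [RHS]sqrtrM ?sqr_ge0// sqrtr_sqr ger0_norm.
  by apply: ler_wsqrtr; lra.
have ss0 : 0 < Num.sqrt s * Num.sqrt b by rewrite mulr_gt0 ?sqrtr_gt0.
have ls0 : 0 < 1 - ln s by lra.
rewrite ler_pdivrMr; last exact: mulr_gt0.
apply: (@le_trans _ _ (expR 1 * expR (- x) * ((1 + 2 * Num.sqrt x) * (1 - ln s)))).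
  by apply: ler_pM; rewrite ?exprn_ge0 ?(ltW (zs_gt0 s))// ln_ge0.
have -> : expR 1 * expR (- x) * ((1 + 2 * Num.sqrt x) * (1 - ln s)) =
  expR 1 * (expR (- x) / Num.sqrt x + 2 * expR (- x)) * (1 - ln s) * Num.sqrt x.
  by field; rewrite gt_eqF.
rewrite [leRHS](_ : _ = expR 1 * (expR (- x) / Num.sqrt x + 2 * expR (- x)) * (1 - ln s) * (2 * (Num.sqrt s * Num.sqrt b))); last by ring.
apply: ler_wpM2l => //.
by rewrite !mulr_ge0 ?expR_ge0 ?(ltW ls0)// addr_ge0 ?mulr_ge0 ?divr_ge0 ?expR_ge0 ?(ltW sx0).
Qed.

Let phi_cvg x : 0 < x -> phi s (grid s x) @[s --> (0 : R)^'+] --> gamma_half x.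
Proof.
move=> x0; rewrite gamma_halfE//.
have sx0 : 0 < Num.sqrt x by rewrite sqrtr_gt0.
have c1 := cvg_zs_grid x0; have c2 := cvg_grid x0; have c3 := cvg_ln_small.
have c4 : Num.sqrt (s * (grid s x)%:R) @[s --> (0 : R)^'+] --> Num.sqrt x.
  by apply: continuous_cvg => //; exact: sqrt_continuous.
have c5 : ln (s * (grid s x)%:R) @[s --> (0 : R)^'+] --> ln x.
  by apply: continuous_cvg => //; exact: continuous_ln.
have c6 : (1 + (ln (s * (grid s x)%:R) - 1) * (1 - ln s)^-1) @[s --> (0 : R)^'+] --> (1 : R).
  rewrite -[X in _ --> X](_ : 1 + (ln x - 1) * 0 = 1); last by rewrite mulr0 addr0.
  by apply: cvgD; [exact: cvg_cst|apply: cvgM => //; apply: cvgB => //; exact: cvg_cst].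
have c7 := cvgV (lt0r_neq0 sx0) c4.
have c := cvgM (cvgM c1 (c7 _)) c6.
rewrite -[X in _ --> X]mulr1; apply: cvg_trans (c _ _ _); apply: near_eq_cvg; near=> s.
have s0 : 0 < s by [].
have s1 : s < 1 by near: s; exact: nbhs_right_lt.
have ls0 : 0 < 1 - ln s by have := lns s0 s1; lra.
have g0 : 0 < (grid s x)%:R :> R.
  rewrite ltr0n; near: s; have := cvg_grid_oo x0 => /cvgnyPgt; exact.
rewrite /phi /= sqrtrM ?(ltW s0)// lnM ?posrE//.
by field; rewrite !gt_eqF ?sqrtr_gt0.
Unshelve. all: by end_near. Qed.

Let ih : leb.-integrable Rpos (EFin \o h).
Proof.
have -> : EFin \o h = (fun x => (2 * expR 1)%:E * ((EFin \o gamma_half) x + 2%:E * (EFin \o (fun y => expR (- y))) x))%E.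
  by apply/funext => x.
apply: integrableZl => //; apply: integrableD => //; first exact: integrable_gamma_half.
apply: integrableZl => //.
have : leb.-integrable Rpos (EFin \o exponential_pdf (1 : R)).
  by apply: (integrableS measurableT) => //; exact: integrable_exponential_pdf.
apply: eq_integrable => // x; rewrite inE /= in_itv /= andbT => x0.
by rewrite exponential_pdfE ?(ltW x0)// mul1r mulN1r.
Qed.

(** In 2 sqrt pi the factor sqrt pi is Gamma(1/2), and the 2 comes from ln (1/s) = 2 ln (1 / sqrt
    s). *)
Lemma gf_log_weight : transformable log_weight /\
  fine (gf log_weight (zs s)) / ((Num.sqrt s)^-1 * ln ((Num.sqrt s)^-1))
    @[s --> (0 : R)^'+] --> 2 * Num.sqrt (pi : R).
Proof.
have [_ fin cv] := riemann_dominated phi_ge0 ih phi_le phi_cvg.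
have E s : 0 < s -> s < 1 -> gf log_weight (zs s) =
    ((Num.sqrt s * (1 - ln s))%:E * \sum_(0 <= a <oo) (phi s a)%:E)%E.
  move=> s0 s1; have ls := lns s0 s1.
  rewrite -nneseriesZl; last by move=> i _; rewrite lee_fin phi_ge0.
  apply: eq_eseriesr => -[|n] _; rewrite -EFinM; congr EFin; rewrite /phi /log_weight.
    by rewrite ln0// !(mulr0, mul0r).
  by field; rewrite !gt_eqF ?sqrtr_gt0//; lra.
have tr : transformable log_weight.
  split; first exact: log_weight_ge0.
  move=> s s0 s1; rewrite E// lte_mul_pinfty ?fin//.
  by rewrite lee_fin mulr_ge0 ?sqrtr_ge0//; have := lns s0 s1; lra.
split => //.
have ig : (\int[leb]_(x in Rpos) (gamma_half x)%:E)%E = (Num.sqrt (pi : R))%:E.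
  exact: integral_gamma_half.
rewrite ig in cv; clear ig.
have cv' := fine_cvg cv.
have c2 : (1 - ln s) / ln ((Num.sqrt s)^-1) @[s --> (0 : R)^'+] --> (2 : R).
  have c : 2 / (1 - (1 - ln s)^-1) @[s --> (0 : R)^'+] --> 2 / (1 - 0 : R).
    apply: cvgM; first exact: cvg_cst.
    apply: cvgV; first by rewrite subr0.
    by apply: cvgB; [exact: cvg_cst|exact: cvg_ln_small].
  rewrite subr0 divr1 in c; apply: cvg_trans c; apply: near_eq_cvg; near=> s.
  have s0 : 0 < s by [].
  have s1 : s < 1 by near: s; exact: nbhs_right_lt.
  have l0 : ln s < 0 by rewrite ln_lt0// s0.
  have q0 : 0 < Num.sqrt s by rewrite sqrtr_gt0.
  have <- : - ln s / 2 = ln (Num.sqrt s)^-1.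
    by rewrite -[in LHS](sqr_sqrtr (ltW s0)) lnXn// lnV ?posrE// -[ln _ *+ 2]mulr_natl; field.
  have n0 : ln s != 0 by rewrite lt_eqF.
  have n1 : 1 - ln s != 0 by rewrite gt_eqF//; lra.
  have -> : 1 - (1 - ln s)^-1 = - ln s / (1 - ln s) by field.
  by field; rewrite n0 n1.
have c := cvgM c2 (cv' _).
apply: cvg_trans (c _ _); apply: near_eq_cvg; near=> s.
have s0 : 0 < s by [].
have s1 : s < 1 by near: s; exact: nbhs_right_lt.
have fS : (\sum_(0 <= a <oo) (phi s a)%:E)%E \is a fin_num.
  by rewrite ge0_fin_numE ?fin// nneseries_ge0// => a _ _; rewrite lee_fin phi_ge0.
have l0 : ln s < 0 by rewrite ln_lt0// s0.
have q0 : 0 < Num.sqrt s by rewrite sqrtr_gt0.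
have lq : 0 < ln (Num.sqrt s)^-1.
  have <- : - ln s / 2 = ln (Num.sqrt s)^-1.
    by rewrite -[in LHS](sqr_sqrtr (ltW s0)) lnXn// lnV ?posrE// -[ln _ *+ 2]mulr_natl; field.
  lra.
rewrite /= E// !fineM//= -[X in X * fine _](sqr_sqrtr (ltW s0)) expr2.
by field; rewrite !gt_eqF.
Unshelve. all: by end_near. Qed.

End LogarithmicWeight.

(** * Records of a path *)

Section Paths.
Context {R : realType}.
Implicit Types (x : nat -> R) (c : seq nat) (a i j k l m n r t u : nat).

(* [state x n] lists the ages of the completed records and the current age. *)
Fixpoint state x n : seq nat * nat :=
  if n is n'.+1 then
    let: (c, a) := state x n' in
    if x (n' - a)%N < x n then (rcons c a.+1, 0%N) else (c, a.+1)
  else ([::], 0%N).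

Definition completed x n := (state x n).1.

Definition current x n := (state x n).2.

Definition stays x u r := all (fun j => x (u + j)%N <= x u) (iota 0 r.+1).

Definition hits x u l := [&& (0 < l)%N, stays x u l.-1 & x u < x (u + l)%N].

Lemma staysP x u r : reflect (forall j, (j <= r)%N -> x (u + j)%N <= x u) (stays x u r).
Proof.
apply: (iffP allP) => [h j jr|h j]; first by apply: h; rewrite mem_iota.
by rewrite mem_iota => /= jr; exact: h.
Qed.

Lemma stays0 x u : stays x u 0.
Proof. by apply/staysP => j; rewrite leqn0 => /eqP->; rewrite addn0. Qed.

Lemma staysS x u r : stays x u r.+1 = stays x u r && (x (u + r.+1)%N <= x u).
Proof. by rewrite /stays -(addn1 r.+1) iotaD all_cat /= andbT. Qed.

Lemma stays_le x u r j : (j <= r)%N -> stays x u r -> stays x u j.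
Proof. by move=> jr /staysP h; apply/staysP => i ij; apply: h; exact: leq_trans jr. Qed.

Lemma hitsS x u l : hits x u l.+1 = stays x u l && ~~ stays x u l.+1.
Proof. by rewrite /hits /= staysS; case: (stays _ _ _) => //=; rewrite ltNge. Qed.

Lemma current_le x n : (current x n <= n)%N.
Proof.
rewrite /current; elim: n => //= n; case: (state x n) => c a /= an.
by case: ifP => //= _.
Qed.

Lemma stateE x n : state x n = (completed x n, current x n).
Proof. by rewrite /completed /current; case: (state x n). Qed.

Lemma stateS x n : state x n.+1 = if x (n - current x n)%N < x n.+1
  then (rcons (completed x n) (current x n).+1, 0%N)
  else (completed x n, (current x n).+1).
Proof. by rewrite /= stateE. Qed.

Lemma state_last x n : stays x (n - current x n) (current x n) /\
  state x (n - current x n)%N = (completed x n, 0%N).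
Proof.
elim: n => [|n [ih1 ih2]]; first by rewrite stays0.
rewrite /current /completed stateS; case: ltP => h; last first.
  by rewrite /= subSS ih2 staysS ih1 addnS subnK ?current_le.
split; first exact: stays0.
by rewrite [X in state x X]subn0 stateS h.
Qed.

Lemma state_stay x u r c : state x u = (c, 0%N) -> stays x u r -> state x (u + r)%N = (c, r).
Proof.
move=> su; elim: r => [|r ih]; first by rewrite addn0.
rewrite staysS => /andP[/ih e h].
by rewrite addnS stateS /current /completed e /= addnK -addnS ltNge h.
Qed.

(** Cutting at the last record: the first two conditions on the right depend on the first n - a
    steps, the third on the later ones. *)
Lemma event_split x n (F : seq nat -> nat -> bool) a : (a <= n)%N ->
  (current x n == a) && F (completed x n) (current x n) =
  [&& current x (n - a) == 0%N, F (completed x (n - a)) a & stays x (n - a) a].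
Proof.
move=> an; apply/andP/and3P.
  move=> [/eqP ca Fn]; have [h1 h2] := state_last x n.
  rewrite ca in h1 h2 Fn; rewrite /current /completed h2; split => //.
move=> [/eqP c0 Fn st].
have s0 : state x (n - a)%N = (completed x (n - a)%N, 0%N) by rewrite stateE c0.
have := state_stay s0 st; rewrite subnK// => e.
have en : completed x n = completed x (n - a) by rewrite {1}/completed e.
by rewrite en /current e /= eqxx.
Qed.

Lemma record_split x n (F : seq nat -> bool) :
  (current x n.+1 == 0%N) && F (completed x n.+1) =
  (x (n - current x n)%N < x n.+1) && F (rcons (completed x n) (current x n).+1).
Proof. by rewrite /current /completed stateS; case: ifP. Qed.

Lemma record_split_age x n (F : seq nat -> bool) a : (a <= n)%N ->
  [&& current x n == a, x (n - current x n)%N < x n.+1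
    & F (rcons (completed x n) (current x n).+1)] =
  [&& current x (n - a) == 0%N, F (rcons (completed x (n - a)) a.+1)
    & hits x (n - a) a.+1].
Proof.
move=> an.
rewrite (event_split x (fun c b => (x (n - b)%N < x n.+1) && F (rcons c b.+1)) an).
rewrite /hits /= addnS subnK//.
by case: (_ == _) => //=; case: (F _); rewrite ?andbF ?andbT //= andbC.
Qed.

(** This form of a record, a strict maximum of the past, is the one that reverses in time. *)
Lemma record_max x n : (current x n == 0%N) = all (fun i => x i < x n) (iota 0 n).
Proof.
have inv m : (forall i, (i <= m)%N -> x i <= x (m - current x m)%N) /\
    (forall i, (i < m - current x m)%N -> x i < x (m - current x m)%N).
  elim: m => [|m [h1 h2]].
    by split => i; [rewrite leqn0 => /eqP->; rewrite sub0n|rewrite sub0n].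
  rewrite /current stateS; case: ltP => h /=.
    rewrite subn0; split => i im; last by exact: le_lt_trans (h1 i im) h.
    by move: im; rewrite leq_eqVlt => /orP[/eqP->//|im]; exact/ltW/(le_lt_trans (h1 i im) h).
  rewrite subSS; split => // i.
  by rewrite leq_eqVlt => /orP[/eqP->//|]; exact: h1.
have [h1 h2] := inv n; apply/eqP/allP => [c0 i|h].
  by rewrite mem_iota /= => i_n; rewrite c0 subn0 in h2; exact: h2.
apply/eqP; case: posnP => // c0.
have cn := current_le x n; have lt : (n - current x n < n)%N by lia.
have := h (n - current x n)%N; rewrite mem_iota /= lt => /(_ isT).
by rewrite ltNge h1.
Qed.

End Paths.

(** * From record times to the state of the path *)

Section Records.
Context {R : realType}.
Implicit Types (x : nat -> R) (c : seq nat) (a i j k l m n r t u : nat).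

Lemma first_natE (Q : pred nat) t : Q t -> (forall t', (t' < t)%N -> ~~ Q t') ->
  first_nat Q = Some t.
Proof.
move=> Qt h; rewrite /first_nat; case: pselect => [ex|]; last by case; exists t.
congr Some; case: ex_minnP => m Qm mmin; apply/eqP; rewrite eqn_leq mmin//=.
by rewrite leqNgt; apply/negP => /h; rewrite Qm.
Qed.

Lemma first_nat_None (Q : pred nat) : (forall t, ~~ Q t) -> first_nat Q = None.
Proof. by move=> h; rewrite /first_nat; case: pselect => // -[t Qt]; have := h t; rewrite Qt. Qed.

Definition waiting_time x u : \bar R :=
  if next_record x u is Some t then ((t - u)%N%:R)%:E else +oo%E.

Lemma next_recordE x u l : hits x u l -> next_record x u = Some (u + l)%N.
Proof.
move=> /and3P[l0 /staysP st h]; rewrite /next_record (@first_natE _ l)//= ?l0//.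
move=> t tl; case: posnP => //= t0.
by rewrite -leNgt; apply: st; rewrite -ltnS prednK.
Qed.

Lemma next_record_None x u : (forall r, stays x u r) -> next_record x u = None.
Proof.
move=> st; rewrite /next_record first_nat_None// => t; rewrite negb_and -leNgt.
by apply/orP; right; apply/(staysP x u t).
Qed.

Lemma hits_or_stays x u : (exists l, hits x u l) \/ (forall r, stays x u r).
Proof.
have [h|h] := pselect (forall r, stays x u r); first by right.
left; have ex : exists r, ~~ stays x u r.
  by apply: contrapT => h'; apply: h => r; apply/negPn/negP => nr; apply: h'; exists r.
case: (ex_minnP ex) => -[|r nr rmin]; first by rewrite stays0.
exists r.+1; rewrite hitsS nr andbT; apply/negPn/negP => /rmin.
by rewrite ltnn.
Qed.

Lemma waiting_time_hits x u l : hits x u l -> waiting_time x u = (l%:R)%:E.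
Proof. by move=> h; rewrite /waiting_time (next_recordE h) addKn. Qed.

Lemma waiting_time_stays x u : (forall r, stays x u r) -> waiting_time x u = +oo%E.
Proof. by move=> h; rewrite /waiting_time next_record_None. Qed.

Lemma hits_stays x u l j : hits x u l -> stays x u j = (j < l)%N.
Proof.
case: l => [//|l]; rewrite hitsS => /andP[s1 s2]; apply/idP/idP => [sj|jl].
  by rewrite ltnNge; apply: contra s2 => lj; exact: stays_le lj sj.
by apply: stays_le s1; rewrite -ltnS.
Qed.

Lemma waiting_time_gt x u j : ((j%:R)%:E < waiting_time x u)%E = stays x u j.
Proof.
have [[l h]|h] := hits_or_stays x u.
  by rewrite (waiting_time_hits h) lte_fin ltr_nat (hits_stays _ h).
by rewrite waiting_time_stays// ltry h.
Qed.

Lemma next_record_gt x u t r : next_record x u = Some t -> stays x u r -> (u + r < t)%N.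
Proof.
have [[l h]|h] := hits_or_stays x u; last by rewrite next_record_None.
by rewrite (next_recordE h) => -[<-]; rewrite (hits_stays _ h) ltn_add2l.
Qed.

Lemma record_timeS x k : record_time x k.+2 = obind (next_record x) (record_time x k.+1).
Proof. by []. Qed.

(** The link between the definition of the record times and [state]: they are the partial sums of
    the completed ages. *)
Lemma record_times x n :
  (forall i, (i <= size (completed x n))%N ->
     record_time x i.+1 = Some (sumn (take i (completed x n)))) /\
  sumn (completed x n) = (n - current x n)%N.
Proof.
elim: n => [|n [ih1 ih2]]; first by split => // i; rewrite leqn0 => /eqP->.
have [st _] := state_last x n; have cn := current_le x n.
rewrite /completed /current stateS; case: ltP => h; last by rewrite /= subSS.
rewrite [(_, _).1]/= [(_, _).2]/=.
rewrite sumn_rcons ih2 subn0 addnS subnK// size_rcons; split => // i.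
rewrite leq_eqVlt => /orP[/eqP->|]; last first.
  by rewrite ltnS => ic; rewrite ih1// -cats1 takel_cat.
rewrite record_timeS ih1// take_size ih2 [LHS]/=.
rewrite (@next_recordE x _ (current x n).+1).
  by rewrite take_oversize ?size_rcons// sumn_rcons ih2.
by rewrite /hits /= st addnS subnK.
Qed.

Lemma record_numberE x n : record_number x n = (size (completed x n)).+1.
Proof.
have [rt sc] := record_times x n; have [st _] := state_last x n.
have cn := current_le x n; set c := completed x n in rt sc *.
have rl : record_time x (size c).+1 = Some (n - current x n)%N.
  by rewrite rt// take_size sc.
(* Every later record time is either undefined or larger than n, so that no larger m can be the
   record number. *)
have late j : if record_time x ((size c).+2 + j) is Some t then (n < t)%N else true.
  elim: j => [|j].
    rewrite addn0 record_timeS rl [obind _ _]/=.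
    case E : (next_record _ _) => [t|//].
    by have := next_record_gt E st; rewrite subnK.
  rewrite addnS addSn record_timeS -addSn.
  case: (record_time x _) => // s ns; rewrite [obind _ _]/=; case E : (next_record _ _) => [t|//].
  by apply: ltn_trans ns _; have := next_record_gt E (stays0 x s); rewrite addn0.
apply: xget_unique.
  split; first by rewrite rl leq_subr.
  by have := late 0%N; rewrite addn0; case: (record_time _ _).
move=> m [m1 m2]; apply/eqP; case: ltngtP => // mc.
  case: m m1 m2 mc => [_ //|m] _ m2; rewrite ltnS => mc.
  move: m2; rewrite rt// ltnNge; case/negP; apply: leq_trans (leq_subr (current x n) n).
  by rewrite -sc -[X in (_ <= sumn X)%N](cat_take_drop m.+1) sumn_cat leq_addr.
by have := late (m - (size c).+2)%N; rewrite subnKC//; case: (record_time x m) m1 => // t; rewrite ltnNge => ->.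
Qed.

Definition nat_ages c : seq (\bar R) := [seq (i%:R)%:E | i <- c].

Lemma ages3E x n : ages3 x n = nat_ages (completed x n).
Proof.
have [rt sc] := record_times x n; rewrite /ages3 record_numberE /nat_ages.
apply: (@eq_from_nth _ 0%E) => [|i]; rewrite !size_map size_iota ?subn1// => ic.
rewrite (nth_map 0%N) ?size_iota ?subn1// nth_iota ?subn1// add1n.
rewrite (nth_map 0%N)// /age rt ?(ltnW ic)// rt//.
by rewrite (take_nth 0%N)// sumn_rcons addKn.
Qed.

Lemma ages1E x n : ages1 x n = rcons (nat_ages (completed x n)) ((current x n)%:R)%:E.
Proof.
have [rt sc] := record_times x n; rewrite /ages1 -/(ages3 x n) ages3E; congr rcons.
by rewrite /current_age record_numberE rt// take_size sc subKn// current_le.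
Qed.

Lemma ages2E x n : ages2 x n =
  rcons (nat_ages (completed x n)) (waiting_time x (n - current x n)).
Proof.
have [rt sc] := record_times x n; rewrite -ages3E /ages2 /ages3 record_numberE.
rewrite /index_iota !subSS !subn0 -[(size _).+1]addn1 iotaD map_cat cats1 /=.
congr rcons; rewrite /age add1n rt// take_size sc.
rewrite record_timeS rt// take_size sc /=.
by rewrite /waiting_time; case: (next_record _ _).
Qed.

Lemma count_nat_ages c j : count (fun y => (j%:R)%:E < y)%E (nat_ages c) = count (ltn j) c.
Proof. by rewrite count_map; apply: eq_count => i /=; rewrite lte_fin ltr_nat. Qed.

Lemma last_kth1 x n k : last_is_kth_longest k (ages1 x n) =
  (count (ltn (current x n)) (completed x n) == k.-1).
Proof.
rewrite ages1E /last_is_kth_longest last_rcons -size_eq0 size_rcons /=.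
by rewrite -cats1 count_cat count_nat_ages /= ltxx !addn0.
Qed.

Lemma last_kth2 x n k l : hits x (n - current x n) l ->
  last_is_kth_longest k (ages2 x n) = (count (ltn l) (completed x n) == k.-1).
Proof.
move=> h; rewrite ages2E /last_is_kth_longest last_rcons -size_eq0 size_rcons /=.
by rewrite -cats1 count_cat (waiting_time_hits h) count_nat_ages /= ltxx !addn0.
Qed.

Lemma last_kth3 x n k : last_is_kth_longest k (ages3 x n) =
  (completed x n != [::]) && (count (ltn (last 0%N (completed x n))) (completed x n) == k.-1).
Proof.
rewrite ages3E /last_is_kth_longest -!size_eq0 size_map.
case/lastP: (completed x n) => //= c i; rewrite last_rcons.
have -> : last 0%E (nat_ages (rcons c i)) = (i%:R)%:E by rewrite /nat_ages map_rcons last_rcons.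
by rewrite count_nat_ages.
Qed.

Lemma count_ages1 x n j : count (fun y => (j%:R)%:E < y)%E (ages1 x n) =
  (count (ltn j) (completed x n) + (j < current x n))%N.
Proof. by rewrite ages1E -cats1 count_cat count_nat_ages /= addn0 lte_fin ltr_nat. Qed.

Lemma count_ages2 x n j : count (fun y => (j%:R)%:E < y)%E (ages2 x n) =
  (count (ltn j) (completed x n) + stays x (n - current x n) j)%N.
Proof. by rewrite ages2E -cats1 count_cat count_nat_ages /= addn0 waiting_time_gt. Qed.

Lemma count_ages3 x n j : count (fun y => (j%:R)%:E < y)%E (ages3 x n) =
  count (ltn j) (completed x n).
Proof. by rewrite ages3E count_nat_ages. Qed.

End Records.

(** * The kth largest age as a sum over levels *)

Section KthLargest.
Context {R : realType}.
Implicit Types (s : seq (\bar R)) (y t : \bar R) (j k n : nat).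

Definition nat_or_oo y := y = +oo%E \/ exists n, y = (n%:R)%:E.

Let ge_bar (a b : \bar R) := (b <= a)%E.

(** The sign of t matters because [nth] returns 0 beyond the end of the sequence. *)
Lemma nth_desc s i t : (0 <= t)%E -> sorted ge_bar s ->
  (t < nth 0 s i)%E = (i < count (fun y => (t < y)%E) s)%N.
Proof.
move=> t0; elim: s i => [|y s ih] i ys; first by rewrite nth_nil ltn0 ltNge t0.
have ss : sorted ge_bar s by exact: path_sorted ys.
have [yt|yt] /= := ltP t y.
  by case: i => [|i] /=; rewrite yt add1n //= ltnS ih.
have tr : transitive ge_bar by move=> a b c; rewrite /ge_bar => h1 h2; exact: le_trans h2 h1.
have al : all (ge_bar y) s by apply: order_path_min ys.
rewrite (eq_in_count (a2 := pred0)); last first.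
  by move=> a /(allP al) ya /=; apply/negbTE; rewrite -leNgt; exact: le_trans ya yt.
rewrite count_pred0 [(t < y)%E]ltNge yt ltn0; apply/negbTE; rewrite -leNgt; case: i => //= i.
have [si|si] := leqP (size s) i; first by rewrite nth_default.
by apply: le_trans yt; apply: (allP al); exact: mem_nth.
Qed.

Lemma kth_largest_gt k s j : (0 < k)%N ->
  ((j%:R)%:E < kth_largest k s)%E = (k <= count (fun y => (j%:R)%:E < y)%E s)%N.
Proof.
move=> k0; rewrite /kth_largest nth_desc ?lee_fin//; last first.
  by apply: sort_sorted => a b; rewrite /ge_bar le_total.
by rewrite (permP (permEl (perm_sort _ _))) prednK.
Qed.

Lemma nat_or_oo_sum y : nat_or_oo y ->
  y = (\sum_(0 <= j <oo) (((j%:R)%:E < y)%E%:R : R)%:E)%E.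
Proof.
case=> [->|[n ->]].
  under eq_eseriesr do rewrite ltry.
  symmetry; apply/cvg_lim => //.
  rewrite (_ : (fun N => _) = EFin \o (fun N => N%:R)); last first.
    by apply/funext => N; rewrite /= sumEFin sumr_const_nat subn0.
  by apply/cvgeryP; exact: cvgr_idn.
symmetry; under eq_eseriesr do rewrite lte_fin ltr_nat.
rewrite (@finite_nneseries _ _ n) => [|j nj]; last by rewrite ltnNge nj.
by congr EFin; under eq_bigr do rewrite ltn_ord; rewrite sumr_const card_ord.
Unshelve. all: by end_near. Qed.

Lemma kth_largest_nat k s : (forall y, y \in s -> nat_or_oo y) -> nat_or_oo (kth_largest k s).
Proof.
move=> h; rewrite /kth_largest; set s' := sort _ _.
have [si|si] := leqP (size s') k.-1; first by rewrite nth_default//; right; exists 0%N.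
by apply: h; rewrite -(mem_sort ge_bar); exact: mem_nth.
Qed.

Lemma kth_largest_sum k s : (0 < k)%N -> (forall y, y \in s -> nat_or_oo y) ->
  kth_largest k s =
  (\sum_(0 <= j <oo) ((k <= count (fun y => (j%:R)%:E < y)%E s)%N%:R : R)%:E)%E.
Proof.
move=> k0 h; rewrite [LHS](nat_or_oo_sum (kth_largest_nat k h)).
by apply: eq_eseriesr => j _; rewrite kth_largest_gt.
Qed.

Lemma waiting_time_nat (x : nat -> R) u : nat_or_oo (waiting_time x u).
Proof. by rewrite /waiting_time; case: next_record => [t|]; [right; eexists|left]. Qed.

Lemma nat_ages_nat c y : y \in nat_ages c -> nat_or_oo y.
Proof. by move=> /mapP[i _ ->]; right; exists i. Qed.

Lemma ages1_nat (x : nat -> R) n y : y \in ages1 x n -> nat_or_oo y.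
Proof.
rewrite ages1E mem_rcons inE => /orP[/eqP->|/nat_ages_nat//].
by right; eexists.
Qed.

Lemma ages2_nat (x : nat -> R) n y : y \in ages2 x n -> nat_or_oo y.
Proof.
rewrite ages2E mem_rcons inE => /orP[/eqP->|/nat_ages_nat//].
exact: waiting_time_nat.
Qed.

Lemma ages3_nat (x : nat -> R) n y : y \in ages3 x n -> nat_or_oo y.
Proof. by rewrite ages3E => /nat_ages_nat. Qed.

End KthLargest.

(** * The law of the sequence of steps *)

Section StepSequences.
Context {R : realType}.
Implicit Types (B : nat -> set R) (i j n u : nat).

Definition box n B : set (nat -> R) := [set e | forall i, (i < n)%N -> B i (e i)].

Definition boxes : set (set (nat -> R)) :=
  [set A | exists n B, (forall i, measurable (B i)) /\ A = box n B].

(** The product sigma-algebra. The finite boxes form a class stable under intersection on which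
    independence gives the law, so each identity between laws is checked on boxes only. *)
Definition steps := g_sigma_algebraType boxes.

Definition shift u (e : steps) : steps := fun i => e (u + i)%N.

Definition reverse n (e : steps) : steps :=
  fun i => if (i < n)%N then e (n - i.+1)%N else e i.

Definition opp_steps (e : steps) : steps := fun i => - e i.

Lemma measurable_box n B : (forall i, measurable (B i)) ->
  measurable (box n B : set steps).
Proof. by move=> mB; apply: sub_sigma_algebra; exists n, B. Qed.

Lemma measurable_coord i : measurable_fun [set: steps] (fun e : steps => e i).
Proof.
move=> _ Y mY; rewrite setTI.
rewrite [X in measurable X](_ : _ = box i.+1 (fun j => if j == i then Y else setT)).
  by apply: measurable_box => j; case: ifP.
apply/seteqP; split => e /=.
  by move=> Yi j _; case: eqP => // ->.
by move=> /(_ i (ltnSn i)); rewrite eqxx.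
Qed.

Lemma measurable_steps_fun d (T : measurableType d) (f : T -> steps) :
  (forall i, measurable_fun setT (fun w => f w i)) -> measurable_fun setT f.
Proof.
move=> mf; apply: (@measurability _ _ _ _ setT f boxes) => //.
move=> _ [_ [n [B [mB ->]]] <-]; rewrite setTI.
rewrite [X in measurable X](_ : _ = \bigcap_(i in `I_n) ((fun w => f w i) @^-1` B i)); last first.
  by apply/seteqP; split => w /=.
apply: bigcap_measurableType => i _.
by rewrite -[X in measurable X]setTI; exact: mf.
Qed.

Lemma steps_measure_unique (m1 m2 : {measure set steps -> \bar R}) :
  (m1 setT < +oo)%E ->
  (forall n B, (forall i, measurable (B i)) -> m1 (box n B) = m2 (box n B)) ->
  forall A, measurable A -> m1 A = m2 A.
Proof.
move=> m1oo m12 A mA.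
apply: (@measure_unique _ R steps boxes (fun=> setT)) => //.
- move=> _ _ [n [B [mB ->]]] [n' [B' [mB' ->]]].
  exists (maxn n n'), (fun i => (if (i < n)%N then B i else setT) `&` (if (i < n')%N then B' i else setT)).
  split => [i|]; first by apply: measurableI; case: ifP.
  apply/seteqP; split => e.
    by move=> [h h'] i _; split; case: ifP => // ?; [exact: h|exact: h'].
  move=> h; split => i ni.
    by have [] := h i (leq_trans ni (leq_maxl _ _)); rewrite ni.
  by have [] := h i (leq_trans ni (leq_maxr _ _)); rewrite ni.
- by move=> _; exists 0%N, (fun=> setT); split => //; apply/seteqP; split.
- by rewrite bigcup_const.
- by move=> _ [n [B [mB ->]]]; exact: m12.
Qed.

Definition depends_on_first u (C : set steps) :=
  forall e e', (forall i, (i < u)%N -> e i = e' i) -> C e -> C e'.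

End StepSequences.

Lemma pushforward_unique (R : realType) d1 d2 (T1 : measurableType d1) (T2 : measurableType d2)
  (m1 : {measure set T1 -> \bar R}) (m2 : {measure set T2 -> \bar R})
  (f1 : T1 -> @steps R) (f2 : T2 -> @steps R) :
  measurable_fun setT f1 -> measurable_fun setT f2 -> (m1 setT < +oo)%E ->
  (forall n B, (forall i, measurable (B i)) -> m1 (f1 @^-1` box n B) = m2 (f2 @^-1` box n B)) ->
  forall A, measurable A -> m1 (f1 @^-1` A) = m2 (f2 @^-1` A).
Proof.
move=> mf1 mf2 m1oo m12 A mA.
by apply: (steps_measure_unique (m1 := pushforward m1 f1) (m2 := pushforward m2 f2)).
Qed.

Section Law.
Context {d : measure_display} {T : measurableType d} {R : realType}.
Variables (P : probability T R) (eta : nat -> {RV P >-> R}).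
Implicit Types (A C : set (@steps R)) (i j n u : nat).

Definition step_path (w : T) : @steps R := fun i => eta i w.

Lemma measurable_step_path : measurable_fun setT step_path.
Proof. by apply: measurable_steps_fun => i. Qed.

HB.instance Definition _ := @isMeasurableFun.Build _ _ T (@steps R) step_path measurable_step_path.

Definition law : probability (@steps R) R := distribution P step_path.

Lemma lawE A : law A = P [set w | A (step_path w)]. Proof. by []. Qed.

Hypotheses (eta_indep : mutually_independent eta) (eta_ident : identically_distributed eta).

Let mu := distribution P (eta 0).

Lemma law_box n (B : nat -> set R) : (forall i, measurable (B i)) ->
  law (box n B) = (\prod_(i < n) mu (B i))%E.
Proof.
move=> mB; rewrite lawE.
have -> : [set w | box n B (step_path w)] = \bigcap_(j in [set` [fset k | k in iota 0 n]%fset]) (eta j @^-1` B j).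
  apply/seteqP; split => w /= h i.
    by rewrite /= !inE mem_iota add0n => /andP[_ ni]; exact: h.
  by move=> ni; apply: h => /=; rewrite !inE mem_iota.
rewrite eta_indep//.
rewrite (perm_big (iota 0 n)) /=; last first.
  apply: uniq_perm; rewrite ?iota_uniq ?fset_uniq// => i.
  by rewrite !inE.
rewrite -[in iota 0 n](subn0 n) -/(index_iota 0 n) big_mkord.
by apply: eq_bigr => i _; exact: (eta_ident _ _ (mB i)).
Qed.

Lemma measurable_shift u : measurable_fun setT (@shift R u).
Proof. by apply: measurable_steps_fun => i; exact: measurable_coord. Qed.

Lemma measurable_reverse n : measurable_fun setT (@reverse R n).
Proof.
apply: measurable_steps_fun => i; rewrite /reverse.
by case: (i < n)%N; exact: measurable_coord.
Qed.

Lemma measurable_opp_steps : measurable_fun setT (@opp_steps R).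
Proof.
by apply: measurable_steps_fun => i; apply: measurableT_comp => //; exact: measurable_coord.
Qed.

Let law_box_shift u (B : nat -> set R) A : (forall i, measurable (B i)) -> measurable A ->
  law (box u B `&` (shift u @^-1` A)) = (law (box u B) * law A)%E.
Proof.
move=> mB mA; have mb : measurable (box u B : set (@steps R)) by exact: measurable_box.
pose c : {nonneg R} := NngNum (fine_ge0 (measure_ge0 law (box u B))).
have cE : c%:num%:E = law (box u B) by rewrite /= fineK// fin_num_measure.
rewrite -cE.
transitivity (mrestr law mb (shift u @^-1` A)); first by rewrite /mrestr setIC.
apply: (pushforward_unique (f2 := id) (m2 := mscale c law)) => //.
- exact: measurable_shift.
- by rewrite /= /mrestr setTI ltey_eq fin_num_measure.
move=> n C mC; rewrite /= /mrestr /mscale cE preimage_id.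
pose D i := if (i < u)%N then B i else C (i - u)%N.
have mD i : measurable (D i) by rewrite /D; case: ifP.
have -> : shift u @^-1` box n C `&` box u B = box (u + n) D.
  apply/seteqP; split => e.
    move=> [h1 h2] i iun; rewrite /D; have [iu|ui] := ltnP i u; first exact: h2.
    by rewrite -{2}(subnKC ui); apply: h1; lia.
  move=> h; split => i ni /=.
    by have := h (u + i)%N; rewrite /D ltn_add2l (ltnNge _ u) leq_addr /= addKn; exact.
  by have := h i (leq_trans ni (leq_addr _ _)); rewrite /D ni.
etransitivity; first exact: law_box.
rewrite big_split_ord /=; congr (_ * _)%E.
  by rewrite law_box//; apply: eq_bigr => i _; rewrite /D ltn_ord.
symmetry; etransitivity; first exact: law_box.
by apply: eq_bigr => i _; rewrite /D ltnNge leq_addr /= addKn.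
Qed.

(** Two uniqueness arguments: [law_box_shift] treats the case where C is a box by varying A; here C
    varies. *)
Lemma law_split u C A : measurable C -> measurable A -> depends_on_first u C ->
  law (C `&` (shift u @^-1` A)) = (law C * law A)%E.
Proof.
move=> mC mA dC.
have mA' : measurable (shift u @^-1` A).
  by rewrite -[X in measurable X]setTI; exact: measurable_shift.
pose c : {nonneg R} := NngNum (fine_ge0 (measure_ge0 law A)).
have cE : c%:num%:E = law A by rewrite /= fineK// fin_num_measure.
(* Setting the later steps to 0 does not affect membership in C, so C is its own preimage under
   [first]. *)
pose first (e : @steps R) : @steps R := fun i => if (i < u)%N then e i else 0.
have mfirst : measurable_fun setT first.
  apply: measurable_steps_fun => i; rewrite /first.
  by case: (i < u)%N; [exact: measurable_coord|exact: measurable_cst].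
have firstC : first @^-1` C = C.
  by apply/seteqP; split => e; apply: dC => i iu; rewrite /first iu.
rewrite -cE muleC -[in LHS]firstC -[in RHS]firstC.
apply: (pushforward_unique (m1 := mrestr law mA') (m2 := mscale c law)) => //.
  by rewrite /= /mrestr setTI ltey_eq fin_num_measure.
move=> n B mB; rewrite /= /mrestr /mscale cE muleC.
have [B0|nB0] := pselect (forall i, (u <= i < n)%N -> B i 0); last first.
  have -> : first @^-1` box n B = set0.
    apply/seteqP; split => e //= h; apply: nB0 => i /andP[ui ni].
    by have := h i ni; rewrite /first ltnNge ui.
  by rewrite set0I !measure0 mul0e.
pose D i := if (i < n)%N then B i else setT.
have -> : first @^-1` box n B = box u D.
  apply/seteqP; split => e h i; rewrite /D /first.
    by move=> iu; case: ifP => // ni; have := h i ni; rewrite /first iu.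
  move=> ni; rewrite /first; case: (ltnP i u) => iu; last by apply: B0; rewrite iu.
  by have := h i iu; rewrite /D ni.
by apply: law_box_shift => // i; rewrite /D; case: ifP.
Qed.

Lemma law_reverse n A : measurable A -> law (reverse n @^-1` A) = law A.
Proof.
move=> mA; apply: (pushforward_unique (f2 := id)) => //.
- exact: measurable_reverse.
- by rewrite ltey_eq fin_num_measure.
move=> m B mB; rewrite preimage_id.
pose D i := if (i < n)%N then B (n - i.+1)%N else B i.
(* The box is extended to n + m sides, so that reversing the first n coordinates permutes its
   sides. *)
pose B' i := if (i < m)%N then B i else setT.
have mB' i : measurable (B' i) by rewrite /B'; case: ifP.
pose D' i := if (i < n)%N then B' (n - i.+1)%N else B' i.
have mD' i : measurable (D' i) by rewrite /D'; case: ifP.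
have -> : box m B = box (n + m) B'.
  apply/seteqP; split => e h i; rewrite /B'.
    by move=> _; case: ifP => // /h.
  by move=> mi; have := h i (ltn_addl _ mi); rewrite /B' mi.
have -> : reverse n @^-1` box (n + m) B' = box (n + m) D'.
  apply/seteqP; split => e h i inm.
    rewrite /D'; case: ifP => ni; last first.
      by have := h i inm; rewrite /reverse ni.
    have := h (n - i.+1)%N; rewrite /reverse (_ : (n - i.+1 < n)%N); last by lia.
    by rewrite (_ : (n - (n - i.+1).+1)%N = i); [apply; lia|lia].
  rewrite /reverse; case: ifP => ni; last first.
    by have := h i inm; rewrite /D' ni.
  have := h (n - i.+1)%N; rewrite /D' (_ : (n - i.+1 < n)%N); last by lia.
  by rewrite (_ : (n - (n - i.+1).+1)%N = i); [apply; lia|lia].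
etransitivity; first exact: law_box.
etransitivity; last by symmetry; exact: law_box.
rewrite !big_split_ord /=; congr (_ * _)%E; last first.
  by apply: eq_bigr => i _; rewrite /D' ltnNge leq_addr.
rewrite [RHS](reindex_inj rev_ord_inj) /=.
by apply: eq_bigr => i _; rewrite /D' ltn_ord.
Qed.

Lemma law_opp A : symmetric_law (eta 0) -> measurable A -> law (@opp_steps R @^-1` A) = law A.
Proof.
move=> sym mA; apply: (pushforward_unique (f2 := id)) => //.
- exact: measurable_opp_steps.
- by rewrite ltey_eq fin_num_measure.
move=> m B mB; rewrite preimage_id.
have -> : @opp_steps R @^-1` box m B = box m (fun i => [set y | B i (- y)]).
  by apply/seteqP; split => e h i; exact: h.
etransitivity.
  by apply: law_box => i; rewrite -[X in measurable X]setTI; exact: oppr_measurable.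
etransitivity; last by symmetry; exact: law_box.
by apply: eq_bigr => i _; rewrite [RHS]sym.
Qed.

Lemma measurable_partial_sum n :
  measurable_fun setT (fun e : @steps R => \sum_(i < n) e i).
Proof. by apply: measurable_sum => i; exact: measurable_coord. Qed.

Let measurable_partial_sum_mfun n : {mfun @steps R >-> R} := mfun_Sub (mem_set (measurable_partial_sum n)).

(** The sum of the first n steps and the next step have a product law, and each section of x + y = 0
    is a single point, null for the law of a step. *)
Lemma law_no_tie n : abs_continuous_law (eta 0) ->
  law [set e | \sum_(i < n.+1) e i = 0] = 0%E.
Proof.
move=> ac.
pose S (e : @steps R) : R := \sum_(i < n) e i.
have mS : measurable_fun setT S by exact: measurable_partial_sum.
have mn := @measurable_coord R n.
pose f (e : @steps R) : R * R := (S e, e n).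
have mf : measurable_fun setT f by exact/measurable_fun_pair.
pose D := [set p : R * R | p.1 + p.2 = 0].
have mD : measurable D.
  have : measurable_fun setT (fun p : R * R => p.1 + p.2).
    by apply: measurable_funD; [exact: measurable_fst|exact: measurable_snd].
  by move=> /(_ measurableT [set 0] (measurable_set1 _)); rewrite setTI.
rewrite [X in law X](_ : _ = f @^-1` D); last first.
  by apply/seteqP; split => e /=; rewrite big_ord_recr.
pose muS := distribution law (measurable_partial_sum_mfun n).
transitivity ((muS \x mu)%E D).
  symmetry; apply: (@product_measure_unique _ _ _ _ R muS mu (pushforward law f)) => //.
  move=> A B mA mB.
  pose B' := [set e : @steps R | B (e 0%N)].
  have mB' : measurable B'.
    by rewrite -[X in measurable X]setTI; exact: (measurable_coord 0%N).
  have mA' : measurable (S @^-1` A : set (@steps R)).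
    by rewrite -[X in measurable X]setTI; exact: mS.
  transitivity (law ((S @^-1` A) `&` (shift n @^-1` B'))).
    congr (law _); apply/seteqP; split => e [h1 h2]; split => //; move: h2;
      by rewrite /B' /shift /= addn0.
  apply: law_split => // e e' ee; rewrite /S /= (_ : \sum_(i < n) e i = \sum_(i < n) e' i)//.
  by apply: eq_bigr => i _; exact: ee.
rewrite /product_measure1.
apply: integral0_eq => x _ /=.
have -> : xsection D x = [set - x].
  apply/seteqP; split => y; rewrite /xsection /= ?inE /= => h; first by apply/eqP; rewrite -subr_eq0 opprK addrC; apply/eqP.
  by rewrite /D /= h subrr.
by apply: (null_content_dominatesP _ _).1 ac _ _ _ => //; exact: lebesgue_measure_set1.
Qed.

End Law.

(** * Probabilities of records *)

Section PathEvents.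
Context {R : realType}.
Implicit Types (e : @steps R) (a i j k l m n r u : nat).

Definition partial_sums e n : R := \sum_(i < n) e i.

Lemma partial_sumsD e u j :
  partial_sums e (u + j) = partial_sums e u + partial_sums (shift u e) j.
Proof. by rewrite /partial_sums big_split_ord. Qed.

Lemma partial_sums0 e : partial_sums e 0 = 0.
Proof. by rewrite /partial_sums big_ord0. Qed.

Lemma stays_shift e u r : stays (partial_sums e) u r = stays (partial_sums (shift u e)) 0 r.
Proof.
by apply: eq_all => j; rewrite partial_sumsD add0n partial_sums0 gerDl.
Qed.

Lemma hits_shift e u l : hits (partial_sums e) u l = hits (partial_sums (shift u e)) 0 l.
Proof. by rewrite /hits stays_shift partial_sumsD add0n partial_sums0 ltrDl. Qed.

Lemma state_ext (x x' : nat -> R) n : (forall i, (i <= n)%N -> x i = x' i) ->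
  state x n = state x' n.
Proof.
elim: n => // n ih xx; rewrite !stateS /completed /current ih => [|i im]; last exact/xx/leqW.
by rewrite !xx// ltnW// ltnS leq_subr.
Qed.

Lemma partial_sums_ext e e' u i : (forall i, (i < u)%N -> e i = e' i) -> (i <= u)%N ->
  partial_sums e i = partial_sums e' i.
Proof. by move=> ee iu; apply: eq_bigr => j _; apply: ee; exact: leq_trans iu. Qed.

Definition event (E : @steps R -> bool) := measurable [set e | E e].

Lemma event_cst (b : bool) : event (fun=> b).
Proof.
rewrite /event; case: b; first by rewrite (_ : [set _ | _] = setT)//; apply/seteqP; split.
by rewrite (_ : [set _ | _] = set0)//; apply/seteqP; split.
Qed.

Lemma eventI (E E' : @steps R -> bool) : event E -> event E' -> event (fun e => E e && E' e).
Proof.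
move=> mE mE'; rewrite /event.
rewrite (_ : [set _ | _] = [set e | E e] `&` [set e | E' e]); first exact: measurableI.
by apply/seteqP; split => e /=; [move/andP|move=> ?; apply/andP].
Qed.

Lemma eventC (E : @steps R -> bool) : event E -> event (fun e => ~~ E e).
Proof.
move=> mE; rewrite /event (_ : [set _ | _] = ~` [set e | E e]); first exact: measurableC.
by apply/seteqP; split => e /= /negP.
Qed.

Lemma eventU (E E' : @steps R -> bool) : event E -> event E' -> event (fun e => E e || E' e).
Proof.
move=> mE mE'; rewrite /event.
rewrite (_ : [set _ | _] = [set e | E e] `|` [set e | E' e]); first exact: measurableU.
by apply/seteqP; split => e /=; [move/orP|move=> ?; apply/orP].
Qed.

Lemma event_all (s : seq nat) (E : nat -> @steps R -> bool) :
  (forall i, event (E i)) -> event (fun e => all (E^~ e) s).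
Proof.
by move=> mE; elim: s => [|i s ih] /=; [exact: event_cst|exact: eventI].
Qed.

Lemma event_has (s : seq nat) (E : nat -> @steps R -> bool) :
  (forall i, event (E i)) -> event (fun e => has (E^~ e) s).
Proof.
by move=> mE; elim: s => [|i s ih] /=; [exact: event_cst|exact: eventU].
Qed.

Lemma measurable_partial_sums n : measurable_fun [set: @steps R] (partial_sums^~ n).
Proof. by apply: measurable_sum => i; exact: measurable_coord. Qed.

Lemma event_le i j : event (fun e => partial_sums e i <= partial_sums e j).
Proof.
rewrite /event -[X in measurable X]setTI.
exact: (measurable_fun_ler (measurable_partial_sums i) (measurable_partial_sums j) measurableT (_ : measurable [set true])).
Qed.

Lemma event_lt i j : event (fun e => partial_sums e i < partial_sums e j).
Proof. by under eq_fun do rewrite ltNge; exact: (eventC (event_le j i)). Qed.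

Lemma event_stays u r : event (fun e => stays (partial_sums e) u r).
Proof. by apply: event_all => j; exact: event_le. Qed.

Lemma event_hits u l : event (fun e => hits (partial_sums e) u l).
Proof.
apply: eventI; first exact: event_cst.
by apply: eventI; [exact: event_stays|exact: event_lt].
Qed.

(** Stated for all F, so that one step of the path, which alters both components of the state, is
    absorbed into F; the current age takes finitely many values. *)
Lemma event_state n (F : seq nat -> nat -> bool) :
  event (fun e => F (completed (partial_sums e) n) (current (partial_sums e) n)).
Proof.
elim: n F => [|n ih] F; first exact: (event_cst (F [::] 0%N)).
pose H a e := [&& current (partial_sums e) n == a,
  partial_sums e (n - a)%N < partial_sums e n.+1 &
  F (rcons (completed (partial_sums e) n) a.+1) 0%N] ||
  [&& current (partial_sums e) n == a, ~~ (partial_sums e (n - a)%N < partial_sums e n.+1) &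
  F (completed (partial_sums e) n) a.+1].
have -> : (fun e => F (completed (partial_sums e) n.+1) (current (partial_sums e) n.+1)) =
    (fun e => has (H^~ e) (iota 0 n.+1)).
  apply/funext => e; rewrite /completed /current stateS -/(completed _ n) -/(current _ n).
  set a := current _ n; set c := completed _ n.
  apply/idP/hasP => [h|[b _]].
    exists a; first by rewrite mem_iota /= ltnS current_le.
    by rewrite /H -/a -/c eqxx; move: h; case: ifP => /= _ ->; rewrite ?orbT.
  rewrite /H -/a -/c; case: eqP => //= <-.
  by case: ifP => //= _; rewrite ?orbF.
apply: event_has => a; apply: eventU.
  under eq_fun do rewrite andbCA.
  apply: eventI; first exact: event_lt.
  exact: (ih (fun c b => (b == a) && F (rcons c a.+1) 0%N)).
under eq_fun do rewrite andbCA.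
apply: eventI; first exact: (eventC (event_lt _ _)).
exact: (ih (fun c b => (b == a) && F c a.+1)).
Qed.

Lemma event_record n (F : seq nat -> bool) :
  event (fun e => (current (partial_sums e) n == 0%N) && F (completed (partial_sums e) n)).
Proof. exact: (event_state n (fun c b => (b == 0%N) && F c)). Qed.

Lemma event_shift u (E : @steps R -> bool) : event E -> event (fun e => E (shift u e)).
Proof.
move=> mE; rewrite /event -[X in measurable X]setTI.
exact: (measurable_shift u measurableT mE).
Qed.

End PathEvents.

(** * Records as a renewal process *)

Section RecordProbabilities.
Context {d : measure_display} {T : measurableType d} {R : realType}.
Variables (P : probability T R) (eta : nat -> {RV P >-> R}).
Hypotheses (eta_indep : mutually_independent eta) (eta_ident : identically_distributed eta).
Hypotheses (eta_symm : symmetric_law (eta 0)) (eta_ac : abs_continuous_law (eta 0)).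
Implicit Types (E : @steps R -> bool) (e : @steps R) (F : seq nat -> bool) (a i j k l m n r u : nat).

Let L := law eta.

Definition pr E : R := fine (L [set e | E e]).

Lemma prE E : event E -> L [set e | E e] = (pr E)%:E.
Proof. by move=> mE; rewrite fineK// fin_num_measure. Qed.

Lemma pr_ge0 E : 0 <= pr E. Proof. by rewrite fine_ge0. Qed.

Lemma pr_true : pr (fun=> true) = 1.
Proof.
rewrite /pr (_ : [set _ | _] = setT) ?probability_setT//.
by apply/seteqP; split.
Qed.

Lemma eq_pr E E' : E =1 E' -> pr E = pr E'. Proof. by move=> /funext ->. Qed.

Lemma pr_false : pr (fun=> false) = 0.
Proof.
rewrite /pr (_ : [set _ | _] = set0) ?measure0//.
by apply/seteqP; split.
Qed.

Lemma prD E E' : event E -> event E' -> (forall e, E e -> ~~ E' e) ->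
  pr (fun e => E e || E' e) = pr E + pr E'.
Proof.
move=> mE mE' EE'; apply: EFin_inj; rewrite EFinD -!prE//; last exact: eventU.
rewrite -measureU//; first by congr (L _); apply/seteqP; split => e /= /orP.
by apply/seteqP; split => // e /= [/EE' /negP h /h].
Qed.

Lemma pr_mono E E' : event E -> event E' -> (forall e, E e -> E' e) -> pr E <= pr E'.
Proof.
move=> mE mE' EE'; rewrite -lee_fin -!prE//; by apply: le_measure; rewrite ?inE.
Qed.

Lemma pr_partition E (g : @steps R -> nat) m :
  (forall a, event (fun e => (g e == a) && E e)) -> (forall e, E e -> (g e < m)%N) ->
  pr E = \sum_(a < m) pr (fun e => (g e == a) && E e).
Proof.
move=> mg gm.
rewrite (eq_pr (E' := fun e => (g e < m)%N && E e)); last first.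
  by move=> e; case: (boolP (E e)) => [/gm ->|_]; rewrite ?andbF.
have mlt r : event (fun e => (g e < r)%N && E e).
  have -> : (fun e => (g e < r)%N && E e) = (fun e => has (fun a => (g e == a) && E e) (iota 0 r)).
    apply/funext => e; apply/andP/hasP => [[gr Ee]|[a]].
      by exists (g e); rewrite ?mem_iota// eqxx.
    by rewrite mem_iota /= => ar /andP[/eqP-> ->].
  exact: event_has.
elim: m {gm} => [|m ih]; first by rewrite big_ord0 -[RHS]pr_false; apply: eq_pr.
rewrite big_ord_recr /= -ih -prD//.
  by apply: eq_pr => e; rewrite ltnS leq_eqVlt andb_orl orbC.
by move=> e /andP[ge _]; rewrite negb_and neq_ltn ge.
Qed.

Lemma pr_split F u E : event E ->
  pr (fun e => [&& current (partial_sums e) u == 0%N, F (completed (partial_sums e) u)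
    & E (shift u e)]) =
  pr (fun e => (current (partial_sums e) u == 0%N) && F (completed (partial_sums e) u)) * pr E.
Proof.
move=> mE; apply: EFin_inj; rewrite EFinM -!prE//; last 2 first.
- exact: event_record.
- under eq_fun do rewrite andbA.
  by apply: eventI; [exact: event_record|exact: event_shift].
have dep : depends_on_first u [set e : @steps R | (current (partial_sums e) u == 0%N) &&
    F (completed (partial_sums e) u)].
  move=> e e' ee /=; rewrite /current /completed (@state_ext _ _ (partial_sums e'))//.
  by move=> i iu; exact: (partial_sums_ext ee iu).
have := law_split eta_indep eta_ident (event_record u F) mE dep.
rewrite -/L => <-.
congr (L _); apply/seteqP; split => e /=; first by rewrite andbA => /andP.
by move=> ?; rewrite andbA; apply/andP.
Qed.

Definition record_pr F u : R :=
  pr (fun e => (current (partial_sums e) u == 0%N) && F (completed (partial_sums e) u)).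

Definition stay_pr r : R := pr (fun e => stays (partial_sums e) 0 r).

Lemma pr_stays F u r :
  pr (fun e => [&& current (partial_sums e) u == 0%N, F (completed (partial_sums e) u)
    & stays (partial_sums e) u r]) = record_pr F u * stay_pr r.
Proof.
under eq_fun do rewrite stays_shift.
exact: (pr_split _ _ (event_stays 0 r)).
Qed.

Lemma pr_state n (F : seq nat -> nat -> bool) :
  pr (fun e => F (completed (partial_sums e) n) (current (partial_sums e) n)) =
  \sum_(a < n.+1) record_pr (F^~ a) (n - a) * stay_pr a.
Proof.
rewrite (pr_partition (g := fun e => current (partial_sums e) n) (m := n.+1)); last 2 first.
- by move=> a; exact: (event_state n (fun c b => (b == a) && F c b)).
- by move=> e _; rewrite ltnS current_le.
apply: eq_bigr => a _; rewrite -pr_stays; apply: eq_pr => e.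
by rewrite event_split// -ltnS.
Qed.

Lemma hit_pr a : pr (fun e => hits (partial_sums e) 0 a.+1) = stay_pr a - stay_pr a.+1.
Proof.
apply/eqP; rewrite eq_sym subr_eq; apply/eqP.
rewrite /stay_pr -prD; [|exact: event_hits|exact: event_stays|]; last first.
  by move=> e; rewrite hitsS => /andP[].
by apply: eq_pr => e; rewrite hitsS staysS; case: stays => //=; case: (_ <= _).
Qed.

Lemma record_prS F n : record_pr F n.+1 =
  \sum_(a < n.+1) record_pr (fun c => F (rcons c a.+1)) (n - a) * (stay_pr a - stay_pr a.+1).
Proof.
pose g e := current (partial_sums e) n.
pose E a e := [&& current (partial_sums e) (n - a) == 0%N,
  F (rcons (completed (partial_sums e) (n - a)) a.+1) & hits (partial_sums e) (n - a) a.+1].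
have EE e a : (a <= n)%N -> E a e =
  (g e == a) && ((current (partial_sums e) n.+1 == 0%N) && F (completed (partial_sums e) n.+1)).
  by move=> an; rewrite record_split /E -record_split_age.
rewrite /record_pr (pr_partition (g := g) (m := n.+1)); last 2 first.
- move=> a; have [an|na] := leqP a n.
    under eq_fun do rewrite -EE//.
    rewrite /E; under eq_fun do rewrite andbA.
    apply: eventI; last exact: event_hits.
    exact: (event_record _ (fun c => F (rcons c a.+1))).
  rewrite (_ : (fun _ => _) = (fun=> false)); first exact: event_cst.
  apply/funext => e; have := current_le (partial_sums e) n; rewrite -/(g e) => gn.
  by rewrite ltn_eqF// (leq_ltn_trans gn).
- by move=> e _; rewrite ltnS current_le.
apply: eq_bigr => a _; rewrite -hit_pr -(pr_split (fun c => F (rcons c a.+1)) (n - a) (event_hits 0 a.+1)).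
apply: eq_pr => e; rewrite -EE; last by rewrite -ltnS.
by rewrite /E hits_shift.
Qed.

Let reverse_sums e n j : (j <= n)%N ->
  partial_sums (reverse n e) j = partial_sums e n - partial_sums e (n - j).
Proof.
move=> jn; apply/eqP; rewrite eq_sym subr_eq addrC; apply/eqP.
rewrite -[in LHS](subnK jn) partial_sumsD; congr (_ + _).
rewrite /partial_sums [LHS](reindex_inj rev_ord_inj) /=.
apply: eq_bigr => i _; rewrite /reverse (leq_trans (ltn_ord i) jn) /shift.
by congr (e _); have := ltn_ord i; lia.
Qed.

Lemma record_prE n : record_pr xpredT n = stay_pr n.
Proof.
(* Reversal turns a strict maximum at n into positivity of all partial sums ([A]), a change of signs
   into negativity ([B]); [stays] is the version of [B] that allows ties. *)
pose A := fun e => all (fun j => partial_sums e 0 < partial_sums e j) (iota 1 n).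
pose B := fun e => all (fun j => partial_sums e j < partial_sums e 0) (iota 1 n).
have mA : event A by apply: event_all => j; exact: event_lt.
have mB : event B by apply: event_all => j; exact: event_lt.
transitivity (pr A).
  rewrite /pr /L -[in RHS](law_reverse eta_indep eta_ident n mA); congr (fine (law _ _)).
  apply/seteqP; split => e /=; rewrite andbT record_max.
    move=> /allP h; apply/allP => j; rewrite mem_iota add1n ltnS => /andP[j1 jn].
    rewrite !reverse_sums// subn0 subrr subr_gt0; apply: h; rewrite mem_iota /=; lia.
  move=> /allP h; apply/allP => i; rewrite mem_iota /= => i_n.
  have := h (n - i)%N; rewrite mem_iota => /(_ _)/wrap[]; first by lia.
  by rewrite !reverse_sums ?leq_subr// subn0 subrr subr_gt0 subKn ?(ltnW i_n).
transitivity (pr B).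
  rewrite /pr /L -[in LHS](law_opp eta_indep eta_ident eta_symm mA); congr (fine (law _ _)).
  have oppS e j : partial_sums (opp_steps e) j = - partial_sums e j.
    by rewrite /partial_sums -sumrN.
  by apply/seteqP; split => e /allP h; apply/allP => j /h; rewrite !oppS ltrN2.
apply/eqP; rewrite eq_le; apply/andP; split.
  apply: pr_mono => //; first exact: event_stays.
  move=> e /allP h; apply/staysP => j jn; rewrite add0n.
  by case: (posnP j) => [->//|j0]; apply/ltW/h; rewrite mem_iota add1n ltnS j0.
(* Where [stays] and [B] differ, some partial sum vanishes, which is a null event. *)
pose N := [set e : @steps R | stays (partial_sums e) 0 n] `\` [set e | B e].
have mN : measurable N by apply: measurableD => //; exact: event_stays.
have N0 : L N = 0%E.
  apply: measure_negligible => //.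
  apply: (@negligibleS _ _ _ _ (\bigcup_i [set e : @steps R | \sum_(j < i.+1) e j = 0])); last first.
    apply: negligible_bigcup => i; apply/negligibleP; last exact: law_no_tie.
    rewrite -[X in measurable X]setTI.
    exact: (measurable_partial_sums i.+1 measurableT (measurable_set1 0)).
  move=> e [/staysP st nB]; apply: contrapT => h; apply: nB; apply/allP => j.
  rewrite mem_iota add1n ltnS => /andP[j0 jn].
  rewrite lt_neqAle; have := st j jn; rewrite add0n => ->; rewrite andbT.
  apply/eqP => e0; apply: h; exists j.-1 => //=; rewrite prednK//.
  by move: e0; rewrite partial_sums0.
rewrite -lee_fin -!prE//; last exact: event_stays.
rewrite -[leRHS]adde0 -N0 -measureU//; last first.
  by apply/seteqP; split => // e [/= h1 [_ /(_ h1)]].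
apply: le_measure; rewrite ?inE//; [exact: event_stays|exact: measurableU|].
by move=> e /= h; case: (boolP (B e)) => [|/negP nB]; [left|right].
Qed.

Lemma stay_prE : stay_pr =1 qs.
Proof.
apply: conv1_unique; first exact: pr_ge0.
move=> n; rewrite -[RHS]pr_true (pr_state n (fun _ _ => true)).
by apply: eq_bigr => a _; rewrite record_prE mulrC.
Qed.

Lemma record_pr_conv F n : record_pr F n.+1 =
  \sum_(a < n.+1) record_pr (fun c => F (rcons c a.+1)) (n - a) * fs a.+1.
Proof. by rewrite record_prS; apply: eq_bigr => a _; rewrite !stay_prE. Qed.

Lemma hits_pr l : pr (fun e => hits (partial_sums e) 0 l) = fs l.
Proof.
case: l => [|l]; last by rewrite hit_pr !stay_prE.
by rewrite -[RHS]pr_false; apply: eq_pr.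
Qed.

Definition tails b k n := record_pr (fun c => k <= count (ltn b) c)%N n.

Lemma tails_weights : tail_weights tails.
Proof.
split=> [b n|b k n].
  by rewrite /tails record_prE stay_prE.
case: n => [|n].
  rewrite big_ord1 /= mul0r -[RHS]pr_false; apply: eq_pr => e.
  by rewrite /completed /current.
rewrite big_ord_recl /= mul0r add0r /tails record_pr_conv; apply: eq_bigr => a _.
rewrite mulrC subSS; congr (_ * _); apply: eq_pr => e; congr (_ && _).
rewrite /= -cats1 count_cat /= addn0 /bump /= add1n.
by have [ab|ba] := leqP a.+1 b; rewrite ?(ltnNge b) ?ab ?addn0// addn1 ltnS.
Qed.

Lemma record_pr_exact b k n :
  record_pr (fun c => count (ltn b) c == k)%N n = exact_weights tails b k n.
Proof.
apply/eqP; rewrite eq_sym subr_eq; apply/eqP.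
rewrite /tails /record_pr -(prD (event_record n (fun c => count (ltn b) c == k)%N)
  (event_record n (fun c => k < count (ltn b) c)%N)); last first.
  by move=> e /andP[_ /eqP ->]; rewrite negb_and ltnn orbT.
apply: eq_pr => e; rewrite -andb_orr leq_eqVlt; congr (_ && (_ || _)).
by rewrite eq_sym.
Qed.

End RecordProbabilities.

(** * Asymptotics of the Laplace transforms *)

Section Equivalents.
Context {R : realType}.
Implicit Types (s z : R) (u w : nat -> R) (n : nat).

Lemma equiv_at0_const (F : R -> \bar R) (w : R -> R) (C : \bar R) :
  (0 < C < +oo)%E -> (forall s, 0 < s -> 0 < w s) ->
  ((w s)%:E * F s)%E @[s --> (0 : R)^'+] --> C ->
  equiv_at0 F (fun s => (C / (w s)%:E)%E).
Proof.
case: C => [c| |]; rewrite ?ltxx ?andbF// lte_fin ltry andbT => c0 w0 cv.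
have : ((w s)%:E * F s * (c^-1)%:E)%E @[s --> (0 : R)^'+] --> (c%:E * (c^-1)%:E)%E.
  by apply: cvgeZr.
rewrite -EFinM divff ?gt_eqF//; apply: cvg_trans; apply: near_eq_cvg; near=> s.
have s0 : 0 < s by [].
have ws : w s != 0 by rewrite gt_eqF// w0.
have cw : c / w s != 0 by rewrite mulf_neq0 ?invr_neq0// gt_eqF.
rewrite inver (negPf ws) -EFinM inver (negPf cw) invf_div.
by rewrite EFinM muleA [(F s * _)%E]muleC.
Unshelve. all: by end_near. Qed.

Lemma gf_partial_sums u z : 0 <= z -> z < 1 -> (forall n, 0 <= u n) ->
  gf (fun n => \sum_(i < n) u i) z = ((z / (1 - z))%:E * gf u z)%E.
Proof.
move=> z0 z1 u0; pose one n : R := if n is _.+1 then 1 else 0.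
have one0 n : 0 <= one n by case: n.
have gone : gf one z = (z / (1 - z))%:E.
  by rewrite gf_recl//= add0e gf1// -EFinM.
rewrite muleC -gone -gf_conv//; last by rewrite gone.
congr gf; apply/funext => n; rewrite /conv big_ord_recr /= subnn mulr0 addr0.
by apply: eq_bigr => i _; rewrite -[(n - i)%N]prednK ?mulr1// subn_gt0.
Qed.

Lemma gf_id z : 0 <= z -> z < 1 -> gf (fun n => n%:R) z = (z / (1 - z) / (1 - z))%:E.
Proof.
move=> z0 z1; rewrite (_ : (fun n => n%:R) = (fun n => \sum_(i < n) 1 : R)); last first.
  by apply/funext => n; rewrite sumr_const card_ord.
by rewrite (@gf_partial_sums (fun=> 1) z)// gf1// -EFinM.
Qed.

Lemma cvg_s_one_minus_zs : s / (1 - zs s) @[s --> (0 : R)^'+] --> (1 : R).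
Proof.
have h : ((1 - zs s) / s)^-1 @[s --> (0 : R)^'+] --> (1 : R)^-1.
  by apply: cvgV; [exact: oner_neq0|exact: cvg_one_minus_zs].
rewrite invr1 in h; apply: cvg_trans h; apply: near_eq_cvg; near=> s.
by rewrite invf_div.
Unshelve. all: by end_near. Qed.

Lemma cvg_zs : zs s @[s --> (0 : R)^'+] --> (1 : R).
Proof.
have h : 1 - s * ((1 - zs s) / s) @[s --> (0 : R)^'+] --> (1 - 0 * 1 : R).
  apply: cvgB; first exact: cvg_cst.
  apply: cvgM; last exact: cvg_one_minus_zs.
  exact: cvg_at_right_filter.
rewrite mul0r subr0 in h; apply: cvg_trans h; apply: near_eq_cvg; near=> s.
by field; rewrite gt_eqF.
Unshelve. all: by end_near. Qed.

Lemma cvg_sqr_gf_id : s ^+ 2 * fine (gf (fun n => n%:R) (zs s)) @[s --> (0 : R)^'+] --> (1 : R).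
Proof.
have h := cvgM cvg_zs (cvgM cvg_s_one_minus_zs cvg_s_one_minus_zs).
rewrite !mulr1 in h; apply: cvg_trans (h _ _); apply: near_eq_cvg; near=> s.
have s0 : 0 < s by [].
rewrite gf_id ?zs_lt1//=; last exact/ltW/zs_gt0.
by rewrite expr2; ring.
Unshelve. all: by end_near. Qed.

Lemma transformable_id : transformable (fun n => n%:R : R).
Proof.
split=> // s s0 s1; rewrite gf_id ?ltry ?zs_lt1//; exact/ltW/zs_gt0.
Qed.

Lemma cvg_scaled_pinfty (g phi : R -> R) (B : R) : 0 < B ->
  (\forall s \near (0 : R)^'+, 0 < phi s) -> phi s @[s --> (0 : R)^'+] --> (0 : R) ->
  phi s * g s @[s --> (0 : R)^'+] --> B -> g s @[s --> (0 : R)^'+] --> +oo.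
Proof.
move=> B0 phi0 cphi cg; apply/cvgryPge => A.
have c : phi s * g s - A * phi s @[s --> (0 : R)^'+] --> B - A * 0.
  by apply: cvgB => //; apply: cvgM => //; exact: cvg_cst.
rewrite mulr0 subr0 in c; near=> s.
have s0 : 0 < phi s by near: s.
have : 0 < phi s * g s - A * phi s by near: s; exact: (cvgr_gt B c).
by rewrite mulrC -mulrBl pmulr_lgt0// subr_gt0 => /ltW.
Unshelve. all: by end_near. Qed.

(** Serves the conditional limits: an assumed limit l of u / w is also that of the quotient of the
    transforms, which is known after multiplication by [phi]. *)
Lemma abelian_limit u w (l A B : R) (phi : R -> R) : (forall n, 0 <= u n) -> 0 <= l ->
  transformable w -> 0 < B -> (\forall s \near (0 : R)^'+, 0 < phi s) ->
  phi s @[s --> (0 : R)^'+] --> (0 : R) ->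
  phi s * fine (gf w (zs s)) @[s --> (0 : R)^'+] --> B ->
  phi s * fine (gf u (zs s)) @[s --> (0 : R)^'+] --> A ->
  (forall e : R, 0 < e -> \forall n \near \oo, `|u n - l * w n| <= e * w n) ->
  l = A / B.
Proof.
move=> u0 l0 tw B0 phi0 cphi cw cu H.
have woo := cvg_scaled_pinfty B0 phi0 cphi cw.
have [_ c] := abelian u0 l0 tw woo H.
have cl : phi s * fine (gf u (zs s)) @[s --> (0 : R)^'+] --> l * B.
  apply: cvg_trans (cvgM c cw); apply: near_eq_cvg; near=> s.
  have s0 : 0 < s by [].
  have w0 : 0 < fine (gf w (zs s)) by near: s; apply: (cvgryPgt _).1.
  by rewrite /=; field; rewrite gt_eqF.
have -> : A = l * B by apply: (cvg_unique _ cu cl) => //; exact: norm_hausdorff.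
by rewrite mulfK// gt_eqF.
Unshelve. all: by end_near. Qed.

Lemma near_ratio u w (l : R) : (forall n, 0 <= w n) ->
  (\forall n \near \oo, 0 < w n) -> u n / w n @[n --> \oo] --> l ->
  forall e : R, 0 < e -> \forall n \near \oo, `|u n - l * w n| <= e * w n.
Proof.
move=> w0 wp cv e e0; near=> n.
have wn : 0 < w n by near: n.
have : `|l - u n / w n| <= e by near: n; apply: cvgr_dist_le.
rewrite -(ler_pM2r wn) -[X in _ * X <= _]gtr0_norm// -normrM mulrBl divfK ?gt_eqF//.
by rewrite distrC.
Unshelve. all: by end_near. Qed.

Lemma cvg_id_right : (fun s : R => s) @ (0 : R)^'+ --> (0 : R).
Proof. exact: cvg_at_right_filter. Qed.

Lemma cvg_sqr_right : s ^+ 2 @[s --> (0 : R)^'+] --> (0 : R).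
Proof.
rewrite -[X in _ --> X](mulr0 (0 : R)).
by under eq_fun do rewrite expr2; apply: cvgM; exact: cvg_id_right.
Qed.

End Equivalents.

(** * Explicit series for the transforms *)

Section LaplaceIdentities.
Context {R : realType}.
Variable T : nat -> nat -> nat -> R.
Hypothesis Tw : tail_weights T.
Variable z : R.
Hypotheses (z0 : 0 <= z) (z1 : z < 1).
Implicit Types (a i j k l m n : nat).

(** At a record time n, l is the age just completed and exactly j earlier ages exceed it; a
    convolution with [qs] then allows for the current age. *)
Definition last_age j n : R := \sum_(l < n.+1) fs l * exact_weights T l j (n - l).

Lemma last_age_ge0 j n : 0 <= last_age j n.
Proof. by apply: sumr_ge0 => l _; rewrite mulr_ge0// exact_ge0. Qed.

Lemma last_weight_ge0 j n : 0 <= last_weight T j n.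
Proof. by apply: sumr_ge0 => l _; rewrite mulr_ge0// exact_ge0. Qed.

Lemma gf_last_weight j : gf (last_weight T j) z = (\sum_(0 <= a <oo) (p1_term z j a)%:E)%E.
Proof.
rewrite (@gf_conv2 R z z0 (fun a => exact_weights T a j) qs)//; last by move=> *; exact: exact_ge0.
by apply: eq_eseriesr => a _; rewrite gf_exact// -EFinM mulrA.
Qed.

Lemma gf_last_age j : gf (last_age j) z = (\sum_(0 <= l <oo) (p3_term z j l)%:E)%E.
Proof.
rewrite (@gf_conv2 R z z0 (fun l => exact_weights T l j) fs)//; last by move=> *; exact: exact_ge0.
by apply: eq_eseriesr => a _; rewrite gf_exact// -EFinM mulrA.
Qed.

Lemma gf_conv_last_age j : gf (conv qs (last_age j)) z =
  ((Dinf z)^-1%:E * \sum_(0 <= l <oo) (p3_term z j l)%:E)%E.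
Proof.
have l0 n : 0 <= last_age j n by exact: last_age_ge0.
have l1 n : last_age j n <= 1.
  apply: le_trans (_ : conv fs qs n <= _).
    by apply: ler_sum => l _; rewrite ler_wpM2l// exact_le.
  case: n => [|n]; last by rewrite renewal qs_le1.
  by rewrite /conv big_ord1 /= mul0r.
by rewrite gf_conv ?gf_qs ?gf_last_age// -gf_last_age gf_fin.
Qed.

(* The summand is the probability that the current age is [a] and that the last
   record will have age [l > a], exactly [j] of the previous ages exceeding [l]. *)
Definition overshoot j n : \bar R :=
  (\sum_(a < n.+1) \sum_(0 <= l <oo)
    (if (a < l)%N then fs l * exact_weights T l j (n - a) else 0)%:E)%E.

Lemma geometric_sum l : \sum_(a < l) z ^+ a = (1 - z ^+ l) / (1 - z).
Proof.
have z1' : 1 - z != 0 by rewrite gt_eqF// subr_gt0.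
apply: (mulIf z1'); rewrite divfK// -[RHS]opprB subrX1 -mulNr opprB mulrC.
by congr (_ * _).
Qed.

(** All terms are nonnegative, so the triple sum can be rearranged; summing z^a over the current
    ages a < l gives the factor (1 - z^l) / (1 - z). *)
Lemma gf_overshoot j : (\sum_(0 <= n <oo) overshoot j n * (z ^+ n)%:E =
  \sum_(0 <= l <oo) (p2_term z j l)%:E)%E.
Proof.
pose c a l m : R := if (a < l)%N then fs l * exact_weights T l j m else 0.
have c0 a l m : 0 <= c a l m.
  by rewrite /c; case: ifP => // _; rewrite mulr_ge0// exact_ge0.
have zc0 a l m : (0 <= (c a l m * (z ^+ a * z ^+ m))%:E)%E.
  by rewrite lee_fin !mulr_ge0 ?exprn_ge0.
transitivity (\sum_(0 <= n <oo) \sum_(a < n.+1)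
    (\sum_(0 <= l <oo) (c a l (n - a)%N * (z ^+ a * z ^+ (n - a)))%:E))%E.
  apply: eq_eseriesr => n _; rewrite muleC ge0_sume_distrr; last first.
    by move=> a _; apply: nneseries_ge0 => l _ _; rewrite lee_fin c0.
  apply: eq_bigr => a _; rewrite -nneseriesZl; last by move=> l _; rewrite lee_fin c0.
  apply: eq_eseriesr => l _; rewrite -EFinM -exprD subnKC; last by rewrite -ltnS.
  by rewrite mulrC.
rewrite (nneseries_diag (w := fun a m => (\sum_(0 <= l <oo) (c a l m * (z ^+ a * z ^+ m))%:E)%E)); last first.
  by move=> a m; apply: nneseries_ge0.
transitivity (\sum_(0 <= a <oo) \sum_(0 <= l <oo) \sum_(0 <= m <oo) (c a l m * (z ^+ a * z ^+ m))%:E)%E.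
  by apply: eq_eseriesr => a _; rewrite nneseries_interchange.
rewrite nneseries_interchange; last by move=> a l; apply: nneseries_ge0.
apply: eq_eseriesr => l _.
transitivity (\sum_(0 <= a <oo) (if (a < l)%N then
    fs l * z ^+ a * (Gn z l ^+ j / Dn z l ^+ j.+1) else 0)%:E)%E.
  apply: eq_eseriesr => a _; rewrite /c; case: ltnP => _; last first.
    by apply: eseries0 => m _ _; rewrite mul0r.
  rewrite EFinM -(gf_exact Tw z0 z1) /gf -nneseriesZl; last first.
    by move=> m _; rewrite lee_fin mulr_ge0 ?exprn_ge0// exact_ge0.
  by apply: eq_eseriesr => m _; rewrite -EFinM; congr EFin; ring.
rewrite (finite_nneseries (N := l)); last by move=> a la; rewrite ltnNge la.
congr EFin; rewrite /p2_term.
under eq_bigr => a _ do rewrite ltn_ord mulrAC mulrC.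
by rewrite -mulr_suml geometric_sum; ring.
Qed.

Definition mean3 k n : \bar R := (\sum_(0 <= j <oo) (conv qs (T j k) n)%:E)%E.

(** Two disjoint ways for k ages of the second sequence to exceed j: k completed ages do, or exactly
    k - 1 do and the last record, of current age a, lasts more than j as well, that is, through
    max(a, j) steps. *)
Definition level2 k j n : R := conv qs (T j k) n +
  conv (fun a => qs (maxn a j)) (exact_weights T j k.-1) n.

Definition mean2 k n : \bar R := (\sum_(0 <= j <oo) (level2 k j n)%:E)%E.

Lemma conv_ge0 (u v : nat -> R) n : (forall i, 0 <= u i) -> (forall i, 0 <= v i) ->
  0 <= conv u v n.
Proof. by move=> u0 v0; apply: sumr_ge0 => i _; rewrite mulr_ge0. Qed.

Lemma gf_levels (u : nat -> nat -> R) : (forall j n, 0 <= u j n) ->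
  (\sum_(0 <= n <oo) (\sum_(0 <= j <oo) (u j n)%:E) * (z ^+ n)%:E =
   \sum_(0 <= j <oo) gf (u j) z)%E.
Proof.
move=> u0.
have uz j n : (0 <= (u j n * z ^+ n)%:E)%E by rewrite lee_fin mulr_ge0 ?exprn_ge0.
transitivity (\sum_(0 <= n <oo) \sum_(0 <= j <oo) (u j n * z ^+ n)%:E)%E.
  apply: eq_eseriesr => n _; rewrite muleC -nneseriesZl; last by move=> j _; rewrite lee_fin.
  by apply: eq_eseriesr => j _; rewrite -EFinM mulrC.
by rewrite nneseries_interchange.
Qed.

Let Dinf2 : (Dinf z)^-1 * (Dinf z)^-1 = (1 - z)^-1.
Proof. by rewrite -invfM -expr2 Dinf_sqr. Qed.

Lemma gf_mean3 k : (\sum_(0 <= n <oo) mean3 k n * (z ^+ n)%:E =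
  (1 - z)^-1%:E * \sum_(0 <= j <oo) (C3_term z k j)%:E)%E.
Proof.
have C0 j : 0 <= C3_term z k j.
  by rewrite /C3_term divr_ge0 ?exprn_ge0 ?Gn_ge0// ltW// Dn_gt0.
rewrite /mean3 gf_levels => [|j n]; last by apply: conv_ge0 => // i; exact: tail_ge0.
rewrite -nneseriesZl; last by move=> j _; rewrite lee_fin.
apply: eq_eseriesr => j _.
have t0 n : 0 <= T j k n by exact: tail_ge0.
have tf : gf (T j k) z \is a fin_num by rewrite gf_tail.
rewrite gf_conv//.
rewrite gf_qs// gf_tail// -!EFinM; congr EFin.
by rewrite /C3_term -Dinf2 expr_div_n; rewrite /Dinf; ring.
Qed.

(** The sequence differs from [qs] in finitely many terms, and Q minus the partial sum is expressed
    through G_j by [Dn_abel]. *)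
Lemma gf_qs_max j : gf (fun a => qs (maxn a j)) z = ((qs j - Gn z j) / (1 - z))%:E.
Proof.
have z1' : 1 - z != 0 by rewrite gt_eqF// subr_gt0.
have e a : qs (maxn a j) = qs a - (if (a < j)%N then qs a - qs j else 0) :> R.
  case: ltnP => aj.
    by ring.
  by rewrite subr0.
pose v a : R := if (a < j)%N then qs a - qs j else 0.
have v0 a : 0 <= v a by rewrite /v; case: ltnP => // aj; rewrite subr_ge0 qs_nonincr// ltnW.
have gv : gf v z = (\sum_(a < j) (qs a - qs j) * z ^+ a)%:E.
  rewrite /gf (finite_nneseries (N := j)).
    by congr EFin; apply: eq_bigr => a _; rewrite /v ltn_ord.
  by move=> a ja; rewrite /v ltnNge ja mul0r.
have : gf qs z = (gf (fun a => qs (maxn a j)) z + gf v z)%E.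
  rewrite -gfD//; congr gf; apply/funext => a; rewrite e /v; ring.
rewrite gf_qs// gv => E.
have {}E : gf (fun a => qs (maxn a j)) z = ((Num.sqrt (1 - z))^-1 - \sum_(a < j) (qs a - qs j) * z ^+ a)%:E.
  by rewrite EFinB E addeK.
rewrite E; congr EFin.
have -> : \sum_(a < j) (qs a - qs j) * z ^+ a =
    \sum_(a < j) qs a * z ^+ a - qs j * ((1 - z ^+ j) / (1 - z)).
  by rewrite -geometric_sum mulr_sumr -sumrB; apply: eq_bigr => a _; rewrite mulrBl.
have D0 := Dinf_gt0 z1.
have -> : (Num.sqrt (1 - z))^-1 = Dinf z / (1 - z).
  by rewrite -/(Dinf z) -Dinf2 mulrA divff ?mul1r// gt_eqF.
by rewrite /Gn Dn_abel; field.
Qed.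

Lemma level2_ge0 k j n : 0 <= level2 k j n.
Proof.
rewrite addr_ge0// conv_ge0// => i; first exact: tail_ge0.
exact: exact_ge0.
Qed.

(** The contributions G_j^k of the two parts of [level2] cancel, leaving q(j) G_j^(k-1) / D_j^k. *)
Lemma gf_mean2 k : (0 < k)%N -> (\sum_(0 <= n <oo) mean2 k n * (z ^+ n)%:E =
  (1 - z)^-1%:E * \sum_(0 <= j <oo) (C2_term z k.-1 j)%:E)%E.
Proof.
move=> k0.
have C0 j : 0 <= C2_term z k.-1 j.
  by rewrite /C2_term divr_ge0 ?mulr_ge0 ?exprn_ge0 ?Gn_ge0// ltW// Dn_gt0.
rewrite /mean2 gf_levels => [|j n]; last exact: level2_ge0.
rewrite -nneseriesZl; last by move=> j _; rewrite lee_fin.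
apply: eq_eseriesr => j _; rewrite /level2 gfD//; last 2 first.
- by move=> n; apply: conv_ge0 => // i; exact: tail_ge0.
- by move=> n; apply: conv_ge0 => // i; exact: exact_ge0.
have t0 n : 0 <= T j k n by exact: tail_ge0.
have e0 n : 0 <= exact_weights T j k.-1 n by exact: exact_ge0.
have tf : gf (T j k) z \is a fin_num by rewrite gf_tail.
have ef : gf (exact_weights T j k.-1) z \is a fin_num by rewrite gf_exact.
rewrite !gf_conv//.
rewrite gf_qs// gf_tail// gf_exact// gf_qs_max -!EFinM -EFinD; congr EFin.
have D0 := Dinf_gt0 z1; have Dj := Dn_gt0 z0 z1 j.
have z1' : 1 - z != 0 by rewrite gt_eqF// subr_gt0.
rewrite -/(Dinf z) mulrA Dinf2 /C2_term expr_div_n -(prednK k0) /= [Gn z j ^+ _.+1]exprS.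
by field; rewrite gt_eqF ?exprn_gt0.
Qed.

End LaplaceIdentities.

(** * Asymptotics of the six sequences *)

Section Conclusions.
Context {R : realType}.
Variable T : nat -> nat -> nat -> R.
Hypothesis Tw : tail_weights T.
Implicit Types (s z : R) (u : nat -> R) (j k n : nat).

Let zle s : 0 <= zs s. Proof. exact/ltW/zs_gt0. Qed.

Lemma laplace_zs (v : nat -> \bar R) s :
  laplace v s = (\sum_(0 <= n <oo) v n * (zs s ^+ n)%:E)%E.
Proof. by apply: eq_eseriesr => n _; rewrite zsX. Qed.

Lemma laplace_gf u s : laplace (fun n => (u n)%:E) s = gf u (zs s).
Proof. by rewrite laplaceE. Qed.

Lemma lift_cvg (I : Type) (F : set_system I) {FF : Filter F} (f : I -> R) (l : R) :
  f x @[x --> F] --> l -> (f x)%:E @[x --> F] --> l%:E.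
Proof. by move=> cf; apply: cvg_EFin => //; exact: nearW. Qed.

Lemma pos_finite (C : \bar R) : (0 < C < +oo)%E -> exists2 c, 0 < c & C = c%:E.
Proof. by case: C => [c| |]; rewrite ?ltxx ?andbF// lte_fin => /andP[c0 _]; exists c. Qed.

Lemma scaled_laplace (w F G : R -> \bar R) (C : \bar R) :
  (forall s, 0 < s -> s < 1 -> F s = G s) ->
  (w s * G s)%E @[s --> (0 : R)^'+] --> C -> (w s * F s)%E @[s --> (0 : R)^'+] --> C.
Proof.
move=> FG; apply: cvg_trans; apply: near_eq_cvg; near=> s.
by rewrite FG//; near: s; exact: nbhs_right_lt.
Unshelve. all: by end_near. Qed.

Lemma real_scaled u (F : R -> \bar R) (w : R -> R) (c : R) : (forall n, 0 <= u n) ->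
  (forall s, 0 < s -> s < 1 -> gf u (zs s) = F s) ->
  (forall s, 0 < s -> s < 1 -> (F s < +oo)%E) ->
  ((w s)%:E * F s)%E @[s --> (0 : R)^'+] --> c%:E ->
  transformable u /\ w s * fine (gf u (zs s)) @[s --> (0 : R)^'+] --> c.
Proof.
move=> u0 uF Foo cv.
have tu : transformable u by split => // s s0 s1; rewrite uF// Foo.
split => //; have := fine_cvg (scaled_laplace uF cv).
move=> h; apply: cvg_trans (h _); apply: near_eq_cvg; near=> s.
have s0 : 0 < s by [].
have s1 : s < 1 by near: s; exact: nbhs_right_lt.
rewrite /= fineM// ge0_fin_numE ?tu.2// gf_ge0//; exact: zle.
Unshelve. all: by end_near. Qed.

Let p1_lap j s : 0 < s -> s < 1 ->
  gf (last_weight T j) (zs s) = (\sum_(0 <= a <oo) (p1_term (zs s) j a)%:E)%E.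
Proof. by move=> s0 s1; rewrite gf_last_weight// zs_lt1. Qed.

Lemma last_weight_equiv j : equiv_at0 (laplace (fun n => (last_weight T j n)%:E))
  (fun s => @p1_const R j.+1 / s%:E)%E.
Proof.
have [C0 _ cv] := @asym_p1 R j.
apply: equiv_at0_const => //; apply: scaled_laplace cv => s s0 s1.
by rewrite laplace_gf p1_lap.
Qed.

Let p1_scaled j : exists2 c : R, @p1_const R j.+1 = c%:E &
  transformable (last_weight T j) /\
  s * fine (gf (last_weight T j) (zs s)) @[s --> (0 : R)^'+] --> c.
Proof.
have [/pos_finite[c c0 E] fin cv] := @asym_p1 R j; exists c => //.
rewrite E in cv; apply: (real_scaled (F := fun s => (\sum_(0 <= a <oo) (p1_term (zs s) j a)%:E)%E)) => //.
  exact: last_weight_ge0.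
exact: p1_lap.
Qed.

Lemma last_weight_cvg j : (last_weight T j n)%:E @[n --> \oo] --> @p1_const R j.+1.
Proof.
have [c -> [tr cv]] := p1_scaled j.
apply: cvg_EFin; first exact: nearW.
apply: slow_oscillation; first exact: karamata tr cv.
by move=> e e0; exact: last_weight_slow.
Qed.

Lemma last_weight_sum_cvg j :
  ((\sum_(i < n) last_weight T j i)%:E / n%:R%:E)%E @[n --> \oo] --> @p1_const R j.+1.
Proof.
have [c -> [tr cv]] := p1_scaled j.
apply: cvg_trans (lift_cvg (karamata tr cv)).
apply: near_eq_cvg; near=> n.
have n0 : n%:R != 0 :> R by rewrite pnatr_eq0 -lt0n; near: n; exact: nbhs_infty_gt.
by rewrite /= inver (negPf n0) -EFinM.
Unshelve. all: by end_near. Qed.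

Lemma last_weight_sum_equiv j :
  equiv_at0 (laplace (fun n => (\sum_(i < n) last_weight T j i)%:E))
    (fun s => @p1_const R j.+1 / (s ^+ 2)%:E)%E.
Proof.
have [C0 _ cv] := @asym_p1 R j; apply: equiv_at0_const => // [s s0|]; first exact: exprn_gt0.
have [c c0 E] := pos_finite C0; rewrite E in cv *.
pose F s := (\sum_(0 <= a <oo) (p1_term (zs s) j a)%:E)%E.
have c1 : (zs s * (s / (1 - zs s)))%:E @[s --> (0 : R)^'+] --> (1 * 1 : R)%:E.
  apply: cvg_EFin; first exact: nearW.
  by apply: cvgM; [exact: cvg_zs|exact: cvg_s_one_minus_zs].
rewrite mulr1 in c1.
have h : ((zs s * (s / (1 - zs s)))%:E * (s%:E * F s))%E @[s --> (0 : R)^'+] --> (1 * c%:E)%E.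
  by apply: cvgeM.
rewrite mul1e in h; apply: cvg_trans h; apply: near_eq_cvg; near=> s.
have s0 : 0 < s by [].
have s1 : s < 1 by near: s; exact: nbhs_right_lt.
rewrite laplace_gf gf_partial_sums ?zs_lt1//; last exact: last_weight_ge0.
rewrite p1_lap// !muleA -!EFinM; congr ((_)%:E * _)%E.
by rewrite expr2; ring.
Unshelve. all: by end_near. Qed.

Let p2_ge0 j n : (0 <= overshoot T j n)%E.
Proof.
apply: sume_ge0 => a _; apply: nneseries_ge0 => l _ _; rewrite lee_fin.
by case: ifP => // _; rewrite mulr_ge0// exact_ge0.
Qed.

Lemma overshoot_equiv j u : (forall n, (u n)%:E = overshoot T j n) ->
  equiv_at0 (laplace (fun n => (u n)%:E)) (fun s => @p2_const R j.+1 / s%:E)%E.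
Proof.
move=> uE; have [C0 _ cv] := @asym_p2 R j.
apply: equiv_at0_const => //; apply: scaled_laplace cv => s s0 s1.
rewrite laplace_zs -(gf_overshoot Tw (zle s) (zs_lt1 s0)).
by apply: eq_eseriesr => n _; rewrite uE.
Qed.

Lemma overshoot_cvg j u : (forall n, (u n)%:E = overshoot T j n) -> cvgn u ->
  (u n)%:E @[n --> \oo] --> @p2_const R j.+1.
Proof.
move=> uE cu; have [/pos_finite[c c0 E] fin cv] := @asym_p2 R j.
have u0 n : 0 <= u n by rewrite -lee_fin uE.
have [tr cv'] : transformable u /\ s * fine (gf u (zs s)) @[s --> (0 : R)^'+] --> c.
  rewrite E in cv; apply: (real_scaled _ _ fin cv) => // s s0 s1.
  rewrite -(gf_overshoot Tw (zle s) (zs_lt1 s0)).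
  by apply: eq_eseriesr => n _; rewrite EFinM uE.
have l0 : 0 <= limn u by apply: limr_ge => //; exact: nearW.
have lE : limn u = c / 1.
  apply: (abelian_limit (phi := id) u0 l0 (@transformable1 R) _ _ _ (@cvg_gf1 R) cv') => //.
    by near=> s.
    exact: cvg_id_right.
  apply: near_ratio => //; first exact: nearW.
  by under eq_fun do rewrite divr1.
rewrite divr1 in lE; rewrite E -lE; exact: lift_cvg.
Unshelve. all: by end_near. Qed.

Lemma last_age_equiv j : equiv_at0 (laplace (fun n => (conv qs (last_age T j) n)%:E))
  (fun s => ((Num.sqrt s)^-1 * ln ((Num.sqrt s)^-1))%:E).
Proof.
apply: cvg_trans (lift_cvg (@asym_p3 R j)).
apply: near_eq_cvg; near=> s.
have s0 : 0 < s by [].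
have s1 : s < 1 by near: s; exact: nbhs_right_lt.
rewrite laplace_gf gf_conv_last_age ?zs_lt1 ?zs_gt0//.
have [x Ex _] := p3_sum_bounds j (zs_gt0 s) (zs_lt1 s0).
have q0 : 0 < Num.sqrt s by rewrite sqrtr_gt0.
have q1 : Num.sqrt s < 1 by rewrite -[ltRHS]sqrtr1 ltr_sqrt.
have d0 : (Num.sqrt s)^-1 * ln (Num.sqrt s)^-1 != 0.
  by rewrite mulf_neq0 ?invr_neq0 ?gt_eqF// ln_gt0// invf_gt1.
by rewrite /= Ex inver (negPf d0) -!EFinM.
Unshelve. all: by end_near. Qed.

Let p3_scaled j : transformable (conv qs (last_age T j)) /\
  fine (gf (conv qs (last_age T j)) (zs s)) / ((Num.sqrt s)^-1 * ln ((Num.sqrt s)^-1))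
    @[s --> (0 : R)^'+] --> (1 : R).
Proof.
have E s : 0 < s -> gf (conv qs (last_age T j)) (zs s) =
    ((Dinf (zs s))^-1 * fine (\sum_(0 <= l <oo) (p3_term (zs s) j l)%:E)%E)%:E.
  move=> s0; rewrite gf_conv_last_age ?zs_lt1 ?zs_gt0//.
  by have [x Ex _] := p3_sum_bounds j (zs_gt0 s) (zs_lt1 s0); rewrite Ex.
split.
  split=> [n|s s0 _]; last by rewrite E// ltry.
  by apply: conv_ge0 => // i; exact: last_age_ge0.
by apply: cvg_trans (@asym_p3 R j); apply: near_eq_cvg; near=> s; rewrite E.
Unshelve. all: by end_near. Qed.

Lemma last_age_cvg j (u := conv qs (last_age T j)) :
  cvgn (fun n => Num.sqrt n%:R * u n / ln n%:R : R) ->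
  (Num.sqrt n%:R * u n / ln n%:R : R) @[n --> \oo] --> ((2 * Num.sqrt (pi : R))^-1 : R).
Proof.
move=> cu; have [[u0 tr] cv] := p3_scaled j; rewrite -/u in u0 tr cv.
have [tw cw] := @gf_log_weight R.
have E n : Num.sqrt n%:R * u n / ln n%:R = u n / log_weight n.
  by rewrite /log_weight invf_div; ring.
have pi0 : 0 < 2 * Num.sqrt (pi : R) by rewrite mulr_gt0// sqrtr_gt0 pi_gt0.
set l := limn _ in cu.
have l0 : 0 <= l.
  apply: limr_ge => //; near=> n; rewrite E divr_ge0//; exact: log_weight_ge0.
suff <- : l = (2 * Num.sqrt (pi : R))^-1 by [].
have lw : forall e : R, 0 < e -> \forall n \near \oo, `|u n - l * log_weight n| <= e * log_weight n.
  apply: near_ratio; first exact: log_weight_ge0.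
    near=> n; have n1 : (1 < n)%N by near: n; exact: nbhs_infty_gt.
    by rewrite divr_gt0 ?sqrtr_gt0 ?ltr0n ?(ltnW n1)// ln_gt0// ltr1n.
  by under eq_fun do rewrite -E.
have wpos s : 0 < s -> s < 1 -> 0 < (Num.sqrt s)^-1 * ln (Num.sqrt s)^-1.
  move=> s0 s1; have q0 : 0 < Num.sqrt s by rewrite sqrtr_gt0.
  have q1 : Num.sqrt s < 1 by rewrite -[ltRHS]sqrtr1 ltr_sqrt.
  by rewrite mulr_gt0 ?invr_gt0// ln_gt0// invf_gt1.
pose phi s : R := ((Num.sqrt s)^-1 * ln (Num.sqrt s)^-1)^-1.
have lnE s : 0 < s -> ln (Num.sqrt s)^-1 = - ln s / 2.
  move=> s0; have q0 : 0 < Num.sqrt s by rewrite sqrtr_gt0.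
  by rewrite -[in RHS](sqr_sqrtr (ltW s0)) lnXn// lnV ?posrE// -[ln _ *+ 2]mulr_natl; field.
rewrite -[RHS]div1r; apply: (abelian_limit (phi := phi) u0 l0 tw pi0 _ _ _ _ lw).
- near=> s; rewrite invr_gt0 wpos//; near: s; exact: nbhs_right_lt.
(* Once ln s <= -1, ln (1 / sqrt s) = - ln s / 2 is at least (1 - ln s) / 4, and sqrt s <= 1. *)
- apply: (@squeeze_cvgr _ _ _ _ (fun=> 0) (fun s => 4 * (1 - ln s)^-1)).
  + near=> s; have s0 : 0 < s by [].
    have s1 : s < 1 by near: s; exact: nbhs_right_lt.
    have s2 : s <= expR (-1) by near: s; apply: nbhs_right_le; exact: expR_gt0.
    have q0 : 0 < Num.sqrt s by rewrite sqrtr_gt0.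
    have q1 : Num.sqrt s <= 1 by rewrite -[leRHS]sqrtr1 ler_wsqrtr// ltW.
    have ls : ln s <= -1 by rewrite -[leRHS]expRK ler_ln ?posrE ?expR_gt0.
    rewrite invr_ge0 (ltW (wpos s s0 s1))//= /phi invfM invrK lnE//.
    apply: (@le_trans _ _ (1 * (- ln s / 2)^-1)).
      by apply: ler_wpM2r => //; rewrite invr_ge0; lra.
    rewrite mul1r -[4]invrK -invfM lef_pV2 ?posrE; [lra|lra|].
    by rewrite mulr_gt0//; lra.
  + exact: cvg_cst.
  + rewrite -[X in _ --> X](mulr0 4); apply: cvgM; [exact: cvg_cst|exact: cvg_ln_small].
- by apply: cvg_trans cw; apply: near_eq_cvg; near=> s; rewrite mulrC.
- by apply: cvg_trans cv; apply: near_eq_cvg; near=> s; rewrite mulrC.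
Unshelve. all: by end_near. Qed.


Let mean3_ge0 k n : (0 <= mean3 T k n)%E.
Proof.
apply: nneseries_ge0 => j _ _; rewrite lee_fin.
by apply: conv_ge0 => // i; exact: tail_ge0.
Qed.

Let mean2_ge0 k n : (0 <= mean2 T k n)%E.
Proof. by apply: nneseries_ge0 => j _ _; rewrite lee_fin level2_ge0. Qed.

Let scaled_mean (F G : R -> \bar R) (C : \bar R) : (0 < C < +oo)%E ->
  (forall s, 0 < s -> s < 1 -> F s = ((1 - zs s)^-1%:E * G s)%E) ->
  (s%:E * G s)%E @[s --> (0 : R)^'+] --> C ->
  ((s ^+ 2)%:E * F s)%E @[s --> (0 : R)^'+] --> C.
Proof.
move=> C0 FG cv; have [c c0 E] := pos_finite C0; rewrite E in cv *.
have c1 : (s / (1 - zs s))%:E @[s --> (0 : R)^'+] --> (1 : R)%:E.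
  by apply: cvg_EFin; [exact: nearW|exact: cvg_s_one_minus_zs].
have h : ((s / (1 - zs s))%:E * (s%:E * G s))%E @[s --> (0 : R)^'+] --> (1 * c%:E)%E.
  by apply: cvgeM.
rewrite mul1e in h; apply: cvg_trans h; apply: near_eq_cvg; near=> s.
have s0 : 0 < s by [].
have s1 : s < 1 by near: s; exact: nbhs_right_lt.
rewrite FG// !muleA -!EFinM; congr ((_)%:E * _)%E.
by rewrite expr2; ring.
Unshelve. all: by end_near. Qed.

Let mean3_scaled j :
  ((s ^+ 2)%:E * laplace (mean3 T j.+1) s)%E @[s --> (0 : R)^'+] --> @C3_const R j.+1.
Proof.
have [C0 _ cv] := @asym_C3 R j; apply: scaled_mean C0 _ cv => s s0 s1.
by rewrite laplace_zs gf_mean3// zs_lt1.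
Qed.

Lemma mean3_equiv j : equiv_at0 (laplace (mean3 T j.+1)) (fun s => @C3_const R j.+1 / (s ^+ 2)%:E)%E.
Proof.
have [C0 _ _] := @asym_C3 R j; apply: equiv_at0_const => // s s0; exact: exprn_gt0.
Qed.

Let mean2_scaled j : (0 < j)%N ->
  ((s ^+ 2)%:E * laplace (mean2 T j.+1) s)%E @[s --> (0 : R)^'+] --> @C2_const R j.+1.
Proof.
move=> j0; have [C0 _ cv] := @asym_C2 R j j0; apply: scaled_mean C0 _ cv => s s0 s1.
by rewrite laplace_zs gf_mean2// zs_lt1.
Qed.

Lemma mean2_equiv j : (0 < j)%N ->
  equiv_at0 (laplace (mean2 T j.+1)) (fun s => @C2_const R j.+1 / (s ^+ 2)%:E)%E.
Proof.
move=> j0; have [C0 _ _] := @asym_C2 R j j0.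
by apply: equiv_at0_const => // [s s0|]; [exact: exprn_gt0|exact: mean2_scaled].
Qed.

Let laplace_fine (m : nat -> \bar R) s : (forall n, m n \is a fin_num) ->
  gf (fun n => fine (m n)) (zs s) = laplace m s.
Proof. by move=> mf; rewrite laplace_zs; apply: eq_eseriesr => n _; rewrite EFinM fineK. Qed.

Let fine_scaled (m : nat -> \bar R) (c : R) :
  (forall n, 0 <= m n)%E -> (forall n, m n \is a fin_num) ->
  (forall s, 0 < s -> s < 1 -> (laplace m s < +oo)%E) ->
  ((s ^+ 2)%:E * laplace m s)%E @[s --> (0 : R)^'+] --> c%:E ->
  transformable (fun n => fine (m n)) /\
  s ^+ 2 * fine (gf (fun n => fine (m n)) (zs s)) @[s --> (0 : R)^'+] --> c.
Proof.
move=> m0 mf mlt cv; apply: (real_scaled _ _ mlt cv) => [n|s _ _]; first exact: fine_ge0.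
exact: laplace_fine.
Qed.

Let mean_lty (x : \bar R) s : 0 < s -> (x < +oo)%E ->
  ((1 - zs s)^-1%:E * x < +oo)%E.
Proof.
move=> s0 xoo; rewrite lte_mul_pinfty// lee_fin invr_ge0 subr_ge0 ltW// zs_lt1//.
Qed.

(** The bound by n makes the assumed limit finite, as the Abelian comparison with w(n) = n
    requires. *)
Lemma mean3_cvg j : (forall n, mean3 T j.+1 n <= n%:R%:E)%E ->
  cvgn (fun n => mean3 T j.+1 n / n%:R%:E)%E ->
  (mean3 T j.+1 n / n%:R%:E)%E @[n --> \oo] --> @C3_const R j.+1.
Proof.
move=> mn cu; have [/pos_finite[c c0 E] fin _] := @asym_C3 R j.
have mf n : mean3 T j.+1 n \is a fin_num.
  by rewrite ge0_fin_numE//; apply: le_lt_trans (mn n) _; rewrite ltry.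
pose u n := fine (mean3 T j.+1 n).
have u0 n : 0 <= u n by exact: fine_ge0.
have un n : u n <= n%:R by rewrite -lee_fin fineK.
have [tr cv] : transformable u /\ s ^+ 2 * fine (gf u (zs s)) @[s --> (0 : R)^'+] --> c.
  apply: fine_scaled => //; last by rewrite -E; exact: mean3_scaled.
  move=> s s0 s1; rewrite laplace_zs gf_mean3 ?zs_lt1//; apply: mean_lty => //; exact: fin.
have eqn : \forall n \near \oo, (mean3 T j.+1 n / n%:R%:E)%E = (u n / n%:R)%:E.
  near=> n; have n0 : n%:R != 0 :> R by rewrite pnatr_eq0 -lt0n; near: n; exact: nbhs_infty_gt.
  by rewrite inver (negPf n0) EFinM fineK.
set v := (fun n => _) in cu *; set l := limn v in cu.
have cl : (u n / n%:R)%:E @[n --> \oo] --> l by apply: cvg_trans cu; exact: near_eq_cvg.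
have l0 : (0 <= l)%E.
  by apply: (cvge_ge _ cl); apply: nearW => n; rewrite lee_fin divr_ge0.
have l1 : (l <= 1)%E.
  apply: (cvge_le _ cl); near=> n; have n0 : 0 < n%:R :> R by rewrite ltr0n; near: n; exact: nbhs_infty_gt.
  by rewrite lee_fin ler_pdivrMr// mul1r.
have lf : l \is a fin_num by rewrite ge0_fin_numE//; apply: le_lt_trans l1 (ltry _).
suff lE : fine l = c / 1.
  by rewrite -(fineK lf) lE divr1 -E in cu.
have r0 : 0 <= fine l by exact: fine_ge0.
apply: (abelian_limit (phi := fun s => s ^+ 2) u0 r0 (@transformable_id R) _ _ _ (@cvg_sqr_gf_id R) cv) => //.
- by near=> s; rewrite exprn_gt0.
- exact: cvg_sqr_right.
apply: near_ratio => //.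
  by near=> n; rewrite ltr0n; near: n; exact: nbhs_infty_gt.
by rewrite -(fineK lf) in cl; have := fine_cvg cl; exact.
Unshelve. all: by end_near. Qed.

Let tail_at0 i k : T i k.+1 0 = 0.
Proof. by case: Tw => _ ->; rewrite big_ord1 /= mul0r. Qed.

Let mean2_at0 k : mean2 T k.+2 0 = 0%E.
Proof.
apply: eseries0 => i _ _; rewrite /level2 /conv !big_ord1 /exact_weights !tail_at0.
by rewrite subrr !mulr0 addr0.
Qed.

(** The transform of the increments is (1 - z) / z times that of the sequence; the increments being
    nonnegative, Karamata's theorem applies to them. *)
Lemma mean2_cvg j : (0 < j)%N -> (forall n, mean2 T j.+1 n <= mean2 T j.+1 n.+1)%E ->
  (mean2 T j.+1 n / n%:R%:E)%E @[n --> \oo] --> @C2_const R j.+1.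
Proof.
move=> j0 mono; have [/pos_finite[c c0 E] fin _] := @asym_C2 R j j0.
have lty s : 0 < s -> s < 1 -> (laplace (mean2 T j.+1) s < +oo)%E.
  by move=> s0 s1; rewrite laplace_zs gf_mean2 ?zs_lt1//; apply: mean_lty => //; exact: fin.
(* An infinite value would make the transform infinite at s = 1/2. *)
have mf n : mean2 T j.+1 n \is a fin_num.
  have h0 : 0 < 2^-1 :> R by []. have h1 : 2^-1 < 1 :> R by lra.
  rewrite ge0_fin_numE// ltNge leye_eq; apply/negP => /eqP moo.
  have := lty _ h0 h1; rewrite laplace_zs ltNge => /negP; apply.
  rewrite (@nneseries_split _ _ 0%N n.+1); last by move=> i _; rewrite mule_ge0// lee_fin exprn_ge0.
  rewrite big_nat_recr//= moo gt0_mulye ?lte_fin ?exprn_gt0 ?zs_gt0//.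
  rewrite addey ?addye//.
    by rewrite gt_eqF// (@lt_le_trans _ _ 0%E)// nneseries_ge0// => i _ _; rewrite mule_ge0// lee_fin exprn_ge0.
  by rewrite gt_eqF// (@lt_le_trans _ _ 0%E)// sume_ge0// => i _; rewrite mule_ge0// lee_fin exprn_ge0.
pose u n := fine (mean2 T j.+1 n).
have [tr cv] : transformable u /\ s ^+ 2 * fine (gf u (zs s)) @[s --> (0 : R)^'+] --> c.
  by apply: fine_scaled => //; rewrite -E; exact: mean2_scaled.
pose a n := u n.+1 - u n.
have a0 n : 0 <= a n by rewrite subr_ge0 fine_le.
have uE n : u n = \sum_(i < n) a i.
  elim: n => [|n ih]; last by rewrite big_ord_recr /= -ih /a addrC subrK.
  (* The telescoping starts from the value at time 0, which vanishes because k >= 2. *)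
  by rewrite big_ord0 /u -(prednK j0) mean2_at0.
have guE s : 0 < s -> gf u (zs s) = ((zs s / (1 - zs s))%:E * gf a (zs s))%E.
  move=> s0; rewrite -(gf_partial_sums (zle s) (zs_lt1 s0) a0); congr gf.
  exact/funext.
have ta : transformable a.
  split => // s s0 s1; rewrite ltNge leye_eq; apply/negP => /eqP goo.
  have := tr.2 s s0 s1; rewrite guE// goo gt0_muley ?ltxx//.
  by rewrite lte_fin divr_gt0 ?zs_gt0// subr_gt0 zs_lt1.
have ca : s * fine (gf a (zs s)) @[s --> (0 : R)^'+] --> c.
  have h := cvgM cv (cvgM (@cvg_one_minus_zs R) (cvgV (oner_neq0 R) (@cvg_zs R))).
  rewrite invr1 !mulr1 in h; apply: cvg_trans (h _ _ _); apply: near_eq_cvg; near=> s.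
  have s0 : 0 < s by [].
  have s1 : s < 1 by near: s; exact: nbhs_right_lt.
  have zp := zs_gt0 s; have z1' : 1 - zs s != 0 by rewrite gt_eqF// subr_gt0 zs_lt1.
  have gf0 : gf a (zs s) \is a fin_num.
    by rewrite ge0_fin_numE ?ta.2// gf_ge0//; exact: zle.
  rewrite /= guE// fineM//= expr2; field.
  by rewrite z1' !gt_eqF.
rewrite E; apply: cvg_trans (lift_cvg (karamata ta ca)).
apply: near_eq_cvg; near=> n.
have n0 : n%:R != 0 :> R by rewrite pnatr_eq0 -lt0n; near: n; exact: nbhs_infty_gt.
by rewrite /= -uE inver (negPf n0) EFinM fineK.
Unshelve. all: by end_near. Qed.

(** With k = 1, level i is exceeded whenever the initial record at time 0 lasts n + i steps; the
    probabilities q(n + i) have a divergent sum. *)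
Lemma mean2_oo n : mean2 T 1 n = +oo%E.
Proof.
have q1 i : qs (n + i)%N <= level2 T 1 i n.
  apply: (@le_trans _ _ (conv (fun a => qs (maxn a i)) (exact_weights T i 0) n)).
    rewrite /conv big_ord_recr /= subnn /exact_weights tail_at0 (tail0 Tw) qs0 subr0 mulr1.
    apply: (@le_trans _ _ (qs (maxn n i))).
      by apply: qs_nonincr; rewrite geq_max leq_addr leq_addl.
    rewrite lerDr sumr_ge0// => a _; rewrite mulr_ge0//; exact: (exact_ge0 Tw).
  by rewrite lerDr conv_ge0// => a; exact: tail_ge0.
(* The sum of q over i < m is 2 m q(m) >= sqrt m, and the n terms removed are at most 1 each. *)
have large N : ((Num.sqrt N%:R - n%:R : R)%:E <= mean2 T 1 n)%E.
  apply: (@le_trans _ _ (\sum_(0 <= i < N) (level2 T 1 i n)%:E)%E); last first.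
    by apply: nneseries_lim_ge => i _ _; rewrite lee_fin level2_ge0.
  rewrite sumEFin lee_fin big_mkord.
  apply: (@le_trans _ _ (\sum_(i < N) qs (n + i)%N)); last by apply: ler_sum => i _; exact: q1.
  rewrite lerBlDl; apply: (@le_trans _ _ (\sum_(i < n + N) qs i)); last first.
    rewrite big_split_ord /= lerD2r -[leRHS](_ : \sum_(i < n) (1 : R) = _).
      by apply: ler_sum => i _; exact: qs_le1.
    by rewrite sumr_const card_ord.
  rewrite qs_sum; case: N => [|N].
    by rewrite sqrtr0 !mulr_ge0.
  set m := (n + N.+1)%N; have m0 : 0 < m%:R :> R by rewrite ltr0n /m addnS.
  have qm : 0 < Num.sqrt m%:R :> R by rewrite sqrtr_gt0.
  apply: (@le_trans _ _ (Num.sqrt m%:R)); first by rewrite ler_wsqrtr// ler_nat leq_addl.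
  have := @qs_ge R m; rewrite -(ltr0n R) => /(_ m0).
  rewrite -(ler_pM2l (_ : 0 < 2 * m%:R)); last by rewrite mulr_gt0.
  apply: le_trans; rewrite -{2}(sqr_sqrtr (ltW m0)).
  have -> : 2 * Num.sqrt m%:R ^+ 2 / (2 * Num.sqrt m%:R) = Num.sqrt m%:R :> R.
    by field; rewrite gt_eqF.
  by [].
apply/eqyP => A A0.
pose N := (Num.truncn ((A + n%:R) ^+ 2)).+1.
apply: le_trans (large N); rewrite lee_fin lerBrDr.
have An : 0 <= A + n%:R by rewrite addr_ge0// ltW.
rewrite -[leLHS]ger0_norm// -sqrtr_sqr; apply: ler_wsqrtr; apply: ltW.
by have /truncn_itv/andP[] : 0 <= (A + n%:R) ^+ 2 by exact: sqr_ge0.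
Qed.

End Conclusions.

(** * Ages of records of the walk *)

Section AgeFormulas.
Context {d : measure_display} {T : measurableType d} {R : realType}.
Variables (P : probability T R) (eta : nat -> {RV P >-> R}).
Hypotheses (eta_indep : mutually_independent eta) (eta_ident : identically_distributed eta).
Hypotheses (eta_symm : symmetric_law (eta 0)) (eta_ac : abs_continuous_law (eta 0)).
Implicit Types (e : @steps R) (a i j k l m n r u : nat).

Let L := law eta.
Local Notation pr := (pr eta).
Local Notation record_pr := (record_pr eta).
Local Notation W := (tails eta).

Let pr_stay r : stay_pr eta r = qs r.
Proof. exact: stay_prE. Qed.

Lemma prob_last_pr ages k n :
  prob_last_kth eta ages k n =
  pr (fun e => last_is_kth_longest k (ages (partial_sums e) n)).
Proof. by []. Qed.

Lemma prob_last1 k n : prob_last_kth eta ages1 k n = last_weight W k.-1 n.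
Proof.
rewrite prob_last_pr; under eq_pr do rewrite last_kth1.
rewrite (pr_state eta_indep eta_ident n (fun c b => count (ltn b) c == k.-1)).
by apply: eq_bigr => a _; rewrite record_pr_exact pr_stay mulrC.
Qed.

Lemma record_pr_last j n :
  record_pr (fun c => (c != [::]) && (count (ltn (last 0%N c)) c == j)) n = last_age W j n.
Proof.
rewrite /last_age big_ord_recl /= mul0r add0r.
case: n => [|n].
  rewrite big_ord0 -[RHS](pr_false eta); apply: eq_pr => e.
  by rewrite /completed /current.
rewrite record_pr_conv//; apply: eq_bigr => a _; rewrite /bump /= add1n subSS mulrC.
congr (_ * _); rewrite -record_pr_exact; apply: eq_pr => e; congr (_ && _).
rewrite last_rcons -size_eq0 size_rcons /= -cats1 count_cat /= ltnn !addn0.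
by congr (_ == _); apply: eq_count.
Qed.

Lemma prob_last3 k n : prob_last_kth eta ages3 k n = conv qs (last_age W k.-1) n.
Proof.
rewrite prob_last_pr; under eq_pr do rewrite last_kth3.
rewrite (pr_state eta_indep eta_ident n
  (fun c b => (c != [::]) && (count (ltn (last 0%N c)) c == k.-1))).
by apply: eq_bigr => a _; rewrite record_pr_last pr_stay mulrC.
Qed.

Let over_event k n a l e := [&& (a < l)%N, current (partial_sums e) (n - a) == 0%N,
  count (ltn l) (completed (partial_sums e) (n - a)) == k.-1 &
  hits (partial_sums e) (n - a) l].

Let pr_over k n a l : pr (over_event k n a l) =
  if (a < l)%N then fs l * exact_weights W l k.-1 (n - a) else 0.
Proof.
case: ifP => al; last first.
  by rewrite -[RHS](pr_false eta); apply: eq_pr => e; rewrite /over_event al.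
rewrite mulrC -record_pr_exact//.
rewrite -(hits_pr eta_indep eta_ident eta_symm eta_ac l).
rewrite -(pr_split eta_indep eta_ident (fun c => count (ltn l) c == k.-1) (n - a) (event_hits 0 l)).
by apply: eq_pr => e; rewrite /over_event al hits_shift.
Qed.

Let event_over k n a l : event (over_event k n a l).
Proof.
rewrite /over_event; case: (a < l)%N; last exact: event_cst.
under eq_fun do rewrite /= andbA.
apply: eventI; last exact: event_hits.
exact: (event_record _ (fun c => count (ltn l) c == k.-1)).
Qed.

Let forever n := [set e : @steps R |
  forall r, stays (partial_sums e) (n - current (partial_sums e) n) r].

Let event_stays_last n r :
  event (fun e => stays (partial_sums e) (n - current (partial_sums e) n) r).
Proof.
rewrite (_ : (fun _ => _) = (fun e => has (fun a => (current (partial_sums e) n == a) &&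
  stays (partial_sums e) (n - a) r) (iota 0 n.+1))).
  apply: event_has => a; apply: eventI; last exact: event_stays.
  exact: (event_state n (fun _ b => b == a)).
apply/funext => e; apply/idP/hasP => [h|[a _ /andP[/eqP -> //]]].
by exists (current (partial_sums e) n); rewrite ?mem_iota ?ltnS ?current_le ?eqxx.
Qed.

Let measurable_forever n : measurable (forever n).
Proof.
rewrite (_ : forever n = \bigcap_r [set e |
  stays (partial_sums e) (n - current (partial_sums e) n) r]).
  by apply: bigcapT_measurable => r; exact: event_stays_last.
by apply/seteqP; split => e h r => [_|]; exact: h.
Qed.

(** For each r the event forces a stay of r steps from one of the n + 1 possible places of the last
    record, so its probability is at most (n + 1) q(r), which tends to 0. *)
Let forever0 n : L (forever n) = 0%E.
Proof.
have bound r : (L (forever n) <= (n.+1%:R * qs r)%:E)%E.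
  pose E e := stays (partial_sums e) (n - current (partial_sums e) n) (n + r).
  have mE : event E by exact: event_stays_last.
  apply: (@le_trans _ _ (L [set e | E e])).
    by apply: le_measure; rewrite ?inE// => e h; exact: h.
  rewrite /L prE// lee_fin (@pr_partition _ _ _ _ eta E (fun e => current (partial_sums e) n) n.+1).
  - rewrite mulr_natl -[n.+1 in leRHS]card_ord -sumr_const; apply: ler_sum => a _.
    apply: (@le_trans _ _ (pr (fun e => [&& current (partial_sums e) (n - a) == 0%N, xpredT (completed (partial_sums e) (n - a)) & stays (partial_sums e) (n - a) r]))).
      apply: pr_mono.
      + under eq_fun do rewrite /E.
        rewrite (_ : (fun _ => _) = (fun e => (current (partial_sums e) n == a) && stays (partial_sums e) (n - a) (n + r))).
          apply: eventI; last exact: event_stays.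
          exact: (event_state n (fun _ b => b == a)).
        by apply/funext => e; case: eqP => //= ->.
      + apply: eventI; last by under eq_fun do rewrite andTb; exact: event_stays.
        exact: (event_state _ (fun _ b => b == 0%N)).
      + move=> e /andP[ca st].
        have := event_split (partial_sums e) (fun _ _ => true) (_ : (a <= n)%N).
        rewrite -ltnS => /(_ (ltn_ord a)); rewrite ca /= => /esym/andP[-> _] /=.
        by move: st; rewrite /E (eqP ca); apply: stays_le; rewrite leq_addl.
    apply: (@le_trans _ _ (record_pr xpredT (n - a) * stay_pr eta r)).
      by rewrite -(pr_stays eta_indep eta_ident).
    by rewrite pr_stay ler_piMl// record_prE// pr_stay qs_le1.
  - move=> a; apply: (eventI _ mE).
    exact: (event_state n (fun _ b => b == a)).
  - by move=> e _; rewrite ltnS current_le.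
apply/eqP; rewrite eq_le measure_ge0 andbT; apply/lee_addgt0Pr => eps eps0; rewrite add0e.
have [r hr] : exists r, n.+1%:R * qs r <= eps :> R.
  pose t := eps / n.+1%:R.
  have t0 : 0 < t by rewrite divr_gt0.
  pose r := (Num.truncn (t ^- 2)).+1.
  exists r; rewrite mulrC -ler_pdivlMr// -/t.
  apply: le_trans (qs_le _) _.
  have rt : t ^- 2 < r%:R.
    by have /truncn_itv/andP[] : 0 <= t ^- 2 by rewrite invr_ge0 sqr_ge0.
  have r0 : 0 < 2 * r%:R + 1 :> R by have := ler0n R r; lra.
  rewrite -[leRHS]invrK lef_pV2 ?posrE ?sqrtr_gt0 ?invr_gt0//.
  rewrite -[leLHS]ger0_norm ?invr_ge0 ?(ltW t0)// -sqrtr_sqr; apply: ler_wsqrtr.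
  by rewrite exprVn; have := ler0n R r; lra.
exact: le_trans (bound r) _.
Qed.

(** Outside the null event [forever n], the event is the disjoint union, over the current age a and
    the eventual age l > a of the last record, of the events [over_event]. *)
Lemma prob_last2 k n : (prob_last_kth eta ages2 k n)%:E = overshoot W k.-1 n.
Proof.
rewrite prob_last_pr.
pose Q e := last_is_kth_longest k (ages2 (partial_sums e) n).
pose H a := \bigcup_l [set e | over_event k n a l e].
have mH a : measurable (H a) by apply: bigcupT_measurable => l; exact: event_over.
pose U := \big[setU/set0]_(a < n.+1) H a.
have overQ a l e : (a <= n)%N -> over_event k n a l e ->
    current (partial_sums e) n = a /\ Q e.
  move=> an /and4P[al c0 ck h].
  have := event_split (partial_sums e) (fun c b => count (ltn l) c == k.-1) an.
  have st : stays (partial_sums e) (n - a) a by rewrite (hits_stays _ h).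
  rewrite c0 ck st => /andP[/eqP ca cn]; split => //.
  by rewrite /Q (@last_kth2 _ _ _ _ l)// ca.
have QU e : Q e -> U e \/ forever n e.
  move=> Qe; have [[l h]|h] := hits_or_stays (partial_sums e) (n - current (partial_sums e) n);
    last by right.
  left; have an := current_le (partial_sums e) n.
  pose a := Ordinal (an : current (partial_sums e) n < n.+1)%N.
  rewrite /U -bigcup_mkord; exists (current (partial_sums e) n) => //; exists l => //.
  have [st _] := state_last (partial_sums e) n.
  have al : (current (partial_sums e) n < l)%N by rewrite -(hits_stays _ h).
  have := event_split (partial_sums e) (fun c b => count (ltn l) c == k.-1) an.
  rewrite eqxx /= -(last_kth2 k h) -/(Q e) Qe => /esym/and3P[c0 ck _].
  by rewrite /over_event /= al c0 ck.
have UQ e : U e -> Q e.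
  by rewrite /U -bigcup_mkord => -[a /= an [l _ /overQ]] => /(_ an)[].
have mU : measurable U by apply: bigsetU_measurable.
have QE : [set e | Q e] = U `|` ([set e | Q e] `&` forever n).
  apply/seteqP; split => e.
    by move=> Qe; case: (QU e Qe); [left|right].
  by move=> [/UQ//|[]].
(* On [forever n] the last age is infinite and no other exceeds it, so the event there is everything
   or nothing; this settles measurability. *)
have Qf : [set e | Q e] `&` forever n = if k.-1 == 0%N then forever n else set0.
  have fQ e : forever n e -> Q e = (k.-1 == 0%N).
    move=> h; rewrite /Q ages2E /last_is_kth_longest last_rcons -size_eq0 size_rcons /=.
    rewrite -cats1 count_cat waiting_time_stays// /= ?ltxx !addn0.
    rewrite count_map (eq_count (a2 := pred0)) ?count_pred0 1?eq_sym//.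
  apply/seteqP; split => e /=.
    by move=> [Qe h]; have := fQ e h; rewrite Qe; case: eqP.
  case: eqP => // k0 h; split => //; rewrite (fQ e h); exact/eqP.
have mQf : measurable ([set e | Q e] `&` forever n).
  by rewrite Qf; case: ifP => _ //; exact: measurable_forever.
have mQ : event Q by rewrite /event QE; apply: measurableU.
have LQ : L [set e | Q e] = L U.
  have f0 : L ([set e | Q e] `&` forever n) = 0%E.
    apply/eqP; rewrite eq_le measure_ge0 andbT -(forever0 n).
    by apply: le_measure; rewrite ?inE.
  by rewrite QE measureU0.
rewrite -prE// -/L LQ /U measure_bigsetU_ord//; last first.
  apply/trivIsetP => a b _ _ ab; apply/seteqP; split => // e [[l _ /overQ ha] [m _ /overQ hb]].
  have [ea _] := ha (ltn_ord a); have [eb _] := hb (ltn_ord b).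
  by case/eqP: ab; apply/val_inj; rewrite /= -ea.
apply: eq_bigr => a _.
transitivity (\sum_(0 <= l <oo) L [set e | over_event k n a l e])%E; last first.
  by apply: eq_eseriesr => l _; rewrite /L prE// pr_over.
apply: measure_semi_bigcup.
- by move=> l; exact: event_over.
- apply/trivIsetP => l m _ _ lm; apply/seteqP; split => // e [/and4P[_ _ _ h1] /and4P[_ _ _ h2]].
  have := hits_stays l h1; rewrite ltnn => h; have := hits_stays m h1.
  have := hits_stays m h2; rewrite ltnn => ->; have := hits_stays l h2; rewrite h => h3 h4.
  by case/eqP: lm; apply/eqP; rewrite eqn_leq leqNgt -h4 /= leqNgt -h3.
- exact: mH.
Qed.

Let level (ages : (nat -> R) -> nat -> seq (\bar R)) k n j e :=
  (k <= count (fun y => (j%:R)%:E < y)%E (ages (partial_sums e) n))%N.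

Lemma mean_sum ages k n : (0 < k)%N ->
  (forall (x : nat -> R) y, y \in ages x n -> nat_or_oo y) ->
  (forall j, event (level ages k n j)) ->
  mean_kth_largest eta ages k n = (\sum_(0 <= j <oo) (pr (level ages k n j))%:E)%E.
Proof.
move=> k0 an ev; rewrite /mean_kth_largest.
have mB j : measurable [set w | level ages k n j (step_path eta w)].
  rewrite -[X in measurable X]setTI; exact: (measurable_step_path eta measurableT (ev j)).
transitivity (\int[P]_w (\sum_(0 <= j <oo)
    (\1_[set w | level ages k n j (step_path eta w)] w : R)%:E))%E.
  apply: eq_integral => w _; rewrite kth_largest_sum; [|exact: k0|exact: an].
  apply: eq_eseriesr => j _; rewrite indicE; congr ((_ : bool)%:R)%:E.
  by apply/idP/idP => [h|/set_mem//]; exact: mem_set.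
rewrite integral_nneseries//; last first.
  by move=> j; apply/measurable_EFinP; exact: measurable_indic.
apply: eq_eseriesr => j _; rewrite integral_indic// setIT.
by rewrite -(prE eta (ev j)).
Qed.

Lemma mean_kth3 k n : (0 < k)%N -> mean_kth_largest eta ages3 k n = mean3 W k n.
Proof.
move=> k0; have E j : level ages3 k n j = (fun e => k <= count (ltn j) (completed (partial_sums e) n))%N.
  by apply/funext => e; rewrite /level count_ages3.
rewrite mean_sum//; last 2 first.
- by move=> x y; exact: ages3_nat.
- by move=> j; rewrite E; exact: (event_state n (fun c _ => k <= count (ltn j) c)%N).
apply: eq_eseriesr => j _; rewrite E; congr EFin.
rewrite (pr_state eta_indep eta_ident n (fun c _ => k <= count (ltn j) c)%N).
by apply: eq_bigr => a _; rewrite pr_stay mulrC.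
Qed.

Let event_level2 k n j : event (level ages2 k n j).
Proof.
pose E a e := [&& current (partial_sums e) n == a, (k <= count (ltn j) (completed (partial_sums e) n))%N & true]
  || [&& current (partial_sums e) n == a, (k <= (count (ltn j) (completed (partial_sums e) n)).+1)%N
    & stays (partial_sums e) (n - a) j].
rewrite (_ : level _ _ _ _ = (fun e => has (E^~ e) (iota 0 n.+1))).
  apply: event_has => a; apply: eventU; rewrite /E; under eq_fun do rewrite /= andbA.
    by apply: eventI; [exact: (event_state n (fun c b => (b == a) && (k <= count (ltn j) c)%N))|exact: event_cst].
  apply: eventI; last exact: event_stays.
  exact: (event_state n (fun c b => (b == a) && (k <= (count (ltn j) c).+1)%N)).
apply/funext => e; rewrite /level count_ages2; apply/idP/hasP => [h|[a _]].
  exists (current (partial_sums e) n); first by rewrite mem_iota ltnS current_le.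
  by rewrite /E eqxx /=; move: h; case: (stays _ _ _); rewrite ?addn1 ?addn0 => ->; rewrite ?orbT.
rewrite /E => /orP[/and3P[_ h _]|/and3P[/eqP -> h ->]]; last by rewrite addn1.
exact: leq_trans h (leq_addr _ _).
Qed.

Lemma pr_level2 k n j : (0 < k)%N -> pr (level ages2 k n j) = level2 W k j n.
Proof.
move=> k0.
rewrite (@pr_partition _ _ _ _ eta _ (fun e => current (partial_sums e) n) n.+1); last 2 first.
- move=> a; apply: eventI; last exact: event_level2.
  exact: (event_state n (fun _ b => b == a)).
- by move=> e _; rewrite ltnS current_le.
rewrite /level2 /conv [X in _ + X](reindex_inj rev_ord_inj) /=.
rewrite [X in X + _](reindex_inj rev_ord_inj) /=.
rewrite (reindex_inj rev_ord_inj) /= -big_split /=.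
apply: eq_bigr => b _; rewrite subSS; set a := (n - b)%N.
have an : (a <= n)%N by exact: leq_subr.
have -> : (n - a)%N = b by rewrite subKn// -ltnS.
rewrite -!pr_stay mulrC [X in _ + X]mulrC -record_pr_exact// -!pr_stays//.
rewrite -prD; last 3 first.
- under eq_fun do rewrite andbA.
  by apply: eventI; [exact: (event_record _ (fun c => k <= count (ltn j) c)%N)|exact: event_stays].
- under eq_fun do rewrite andbA.
  by apply: eventI; [exact: (event_record _ (fun c => count (ltn j) c == k.-1)%N)|exact: event_stays].
- move=> e /and3P[_ h _]; apply/negP => /and3P[_ /eqP h' _].
  by move: h; rewrite h' -{1}(prednK k0) ltnn.
apply: eq_pr => e.
have := event_split (partial_sums e) (fun c _ => (k <= count (ltn j) c + stays (partial_sums e) b j)%N) an.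
have -> : (n - a)%N = b by rewrite subKn// -ltnS.
rewrite /level count_ages2 => h.
transitivity ((current (partial_sums e) n == a) &&
  (k <= count (ltn j) (completed (partial_sums e) n) + stays (partial_sums e) b j)%N).
  by case: eqP => //= ->; rewrite subKn// -ltnS.
rewrite h; case: (_ == 0%N) => //=.
(* A stay of a steps says that the record at b is still the last one at time n, a stay of j steps
   that its age exceeds j. *)
have -> : stays (partial_sums e) b (maxn a j) = stays (partial_sums e) b a && stays (partial_sums e) b j.
  apply/idP/andP => [st|[s1 s2]]; last by case: (leqP a j).
  by split; apply: stays_le st; rewrite ?leq_maxl ?leq_maxr.
case: (stays _ _ a); rewrite ?andbT ?andbF //=.
case: (stays _ _ j); rewrite ?andbT ?andbF ?orbF ?addn0 ?addn1//.
rewrite -{1}(prednK k0) ltnS leq_eqVlt prednK// orbC; congr (_ || _).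
by rewrite eq_sym.
Qed.

Lemma mean_kth2 k n : (0 < k)%N -> mean_kth_largest eta ages2 k n = mean2 W k n.
Proof.
move=> k0; rewrite mean_sum//; last first.
- by move=> x y; exact: ages2_nat.
by apply: eq_eseriesr => j _; rewrite pr_level2.
Qed.

(** The second sequence never loses an element: a record at n + 1 confirms the age already
    attributed to its predecessor and adds a new one. *)
Lemma mean_kth2_mono k n : (0 < k)%N -> (mean2 W k n <= mean2 W k n.+1)%E.
Proof.
move=> k0; apply: lee_nneseries => [j _ _|j _].
  by rewrite lee_fin level2_ge0//; exact: tails_weights.
rewrite lee_fin -!pr_level2//; apply: pr_mono; try exact: event_level2.
move=> e; rewrite /level !count_ages2 => h; apply: leq_trans h _.
rewrite /current /completed stateS; case: ltP => h /=.
  have [st _] := state_last (partial_sums e) n.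
  have hi : hits (partial_sums e) (n - current (partial_sums e) n) (current (partial_sums e) n).+1.
    by rewrite /hits /= st addnS subnK ?current_le.
  by rewrite (hits_stays _ hi) -cats1 count_cat /= addn0 leq_addr.
by rewrite subSS.
Qed.

Let event_level1 k n j : event (level ages1 k n j).
Proof.
rewrite (_ : level _ _ _ _ = (fun e => (k <= count (ltn j) (completed (partial_sums e) n) + (j < current (partial_sums e) n))%N)).
  exact: (event_state n (fun c b => k <= count (ltn j) c + (j < b))%N).
by apply/funext => e; rewrite /level count_ages1.
Qed.

(** From n to n + 1 the count above level j grows only when the current age at n is j, and it
    reaches k exactly when k - 1 completed ages are longer. Summed over j this is p_k^(1)(n). *)
Let pr_level1 k n j : (0 < k)%N -> pr (level ages1 k n.+1 j) = pr (level ages1 k n j) +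
  pr (fun e => (current (partial_sums e) n == j) && (count (ltn (current (partial_sums e) n)) (completed (partial_sums e) n) == k.-1)).
Proof.
move=> k0; rewrite -prD//; last first.
- move=> e; rewrite /level count_ages1 => h; apply/negP => /andP[/eqP cj].
  rewrite cj => /eqP h'; move: h; rewrite h' cj ltnn addn0.
  by rewrite leqNgt prednK// leqnn.
- exact: (event_state n (fun c b => (b == j) && (count (ltn b) c == k.-1))).
apply: eq_pr => e; rewrite /level !count_ages1.
set a := current _ n; set c := completed _ n.
have -> : (count (ltn j) (completed (partial_sums e) n.+1) + (j < current (partial_sums e) n.+1) =
    count (ltn j) c + (j < a.+1))%N.
  rewrite /current /completed stateS; case: ltP => _ //=.
  by rewrite -cats1 count_cat /= !addn0.
case: (eqVneq a j) => [<-|aj] /=; last first.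
  have -> : (j < a.+1)%N = (j < a)%N by rewrite ltnS leq_eqVlt [j == a]eq_sym (negPf aj).
  by rewrite orbF.
rewrite ltnSn ltnn addn0 addn1 -{1}(prednK k0) ltnS leq_eqVlt prednK// orbC; congr (_ || _).
by rewrite eq_sym.
Qed.

Lemma mean_kth1 k n : (0 < k)%N ->
  mean_kth_largest eta ages1 k n = (\sum_(i < n) prob_last_kth eta ages1 k i)%:E.
Proof.
move=> k0; rewrite mean_sum//; last first.
- by move=> x y; exact: ages1_nat.
elim: n => [|n ih].
  rewrite big_ord0 eseries0// => j _ _; congr EFin; rewrite -[RHS](pr_false eta).
  by apply: eq_pr => e; rewrite /level count_ages1 /completed /current /= leqn0 gtn_eqF.
under eq_eseriesr do rewrite pr_level1// EFinD.
rewrite nneseriesD; [|by move=> j _ _; rewrite lee_fin pr_ge0|by move=> j _ _; rewrite lee_fin pr_ge0].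
rewrite ih big_ord_recr /= EFinD; congr (_ + _)%E.
rewrite (finite_nneseries (N := n.+1)) => [|j nj]; last first.
  rewrite -[RHS](pr_false eta); apply: eq_pr => e; apply/negbTE; rewrite negb_and.
  by rewrite neq_ltn (leq_ltn_trans (current_le _ _) nj).
congr EFin; rewrite prob_last_pr; symmetry.
under eq_pr do rewrite last_kth1.
rewrite (@pr_partition _ _ _ _ eta _ (fun e => current (partial_sums e) n) n.+1)//.
- by move=> a; exact: (event_state n (fun c b => (b == a) && (count (ltn b) c == k.-1))).
- by move=> e _; rewrite ltnS current_le.
Qed.

(** The third sequence is the first without its last element, and E L_k^(1)(n) is a sum of n
    probabilities. *)
Lemma mean3_le k n : (0 < k)%N -> (mean3 W k n <= n%:R%:E)%E.
Proof.
move=> k0; rewrite -mean_kth3//.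
apply: (@le_trans _ _ (mean_kth_largest eta ages1 k n)).
  have E j : level ages3 k n j = (fun e => k <= count (ltn j) (completed (partial_sums e) n))%N.
    by apply/funext => e; rewrite /level count_ages3.
  have e3 j : event (level ages3 k n j).
    by rewrite E; exact: (event_state n (fun c _ => k <= count (ltn j) c)%N).
  rewrite !mean_sum//; [|by move=> x y; exact: ages1_nat|by move=> x y; exact: ages3_nat].
  apply: lee_nneseries => [j _ _|j _]; first by rewrite lee_fin pr_ge0.
  rewrite lee_fin; apply: pr_mono => // e.
  by rewrite E /level count_ages1 => h; exact: leq_trans h (leq_addr _ _).
rewrite mean_kth1// lee_fin -[n in leRHS]card_ord -sumr_const; apply: ler_sum => i _.
rewrite prob_last1 -(@qs_conv R i); apply: ler_sum => a _; apply: ler_wpM2l => //.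
by apply: exact_le; exact: tails_weights.
Qed.

End AgeFormulas.

Local Open Scope ereal_scope.

Theorem theorem2 (d : measure_display) (T : measurableType d) (R : realType)
    (P : probability T R) (eta : nat -> {RV P >-> R})
    (eta_indep : mutually_independent eta)
    (eta_ident : identically_distributed eta)
    (eta_symm : symmetric_law (eta 0%N))
    (eta_ac : abs_continuous_law (eta 0%N))
    (k : nat) (k_ge1 : (1 <= k)%N) :
  let p1 := prob_last_kth eta ages1 k in
  let p2 := prob_last_kth eta ages2 k in
  let p3 := prob_last_kth eta ages3 k in
  let EL1 := mean_kth_largest eta ages1 k in
  let EL2 := mean_kth_largest eta ages2 k in
  let EL3 := mean_kth_largest eta ages3 k in
  (* (a) *)
  (equiv_at0 (laplace (fun n => (p1 n)%:E)) (fun s => p1_const k / s%:E) /\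
   equiv_at0 (laplace (fun n => (p2 n)%:E)) (fun s => p2_const k / s%:E) /\
   equiv_at0 (laplace (fun n => (p3 n)%:E))
     (fun s => ((Num.sqrt s)^-1 * ln ((Num.sqrt s)^-1))%:E)) /\
  (* (b) *)
  ((p1 n)%:E @[n --> \oo] --> p1_const k /\
   (cvgn p2 -> (p2 n)%:E @[n --> \oo] --> p2_const k) /\
   (cvgn (fun n => Num.sqrt n%:R * p3 n / ln n%:R : R)%R ->
    (Num.sqrt n%:R * p3 n / ln n%:R : R)%R @[n --> \oo]
      --> ((2 * Num.sqrt (pi : R))^-1 : R)%R /\
    (p3 n / (ln n%:R / (2 * Num.sqrt (pi * n%:R))) : R)%R @[n --> \oo]
      --> (1 : R)%R)) /\
  (* (c) *)
  (equiv_at0 (laplace EL1) (fun s => C1_const k / (s ^+ 2)%:E) /\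
   (k <> 1%N -> equiv_at0 (laplace EL2) (fun s => C2_const k / (s ^+ 2)%:E)) /\
   equiv_at0 (laplace EL3) (fun s => C3_const k / (s ^+ 2)%:E)) /\
  (* (d) *)
  (EL1 n / n%:R%:E @[n --> \oo] --> C1_const k /\
   (k <> 1%N -> EL2 n / n%:R%:E @[n --> \oo] --> C2_const k) /\
   (cvgn (fun n => EL3 n / n%:R%:E) ->
    EL3 n / n%:R%:E @[n --> \oo] --> C3_const k)) /\
  (* the case beta = 2, k = 1 *)
  (k = 1%N -> @C2_const R k = +oo /\ forall n : nat, EL2 n = +oo).
Proof.
move=> p1 p2 p3 EL1 EL2 EL3.
have Tw := tails_weights eta_indep eta_ident eta_symm eta_ac.
case: k k_ge1 @p1 @p2 @p3 @EL1 @EL2 @EL3 => // j _ p1 p2 p3 EL1 EL2 EL3.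
have p1E : p1 = last_weight (tails eta) j by apply/funext => n; exact: prob_last1.
have p2E n : (p2 n)%:E = overshoot (tails eta) j n by exact: prob_last2.
have p3E : p3 = conv qs (last_age (tails eta) j) by apply/funext => n; exact: prob_last3.
have EL1E : EL1 = (fun n => (\sum_(i < n) last_weight (tails eta) j i)%R%:E).
  by apply/funext => n; rewrite [LHS]mean_kth1// -/p1 p1E.
have EL2E : EL2 = mean2 (tails eta) j.+1 by apply/funext => n; exact: mean_kth2.
have EL3E : EL3 = mean3 (tails eta) j.+1 by apply/funext => n; exact: mean_kth3.
have j0 : j.+1 <> 1%N -> (0 < j)%N by case: (j).
split; [|split; [|split; [|split]]].
- split; [|split].
  + by rewrite p1E; exact: last_weight_equiv.
  + exact: (overshoot_equiv Tw p2E).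
  + by rewrite p3E; exact: last_age_equiv.
- split; [|split].
  + by rewrite p1E; exact: last_weight_cvg.
  + exact: (overshoot_cvg Tw p2E).
  + rewrite p3E => cu; have cl := last_age_cvg Tw cu; split => //.
    have q0 : (0 < Num.sqrt (pi : R))%R by rewrite sqrtr_gt0 pi_gt0.
    have c : ((2 * Num.sqrt (pi : R)) * (Num.sqrt n%:R * conv qs (last_age (tails eta) j) n / ln n%:R) : R)%R @[n --> \oo]
        --> (2 * Num.sqrt (pi : R) * (2 * Num.sqrt (pi : R))^-1 : R)%R.
      by apply: cvgM; [exact: cvg_cst|exact: cl].
    rewrite divff in c; last by rewrite gt_eqF// mulr_gt0.
    apply: cvg_trans c; apply: near_eq_cvg; near=> n.
    by rewrite sqrtrM ?pi_ge0// invf_div; ring.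
- split; [|split].
  + by rewrite EL1E; exact: last_weight_sum_equiv.
  + by move=> /j0 j1; rewrite EL2E; exact: mean2_equiv.
  + by rewrite EL3E; exact: mean3_equiv.
- split; [|split].
  + by rewrite EL1E; exact: last_weight_sum_cvg.
  + move=> /j0 j1; rewrite EL2E; apply: mean2_cvg => // n.
    exact: (mean_kth2_mono eta_indep eta_ident eta_symm eta_ac).
  + rewrite EL3E; apply: mean3_cvg => // n.
    exact: (mean3_le eta_indep eta_ident eta_symm eta_ac).
- rewrite EL2E => -[->]; split => [|n]; first exact: C2_const1.
  exact: (mean2_oo Tw).
Unshelve. all: by end_near. Qed.
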